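(* Let $S$ be a countable (infinite) set with rates $c_{x,y}\in[0,+\infty)$, $x\ne y$ in $S$ (not necessarily symmetric), satisfying Assumption SEP. Then the family $\{\mathbb P^\sigma:\sigma\in\{0,1\}^S\}$ of probability measures on the filtered measurable space $(D_{\{0,1\}^S},(\mathcal F_t)_{t\ge0},\mathcal F)$, defined by the graphical construction, is a Markov process (called the simple exclusion process with rates $c_{x,y}$), i.e. (i) $\mathbb P^\sigma(\eta_0=\sigma)=1$ for all $\sigma\in\{0,1\}^S$; (ii) for any $A\in\mathcal F$ the function $\{0,1\}^S\ni\sigma\mapsto\mathbb P^\sigma(A)\in[0,1]$ is measurable; (iii) for any $\sigma\in\{0,1\}^S$, $t\ge 0$ and $A\in\mathcal F$ it holds $\mathbb P^\sigma(\eta_{t+\cdot}\in A\,|\,\mathcal F_t)=\mathbb P^{\eta_t}(A)$, $\mathbb P^\sigma$-a.s.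
   Context: Setting. $S$ is a countable (infinite) set; $\mathcal E_S^o:=\{(x,y):x\ne y,\ x,y\in S\}$ (ordered pairs), $\mathcal E_S:=\{\{x,y\}:x\neq y,\ x,y\in S\}$ (unordered pairs). To each $(x,y)\in\mathcal E_S^o$ is associated $c_{x,y}\in[0,+\infty)$, not assumed symmetric; $c_{x,x}:=0$; $c^s_{x,y}:=c_{x,y}+c_{y,x}$. Path spaces. For a metric space $W$, $D_W=D(\mathbb R_+,W)$ is the space of càdlàg paths $\mathbb R_+=[0,+\infty)\to W$ with the Skorohod topology and its Borel $\sigma$-algebra. $\mathbb N=\{0,1,\dots\}$ is discrete; $\{0,1\}^S$ has the product topology. $D_{\mathbb N}^{\mathcal E_S^o}$ has the product topology, with generic element $\mathcal K=(\mathcal K_{x,y})_{(x,y)\in\mathcal E_S^o}$. $\mathbb P$ is the law on $D_{\mathbb N}^{\mathcal E_S^o}$ of a family $(N_{x,y}(\cdot))_{(x,y)\in\mathcal E_S^o}$ of independent Poisson processes, $N_{x,y}$ having intensity $c_{x,y}$ and $N_{x,y}(0)=0$. For $\{x,y\}\in\mathcal E_S$, $\mathcal K^s_{x,y}(t):=\mathcal K_{x,y}(t)+\mathcal K_{y,x}(t)$. Assumption SEP: there exists $t_0>0$ such that for $\mathbb P$-a.a. $\mathcal K$ the undirected graph $\mathcal G_{t_0}(\mathcal K)$ with vertex set $S$ and edge set $\{\{x,y\}\in\mathcal E_S:\mathcal K^s_{x,y}(t_0)>\mathcal K^s_{x,y}(0)\}$ has only connected components of finite cardinality. Such a $t_0$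 is fixed. For $r\in\mathbb N$, $\mathcal G^r_{t_0}(\mathcal K)$ is the graph with vertex set $S$ and edge set $\{\{x,y\}\in\mathcal E_S:\mathcal K^s_{x,y}((r+1)t_0)>\mathcal K^s_{x,y}(rt_0)\}$, and $\Gamma_r$ is the set of $\mathcal K$ for which $\mathcal G^r_{t_0}(\mathcal K)$ has only finite connected components. $\Gamma_*$ is the set of $\mathcal K\in D_{\mathbb N}^{\mathcal E_S^o}$ such that: (i) $\mathcal K\in\cap_{r\in\mathbb N}\Gamma_r$; (ii) $\sum_{y\in S\setminus\{x\}}\mathcal K^s_{x,y}(t)<+\infty$ for all $x\in S$, $t\in\mathbb R_+$; (iii) for $(x,y)\ne(x',y')$ in $\mathcal E^o_S$ the sets of jump times of $\mathcal K_{x,y}$ and $\mathcal K_{x',y'}$ are disjoint, and all jumps equal $+1$; (iv) $\mathcal K_{x,y}(0)=0$ for all $(x,y)\in\mathcal E^o_S$. $\Gamma_*$ is Borel and $\mathbb P(\Gamma_* )=1$. Graphical construction. For $\mathcal K\in\Gamma_*$ and $\sigma\in\{0,1\}^S$ define $(\eta^\sigma_t[\mathcal K])_{t\ge0}$ iteratively: $\eta^\sigma_0[\mathcal K]:=\sigma$. If defined up to time $rt_0$, $r\in\mathbb N$, for each (finite) connected component $C$ of $\mathcal G^r_{t_0}(\mathcal K)$ let $s_1<\dots<s_k$ be the times $s\in(rt_0,(r+1)t_0]$ at which $\mathcal K_{x,y}(s)=\mathcal K_{x,y}(s-)+1$ for some $x\neq y$ in $C$. On $C$, start from $\eta^\sigma_{rt_0}[\mathcal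 K]$ and, successively at $s=s_1,\dots,s_k$, move a particle from $x$ to $y$ ($x\ne y$ in $C$) if just before time $s$ site $x$ is occupied and $y$ is empty, and $\mathcal K_{x,y}(s)=\mathcal K_{x,y}(s-)+1$ (at most one such pair exists); between these times the configuration on $C$ is constant. This defines $\eta^\sigma_t[\mathcal K]$ for $t\in(rt_0,(r+1)t_0]$. The path $\eta^\sigma_\cdot[\mathcal K]$ belongs to $D_{\{0,1\}^S}$ and is measurable in $\mathcal K$. $\mathcal F$ is the Borel $\sigma$-algebra of $D_{\{0,1\}^S}$; $\mathcal F_t$ is generated by the coordinate maps $\eta_\cdot\mapsto\eta_s$, $s\in[0,t]$. $\mathbb P^\sigma(A):=\mathbb P(\mathcal K\in\Gamma_*:\eta^\sigma_\cdot[\mathcal K]\in A)$ for $A\in\mathcal F$. *)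

(* Defs.v *)
From HB Require Import structures.
From mathcomp Require Import all_boot all_order all_algebra finmap.
From mathcomp Require Import all_classical all_reals all_analysis.
From mathcomp Require Import measurable_realfun.

Set Implicit Arguments.
Unset Strict Implicit.
Unset Printing Implicit Defensive.

Import Order.TTheory GRing.Theory Num.Theory.
Import numFieldNormedType.Exports.

Local Open Scope classical_set_scope.
Local Open Scope ring_scope.

Definition borel (T : ptopologicalType) := g_sigma_algebraType (@open T).

HB.instance Definition _ (T : ptopologicalType) := Measurable.on (borel T).

Lemma maxr0_ge0 (R : realType) (t : R) : 0 <= Num.max 0 t.
Proof. by rewrite le_max lexx. Qed.

(* A function on [0, +oo[ is read as a function on R that is constant on
   ]-oo, 0]; in particular its left limit at 0 is its value at 0, and 0 is
   never a jump time. *)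
Definition extend (R : realType) (W : Type) (f : {nonneg R} -> W) (t : R) : W :=
  f (NngNum (maxr0_ge0 t)).

Definition is_cadlag (R : realType) (W : ptopologicalType)
    (f : {nonneg R} -> W) : Prop :=
  forall t : R, 0 <= t ->
    (extend f x @[x --> t^'+] --> extend f t) /\
    cvg (extend f x @[x --> t^'-]).

Record cadlag (R : realType) (W : ptopologicalType) : Type := Cadlag {
  cadlag_fun : {nonneg R} -> W ;
  cadlagP : is_cadlag cadlag_fun }.

Definition path_at (R : realType) (W : ptopologicalType) (w : cadlag R W) :
  R -> W := extend (cadlag_fun w).
Coercion path_at : cadlag >-> Funclass.

Definition left_lim (R : realType) (W : ptopologicalType) (w : cadlag R W)
  (t : R) : W := lim (w x @[x --> t^'-]).

Definition jump_times (R : realType) (W : ptopologicalType)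
    (w : cadlag R W) : set R :=
  [set s | w s <> left_lim w s].

HB.instance Definition _ (R : realType) (W : ptopologicalType) :=
  gen_eqMixin (cadlag R W).
HB.instance Definition _ (R : realType) (W : ptopologicalType) :=
  gen_choiceMixin (cadlag R W).

Lemma is_cadlag_cst (R : realType) (W : ptopologicalType) :
  is_cadlag (fun _ : {nonneg R} => point : W).
Proof.
move=> t _; split; first exact: cvg_cst.
by apply/cvg_ex; exists point; exact: cvg_cst.
Qed.

HB.instance Definition _ (R : realType) (W : ptopologicalType) :=
  isPointed.Build (cadlag R W) (Cadlag (@is_cadlag_cst R W)).

Definition time_change (R : realType) (lam : R -> R) : Prop :=
  {in `[0, +oo[ &, {homo lam : x y / x < y}} /\
  lam @` `[0, +oo[%classic = `[0, +oo[%classic.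

Definition skorohod_nbhd (R : realType) (W : puniformType) (w : cadlag R W)
    (T e : R) (E : set (W * W)) : set (cadlag R W) :=
  [set v | exists2 lam : R -> R, time_change lam &
     forall s, 0 <= s <= T -> `|lam s - s| < e /\ E (w (lam s), v s)].

(* The Skorohod (J1) topology: [v_n] converges to [w] iff for all [T] there
   are time changes [lam_n] such that [lam_n s - s] tends to 0 and
   the distance between [w (lam_n s)] and [v_n s] tends to 0, both uniformly
   for [s] in [0, T] (Ethier-Kurtz, Markov Processes, Proposition 3.5.3 (c));
   the metric of [W] enters only through its uniformity. *)
Definition skorohod_open (R : realType) (W : puniformType)
    (U : set (cadlag R W)) : Prop :=
  forall w, U w -> exists T e : R, exists2 E : set (W * W),
    0 < e /\ entourage E & skorohod_nbhd w T e E `<=` U.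

Lemma skorohod_openT (R : realType) (W : puniformType) :
  skorohod_open [set: cadlag R W].
Proof. by move=> w _; exists 0, 1, setT => //; split => //; exact: filterT. Qed.

Lemma skorohod_openI (R : realType) (W : puniformType) :
  setI_closed (@skorohod_open R W).
Proof.
move=> U V oU oV w [/oU[T1 [e1 [E1 [e10 F1] sU]]] /oV[T2 [e2 [E2 [e20 F2] sV]]]].
exists (Num.max T1 T2), (Num.min e1 e2), (E1 `&` E2).
  by split; [rewrite lt_min e10 e20|exact: filterI].
move=> v [lam tc h]; split; [apply: sU|apply: sV]; exists lam => // s /andP[s0 sT].
  have /h[+ []] : 0 <= s <= Num.max T1 T2 by rewrite s0 le_max sT.
  by rewrite lt_min => /andP[].
have /h[+ []] : 0 <= s <= Num.max T1 T2 by rewrite s0 le_max sT orbT.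
by rewrite lt_min => /andP[].
Qed.

Lemma skorohod_open_bigU (R : realType) (W : puniformType) (I : Type)
    (f : I -> set (cadlag R W)) :
  (forall i, skorohod_open (f i)) -> skorohod_open (\bigcup_i f i).
Proof.
move=> of_ w [i _ /of_ [T [e [E eE sf]]]].
by exists T, e, E => // v /sf fv; exists i.
Qed.

HB.instance Definition _ (R : realType) (W : puniformType) :=
  isOpenTopological.Build (cadlag R W) (@skorohod_openT R W)
    (@skorohod_openI R W) (@skorohod_open_bigU R W).

Lemma is_cadlag_shift (R : realType) (W : ptopologicalType) (t : {nonneg R})
    (w : cadlag R W) : is_cadlag (fun s : {nonneg R} => w (t%:num + s%:num)).
Proof.
have shE x : 0 <= x ->
    extend (fun s : {nonneg R} => w (t%:num + s%:num)) x = w (t%:num + x).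
  by move=> x0; rewrite /extend /= max_r.
move=> s s0; have [wr wl] := cadlagP w (addr_ge0 (ge0 t) s0).
split.
  rewrite shE//; apply: (@cvg_trans _ (w (t%:num + x) @[x --> s^'+])).
    apply: near_eq_cvg; near=> x; rewrite shE//.
    by apply: (le_trans s0); apply: ltW; near: x; exact: nbhs_right_gt.
  apply: cvg_comp wr => A.
  case=> e e0 h; exists e => // x /= xs sx.
  by apply: h; [rewrite /ball_ /= opprD addrACA subrr add0r|rewrite ltrD2l].
have [s_gt0|s_le0] := ltP 0 s; last first.
  have {s0 s_le0 wr wl} -> : s = 0 by apply/le_anti; rewrite s_le0 s0.
  apply/cvg_ex; exists (w t%:num).
  apply: cvg_near_cst; near=> x.
  have x0 : x <= 0 by apply: ltW; near: x; exact: nbhs_left_lt.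
  by rewrite /extend /= max_l// addr0.
move/cvg_ex : wl => [l wl]; apply/cvg_ex; exists l.
apply: (@cvg_trans _ (w (t%:num + x) @[x --> s^'-])).
  apply: near_eq_cvg; near=> x; rewrite shE//.
  by apply: ltW; near: x; exact: nbhs_left_gt.
apply: cvg_comp wl => A.
case=> e e0 h; exists e => // x /= xs sx.
by apply: h; [rewrite /ball_ /= opprD addrACA subrr add0r|rewrite ltrD2l].
Unshelve. all: by end_near. Qed.

Definition time_shift (R : realType) (W : ptopologicalType) (t : {nonneg R})
  (w : cadlag R W) : cadlag R W := Cadlag (is_cadlag_shift t w).

Definition natural_filtration (R : realType) (W : ptopologicalType) (t : R) :
    set (set (cadlag R W)) :=
  <<s [set A | exists2 s : R, 0 <= s <= t &
         exists2 B : set (borel W), measurable B &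
           A = (fun w : cadlag R W => w s : borel W) @^-1` B] >>.

(* [Z] is a version of the conditional probability of [E] given the
   sigma-algebra [G]. *)
Definition cond_prob (d : measure_display) (T : measurableType d)
    (R : realType) (P : probability T R) (G : set (set T)) (E : set T)
    (Z : T -> \bar R) : Prop :=
  [/\ forall Y : set (\bar R), measurable Y -> G (Z @^-1` Y),
      P.-integrable setT Z &
      forall B, G B -> (\int[P]_(x in B) Z x)%E = P (B `&` E)].

Definition markov_process (R : realType) (W : puniformType)
    (Q : W -> probability (borel (cadlag R W)) R) : Prop :=
  [/\ forall x : W, Q x [set w | w 0 = x] = 1%E,
      forall A : set (borel (cadlag R W)), measurable A ->
        measurable_fun setT ((fun x => Q x A) : borel W -> \bar R) &
      forall (x : W) (t : {nonneg R}) (A : set (borel (cadlag R W))),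
        measurable A ->
        exists2 Z : cadlag R W -> \bar R,
          cond_prob (Q x) (@natural_filtration R W t%:num) (time_shift t @^-1` A) Z &
          {ae Q x, forall w : borel (cadlag R W), Z w = Q (w t%:num) A}].

Definition opair (S : eqType) := {p : S * S | p.1 != p.2}.

Definition driving (R : realType) (S : eqType) : Type :=
  prod_topology (fun _ : opair S => cadlag R nat).
HB.instance Definition _ (R : realType) (S : eqType) :=
  Topological.on (driving R S).
HB.instance Definition _ (R : realType) (S : eqType) := Pointed.on (driving R S).

Definition config (S : Type) : Type := {ptws S -> bool}.
HB.instance Definition _ (S : Type) := Uniform.on (config S).
HB.instance Definition _ (S : Type) := Pointed.on (config S).

Section poisson.
Context {R : realType} {S : countType}.
Variable P : probability (borel (driving R S)) R.

Definition poisson_weight (m : R) (k : nat) : R :=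
  expR (- m) * m ^+ k / (k`!)%:R.

Definition increment_event (p : opair S) (s t : R) (k : nat) :
    set (borel (driving R S)) :=
  [set K | K p t = (K p s + k)%N].

Definition poisson_coordinate (p : opair S) (lambda : R) : Prop :=
  [/\ P [set K | K p 0 = 0%N] = 1%E,
      forall (s t : R) (k : nat), 0 <= s <= t ->
        P (increment_event p s t k) = (poisson_weight (lambda * (t - s)) k)%:E &
      forall (n : nat) (u : nat -> R) (k : nat -> nat),
        0 <= u 0%N -> {homo u : i j / (i <= j)%N >-> i <= j} ->
        P (\bigcap_(i < n) increment_event p (u i) (u i.+1) (k i)) =
        (\prod_(i < n) P (increment_event p (u i) (u i.+1) (k i)))%E].

Definition independent_coordinates : Prop :=
  forall (s : seq (opair S)) (B : opair S -> set (borel (cadlag R nat))),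
    uniq s -> (forall p, measurable (B p)) ->
    P [set K | forall p, p \in s -> B p (K p)] =
    (\prod_(p <- s) P [set K | B p (K p)])%E.

(* [P] is the law of independent Poisson processes with intensities [c p]. *)
Definition poisson_law (c : opair S -> R) : Prop :=
  (forall p, poisson_coordinate p (c p)) /\ independent_coordinates.

End poisson.

Section graphical_construction.
Context {R : realType} {S : countType}.
Implicit Types (K : driving R S) (zeta : config S) (C : set S) (s t : R).

Definition counter K (x y : S) t : nat :=
  if insub (x, y) is Some p then K p t else 0%N.

Definition sym_count K x y t : nat := (counter K x y t + counter K y x t)%N.

Definition edge K s t : rel S :=
  fun x y => (x != y) && (sym_count K x y s < sym_count K x y t)%N.

Definition component (e : rel S) (x : S) : set S :=
  [set y | exists2 p, path e x p & y = last x p].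

Definition finite_components (e : rel S) : Prop :=
  forall x, finite_set (component e x).

Definition edge_slot t0 K (r : nat) : rel S :=
  edge K (r%:R * t0) (r.+1%:R * t0).

Definition sep_assumption (P : probability (borel (driving R S)) R) t0 : Prop :=
  {ae P, forall K, finite_components (edge K 0 t0)}.

Definition rings_at K (p : opair S) s : Prop := K p s = (left_lim (K p) s).+1.

Definition Gamma_star t0 : set (driving R S) :=
  [set K | [/\ forall r, finite_components (edge_slot t0 K r),
      forall x t, 0 <= t ->
        (\esum_(y in [set y | y != x]) ((sym_count K x y t)%:R : R)%:E < +oo)%E,
      (forall p q, p != q -> jump_times (K p) `&` jump_times (K q) = set0) /\
      (forall p s, jump_times (K p) s -> rings_at K p s) &
      forall p, K p 0 = 0%N]].

Definition inside C (p : opair S) : Prop := C (val p).1 /\ C (val p).2.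

Definition move_particle zeta (p : opair S) : config S :=
  fun z => if z == (val p).1 then false
           else if z == (val p).2 then true else zeta z.

Definition allowed K C s zeta : set (opair S) :=
  [set p | [/\ inside C p, rings_at K p s, zeta (val p).1 & ~~ zeta (val p).2]].

Definition update K C zeta s : config S :=
  if pselect (exists p, allowed K C s zeta p) is left ex
  then move_particle zeta (projT1 (cid ex)) else zeta.

Definition update_times K C s t : seq R :=
  sort <=%O (fset_set
    [set u | s < u <= t /\ exists2 p, inside C p & rings_at K p u]).

(* Evolution from the configuration [zeta] at time [r * t0] up to a time
   [t] in the slot [r * t0, (r + 1) * t0]; the value at [x] is computed in the
   component of [x]. *)
Definition evolve t0 K (r : nat) zeta t : config S :=
  fun x => let C := component (edge_slot t0 K r) x in
    foldl (update K C) zeta (update_times K C (r%:R * t0) t) x.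

Fixpoint eta_grid t0 K (sigma : config S) (r : nat) : config S :=
  if r is r'.+1 then evolve t0 K r' (eta_grid t0 K sigma r') (r%:R * t0)
  else sigma.

(* For [t > 0] the slot of [t] is the [r] with [r * t0 < t <= (r + 1) * t0];
   at [t = 0] no update occurs and the value is [sigma]. *)
Definition eta t0 K (sigma : config S) t : config S :=
  let r := `|Num.ceil (t / t0)|%N.-1 in
  evolve t0 K r (eta_grid t0 K sigma r) t.

Definition graphical_law (P : probability (borel (driving R S)) R) t0
    (sigma : config S) (A : set (cadlag R (config S))) : \bar R :=
  P [set K | Gamma_star t0 K /\
       exists2 w, A w & forall t, 0 <= t -> w t = eta t0 K sigma t].

End graphical_construction.

(* Main.v *)
Require Import Defs.
From mathcomp Require Import all_boot all_order all_algebra finmap.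
From mathcomp Require Import all_classical all_reals all_analysis.
From mathcomp Require Import measurable_realfun ring lra zify.

Set Implicit Arguments.
Unset Strict Implicit.
Unset Printing Implicit Defensive.

Import Order.TTheory GRing.Theory Num.Theory.
Import numFieldNormedType.Exports.

Local Open Scope classical_set_scope.
Local Open Scope ring_scope.

(** The exclusion process is a deterministic function of the Poisson paths, and
    its Markov property combines a flow property of that function with the
    independence and stationarity of Poisson increments.

    Events.  The Borel sets of trajectory space are generated by the values at
    single times and sites ([skorohod_open_coord]).  Indeed the restriction of
    a trajectory to finitely many sites is a step function, and up to a fixed
    time it can be enclosed by finitely many rational prescriptions such that
    any other trajectory obeying them is obtained by a small change of time.
    Hence an open set is a countable union of sets defined by coordinates, and
    statements about all Borel sets reduce to cylinders by a pi-lambda argument.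

    Dynamics.  The state of a site at time [t] is determined by a finite region:
    its component in the last time slot, then the components of these sites in
    the previous slot, and so on down to time 0.  The relevant jumps are finitely
    many and occur at distinct times, so a fine partition of [0, t] separates
    them, and it suffices to know which counters increase over each of its
    intervals ([approximable_eta]).  Any fine partition containing the slot
    endpoints will do, and any finite set of pairs of sites that is large
    enough.  Therefore the state at time [t] is an event of the past of [t]
    ([eta_past]), it depends continuously on the initial configuration
    ([eta_continuous]), and restarting the construction at time [t] from the
    state reached there, with the increments after [t] as driving paths, gives
    the same trajectory ([eta_flow]), although the two constructions use slots
    with different endpoints: a partition may contain both kinds of endpoints.

    Probability.  The conditions defining the good driving paths can be read on
    countably many counts ([Gamma_starE]), hence they are measurable.  Poisson
    estimates on dyadic grids show that all jumps are unit jumps and that no two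
    counters jump together; the finiteness of components is assumed for the
    first slot and follows for the others from stationarity ([full_Gamma]).
    Two pi-lambda extensions turn the product formulas for Poisson increments
    into the independence of the increments after time [t] from the past of [t]
    ([increments_independent]).

    Conclusion.  For a cylinder event, replace the configuration at time [t] by
    its restriction to the first [m] sites.  This takes countably many values,
    and on each of them independence gives the Markov property
    ([markov_truncated]).  Let [m] tend to infinity, using the continuity in the
    initial configuration and dominated convergence ([markov_cylinder]), and
    extend to all Borel events ([sep_law_markov]). *)

(** * Closure properties of sigma-algebras *)
Section sigma_tools.
Context {T : Type} (G : set (set T)).
Hypothesis sG : sigma_algebra setT G.

Lemma salg0 : G set0. Proof. by case: sG. Qed.

Lemma salgC A : G A -> G (~` A).
Proof. by case: sG => _ + _ => /[apply]; rewrite setTD. Qed.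

Lemma salgT : G setT. Proof. by rewrite -setC0; exact/salgC/salg0. Qed.

Lemma salg_ex (I : countType) (F : I -> T -> Prop) :
  (forall i, G [set x | F i x]) -> G [set x | exists i, F i x].
Proof.
move=> GF; case: sG => G0 _ GU.
pose F' n : set T := if @choice.unpickle I n is Some i then [set x | F i x] else set0.
have -> : [set x | exists i, F i x] = \bigcup_n F' n.
  apply/seteqP; split => x /=.
    by move=> [i Fi]; exists (choice.pickle i) => //; rewrite /F' choice.pickleK.
  by move=> [n _]; rewrite /F'; case: choice.unpickle => // i Fi; exists i.
by apply: GU => n; rewrite /F'; case: choice.unpickle.
Qed.

Lemma salg_all (I : countType) (F : I -> T -> Prop) :
  (forall i, G [set x | F i x]) -> G [set x | forall i, F i x].
Proof.
move=> GF; have -> : [set x | forall i, F i x] = ~` [set x | exists i, ~ F i x].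
  apply/seteqP; split => x /=; first by move=> h [i]; exact.
  by move=> h i; apply: contrapT => nF; apply: h; exists i.
by apply: salgC; apply: salg_ex => i; exact: salgC (GF i).
Qed.

Lemma salgU A B : G A -> G B -> G (A `|` B).
Proof.
move=> GA GB; have -> : A `|` B = [set x | exists b : bool, (if b then A else B) x].
  by apply/seteqP; split => x /=; [case=> h; [exists true|exists false]|
    move=> [[] h]; [left|right]].
by apply: salg_ex => -[].
Qed.

Lemma salgI A B : G A -> G B -> G (A `&` B).
Proof.
by move=> GA GB; rewrite -(setCK (A `&` B)) setCI; apply/salgC/salgU; exact: salgC.
Qed.

Lemma salg_imply (p : Prop) (A : set T) : (p -> G A) -> G [set x | p -> A x].
Proof.
move=> h; have [hp|np] := pselect p.
  have -> : [set x | p -> A x] = A by apply/seteqP; split => x /=; [exact|].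
  exact: h.
have -> : [set x | p -> A x] = setT by apply/seteqP; split => // x _ /np.
exact: salgT.
Qed.

Lemma salg_and (p : Prop) (A : set T) : (p -> G A) -> G [set x | p /\ A x].
Proof.
move=> h; have [hp|np] := pselect p.
  have -> : [set x | p /\ A x] = A by apply/seteqP; split => x /= => [[]|].
  exact: h.
have -> : [set x | p /\ A x] = set0 by apply/seteqP; split => x //= -[].
exact: salg0.
Qed.

Lemma salg_cst (p : Prop) : G [set _ | p].
Proof.
have [hp|np] := pselect p.
  have -> : [set _ | p] = [set: T] by apply/seteqP; split.
  exact: salgT.
have -> : [set _ | p] = (set0 : set T) by apply/seteqP; split.
exact: salg0.
Qed.

Lemma salg_all_seq (I : eqType) (s : seq I) (F : I -> T -> Prop) :
  (forall i, i \in s -> G [set x | F i x]) ->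
  G [set x | forall i, i \in s -> F i x].
Proof.
elim: s => [|i s ih] h.
  have -> : [set x | forall i, i \in [::] -> F i x] = setT.
    by apply/seteqP; split.
  exact: salgT.
have -> : [set x | forall j, j \in i :: s -> F j x] =
    [set x | F i x] `&` [set x | forall j, j \in s -> F j x].
  apply/seteqP; split => x /=.
    by move=> hx; split => [|j js]; apply: hx; rewrite inE ?eqxx ?js ?orbT.
  by move=> [h1 h2] j; rewrite inE => /predU1P[->|] //; exact: h2.
apply: salgI; first by apply: h; rewrite inE eqxx.
by apply: ih => j js; apply: h; rewrite inE js orbT.
Qed.

Definition cmeas (A : countType) (f : T -> A) :=
  forall a, G [set x | f x = a].

Lemma cmeas_pred (A : countType) (f : T -> A) (B : A -> Prop) :
  cmeas f -> G [set x | B (f x)].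
Proof.
move=> mf; have -> : [set x | B (f x)] = [set x | exists a, B a /\ f x = a].
  by apply/seteqP; split => x /=; [exists (f x)|move=> [a [Ba ->]]].
by apply: salg_ex => a; apply: salg_and => _; exact: (mf a).
Qed.

Lemma cmeas_comp (A B : countType) (f : T -> A) (h : A -> B) :
  cmeas f -> cmeas (h \o f).
Proof. by move=> mf b; exact: (cmeas_pred (fun a => h a = b) mf). Qed.

Lemma cmeas_pair (A B : countType) (f : T -> A) (g : T -> B) :
  cmeas f -> cmeas g -> cmeas (fun x => (f x, g x)).
Proof.
move=> mf mg [a b].
have -> : [set x | (f x, g x) = (a, b)] = [set x | f x = a] `&` [set x | g x = b].
  by apply/seteqP; split => x /= => [[-> ->]|[-> ->]].
by apply: salgI; [exact: mf|exact: mg].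
Qed.

Lemma cmeas_cst (A : countType) (a : A) : cmeas (fun _ => a).
Proof. by move=> b; exact: salg_cst. Qed.

Lemma cmeas2 (A B C : countType) (h : A -> B -> C) (f : T -> A) (g : T -> B) :
  cmeas f -> cmeas g -> cmeas (fun x => h (f x) (g x)).
Proof.
by move=> mf mg; exact: (cmeas_comp (fun ab => h ab.1 ab.2) (cmeas_pair mf mg)).
Qed.

Lemma cmeas_map (I : Type) (A : countType) (s : seq I) (f : I -> T -> A) :
  (forall i, cmeas (f i)) -> cmeas (fun x => [seq f i x | i <- s]).
Proof.
move=> mf; elim: s => [|i s ih] /=; first exact: cmeas_cst.
exact: cmeas2.
Qed.

(** Everything that is determined by a measurable countable observation is
    measurable; this avoids writing [h] as an explicit function of [V]. *)
Lemma cmeas_factor (A B : countType) (V : T -> A) (h : T -> B) : cmeas V ->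
  (forall x y, V x = V y -> h x = h y) -> cmeas h.
Proof.
move=> mV Vh b.
have -> : [set x | h x = b] = [set x | exists a, (exists2 y, V y = a & h y = b) /\ V x = a].
  apply/seteqP; split => x /=; first by move=> hx; exists (V x); split => //; exists x.
  by move=> [a [[y Vy <-] Vx]]; apply: Vh; rewrite Vy.
by apply: salg_ex => a; apply: salg_and => _; exact: (mV a).
Qed.

End sigma_tools.

Lemma preimage_salg (T T' : Type) (f : T -> T') (G : set (set T)) : sigma_algebra setT G ->
  sigma_algebra setT [set B | G (f @^-1` B)].
Proof.
move=> sG; split => /=.
- by rewrite preimage_set0; exact: salg0.
- by move=> A GA; rewrite setTD; exact: (salgC sG GA).
- by move=> F GF; case: sG => _ _; apply.
Qed.

(** Used with [D] of probability one: an event about [f] is then known to belong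
    to [G] up to a null set, which need not itself belong to [G]. *)
Lemma trace_salg (T T' : Type) (D : set T) (f : T -> T') (G : set (set T)) :
  sigma_algebra setT G ->
  sigma_algebra setT [set B | exists2 B', G B' & forall u, D u -> B (f u) <-> B' u].
Proof.
move=> sG; split => /=.
- by exists set0; [exact: salg0|].
- move=> A [A' GA h]; exists (~` A'); first exact: (salgC sG GA).
  move=> x Dx; split=> [[_ nA] /(h x Dx)//|nA]; split => // Af.
  by apply: nA; apply/(h x Dx).
- move=> F hF; have /choice[F' hF'] : forall n, exists B', G B' /\ forall u, D u ->
  F n (f u) <-> B' u.
    by move=> n; have [B' GB h] := hF n; exists B'.
  exists (\bigcup_n F' n); first by case: sG => _ _; apply => n; have [] := hF' n.
  by move=> x Dx; split => -[n _ h]; exists n => //; have [_ hn] := hF' n; apply/(hn x Dx).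
Qed.

Lemma borel_salg (T : ptopologicalType) :
  sigma_algebra setT (measurable : set (set (borel T))).
Proof. exact: sigma_algebra_measurable. Qed.

(** * Step functions of a real variable *)
Section step_functions.
Context {R : realType}.

(** Compactness of intervals as an induction principle: the supremum of the
    points reached from [a] is reached, and cannot lie before [b]. *)
Lemma interval_ind (P : R -> R -> Prop) :
  (forall a m b : R, 0 <= a -> a <= m -> m <= b -> P a m -> P m b -> P a b) ->
  (forall s : R, 0 <= s -> exists2 d : R, 0 < d &
     forall a b : R, 0 <= a -> s - d < a -> a <= s -> s <= b -> b < s + d -> P a b) ->
  forall a b : R, 0 <= a -> a <= b -> P a b.
Proof.
move=> Ptr Ploc a b a0 ab.
pose E := [set x | a <= x <= b /\ P a x].
have Paa : P a a.
  by have [d d0 h] := Ploc _ a0; apply: h => //; rewrite ?gtrBl ?ltrDl.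
have Ea : E a by split => //; rewrite lexx ab.
have supE : has_sup E.
  by split; [exists a|exists b => x [/andP[]]].
have as_ : a <= sup E by apply: sup_upper_bound.
have sb : sup E <= b by apply: ge_sup => [|x [/andP[]]//]; exists a.
have s0 := le_trans a0 as_.
have [d d0 h] := Ploc _ s0.
have [x Ex xs] := sup_adherent d0 supE.
have xs' : x <= sup E by apply: sup_upper_bound.
case: Ex => /andP[ax xb] Pax.
pose s' := Num.min b (sup E + d / 2).
have ss' : sup E <= s' by rewrite /s' le_min sb lerDl divr_ge0 // ltW.
have Pas' : P a s'.
  apply: (Ptr a x) => //; first exact: le_trans ss'.
  apply: h => //; first exact: le_trans ax.
  by rewrite gt_min; apply/orP; right; rewrite ltrD2l gtr_pMr// invf_lt1 ?ltr1n.
have Es' : E s'.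
  by split => //; rewrite (le_trans as_ ss') /s' ge_min lexx.
have s's : s' <= sup E by apply: sup_upper_bound.
have <- // : s' = b.
have [lt|lt] := leP b (sup E + d / 2); first by rewrite /s' min_l.
by have s'E : s' = sup E + d / 2 := min_r (ltW lt); lra.
Qed.

(** Lebesgue's number lemma, for the covering of [0, T] by the neighbourhoods in
    which all pairs are good. *)
Lemma lebesgue_gap (good : R -> R -> Prop) :
  (forall s : R, 0 <= s -> exists2 d : R, 0 < d &
     forall u v : R, 0 <= u -> s - d < u -> u <= v -> v < s + d -> good u v) ->
  forall T : R, exists2 d : R, 0 < d &
     forall u v : R, 0 <= u -> u <= v -> v <= T -> v - u < d -> good u v.
Proof.
move=> gl T; pose Q (t : R) := exists2 d : R, 0 < d &
     forall u v : R, 0 <= u -> u <= v -> v <= t -> v - u < d -> good u v.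
have Q0 : Q 0.
  have [d d0 h] := gl 0 (lexx _); exists d => // u v u0 uv v0 _; apply: h => //; lra.
have [T0|T0] := leP 0 T; last by exists 1 => // u v u0 uv vT _; lra.
suff : Q 0 -> Q T by exact.
apply: (interval_ind (P := fun a b => Q a -> Q b)) => //.
  by move=> a m b _ _ _ h1 h2 /h1 /h2.
move=> s s0; have [d d0 h] := gl s s0.
exists (d / 2); first by rewrite divr_gt0.
move=> a b a0 sa as_ sb bs [e e0 he]; exists (Num.min e (d / 2)).
  by rewrite lt_min e0 divr_gt0.
move=> u v u0 uv vb; rewrite lt_min => /andP[ve vd].
have [va|av] := leP v a; first exact: he.
by apply: h => //; lra.
Qed.

(** [f] may jump at [s] itself, from [a] to [f s]. *)
Definition step_at (A : Type) (f : R -> A) (s d : R) (a : A) : Prop :=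
  (forall u : R, s <= u -> u < s + d -> f u = f s) /\
  (forall u : R, s - d < u -> u < s -> f u = a).

Definition stepfun (A : Type) (f : R -> A) : Prop :=
  forall s : R, 0 <= s -> exists (d : R) a, 0 < d /\ step_at f s d a.

Lemma stepfun_cadlag (W : ptopologicalType) (A : Type) (pi : W -> A) (w : cadlag R W) :
  (forall z, nbhs z [set y | pi y = pi z]) -> stepfun (fun t => pi (w t)).
Proof.
move=> npi s s0; have [wr wl] := cadlagP w s0.
have [e e0 he] := wr _ (npi _); have [e' e'0 he'] := wl _ (npi _).
exists (Num.min e e'), (pi (lim (extend (cadlag_fun w) x @[x --> s^'-]))).
split; first by rewrite lt_min e0 e'0.
split => u.
  rewrite le_eqVlt => /predU1P[<- //|su us]; apply: he => //=.
  have : u < s + e by rewrite (lt_le_trans us)// lerD2l ge_min lexx.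
  by move=> ?; rewrite distrC ger0_norm; lra.
move=> us su; apply: he' => //=.
have : s - e' < u by rewrite (le_lt_trans _ us)// lerD2l lerN2 ge_min lexx orbT.
by move=> ?; rewrite ger0_norm; lra.
Qed.

Lemma nbhs_nat (n : nat) (A : set nat) : A n -> nbhs n A.
Proof. by move=> An; rewrite nbhs_principalE; exact/principal_filterP. Qed.

Lemma stepfun_nat (w : cadlag R nat) : stepfun w.
Proof. by apply: (@stepfun_cadlag _ _ id) => z; exact: nbhs_nat. Qed.

Lemma left_limE (w : cadlag R nat) s d a : 0 < d ->
  (forall u : R, s - d < u -> u < s -> w u = a) -> left_lim w s = a.
Proof.
move=> d0 h; apply: cvg_lim; first exact: discrete_hausdorff.
apply: (@cvg_near_cst _ _ _ _ _ _ _) => //.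
near=> u; apply: h; last by near: u; exact: nbhs_left_lt.
by near: u; apply: nbhs_left_gt; lra.
Unshelve. all: by end_near. Qed.

Lemma path_le0 (W : ptopologicalType) (w : cadlag R W) t : t <= 0 -> w t = w 0.
Proof.
move=> t0; rewrite /path_at /extend; congr (cadlag_fun w _).
by apply/val_inj => /=; rewrite max_l// maxxx.
Qed.

End step_functions.

(** * Counting paths *)
Section nat_paths.
Context {R : realType}.
Implicit Types w : cadlag R nat.

Lemma left_lim_step w s : 0 <= s ->
  exists d : R, 0 < d /\ step_at w s d (left_lim w s).
Proof.
move=> s0; have [d [a [d0 h]]] := stepfun_nat w s0.
by exists d; split => //; rewrite (@left_limE _ w s d a) //; case: h.
Qed.

Lemma jump_gt0 w s : jump_times w s -> 0 < s.
Proof.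
move=> js; rewrite ltNge; apply/negP => s0; apply: js.
rewrite (@left_limE _ w s 1 (w 0)) ?ltr01 // ?(path_le0 w s0) // => u _ us.
by rewrite path_le0 //; lra.
Qed.

Lemma rings_jump w s : w s = (left_lim w s).+1 -> jump_times w s.
Proof. by rewrite /jump_times /= => ->; apply/eqP; rewrite eqn_leq ltnn. Qed.

Lemma no_jump_cst w a b : 0 <= a -> a <= b ->
  (forall s : R, a < s -> s <= b -> ~ jump_times w s) -> w a = w b.
Proof.
apply: (interval_ind (P := fun a b =>
  (forall s : R, a < s -> s <= b -> ~ jump_times w s) -> w a = w b)).
  move=> {}a m {}b a0 am mb h1 h2 h; rewrite h1 ?h2 // => s sa sb; apply: h; lra.
move=> s s0; have [d [d0 [h1 h2]]] := left_lim_step w s0.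
exists d => // {}a {}b a0 da as_ sb bd h.
rewrite (h1 b)//; move: as_; rewrite le_eqVlt => /predU1P[->//|as_].
by rewrite (h2 a)//; apply: esym; apply: contrapT; exact: h.
Qed.

Lemma jump_isolated w s : 0 <= s ->
  exists2 d : R, 0 < d & forall u, s - d < u -> u < s + d -> jump_times w u -> u = s.
Proof.
move=> s0; have [d [d0 [h1 h2]]] := left_lim_step w s0.
exists d => // u du ud ju; apply: contrapT => us; apply: ju.
have [lt|ge] := ltP u s.
  rewrite (@left_limE _ w u (u - (s - d)) (left_lim w s)) ?subr_gt0//.
    by apply: h2; lra.
  by move=> v v1 v2; apply: h2; lra.
have {us ge}lt : s < u by rewrite lt_neqAle ge andbT; apply/eqP => e; exact: us.
rewrite (@left_limE _ w u (u - s) (w s)) ?subr_gt0//.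
  by apply: h1; lra.
by move=> v v1 v2; apply: h1; lra.
Qed.

Lemma finite_jumps w a b : 0 <= a -> a <= b ->
  finite_set [set s | a < s <= b /\ jump_times w s].
Proof.
apply: (interval_ind (P := fun a b =>
  finite_set [set s | a < s <= b /\ jump_times w s])).
  move=> {}a m {}b a0 am mb h1 h2.
  apply: (@sub_finite_set _ _ ([set s | a < s <= m /\ jump_times w s] `|`
    [set s | m < s <= b /\ jump_times w s])); last by rewrite finite_setU.
  move=> s /= [/andP[sa sb] js]; have [sm|ms] := leP s m; [left|right];
  by split => //; apply/andP; split.
move=> s s0; have [d d0 hd] := jump_isolated w s0.
exists d => // {}a {}b a0 da as_ sb bd.
apply: (@sub_finite_set _ _ [set s]); last exact: finite_set1.
by move=> u /= [/andP[au ub] ju]; apply: hd => //; lra.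
Qed.

Lemma jump_mono w : (forall s : R, jump_times w s -> w s = (left_lim w s).+1) ->
  forall a b : R, 0 <= a -> a <= b -> (w a <= w b)%N.
Proof.
move=> h; apply: (interval_ind (P := fun a b => (w a <= w b)%N)).
  by move=> a m b _ _ _; exact: leq_trans.
move=> s s0; have [d [d0 [h1 h2]]] := left_lim_step w s0.
exists d => // a b a0 da as_ sb bd; rewrite (h1 b)//.
move: as_; rewrite le_eqVlt => /predU1P[->//|as_]; rewrite (h2 a)//.
have [js|/contrapT ->//] := pselect (jump_times w s).
by rewrite h.
Qed.

Lemma mono_left_lim w u s : (forall a b : R, 0 <= a -> a <= b -> (w a <= w b)%N) ->
  0 <= u -> u < s -> (w u <= left_lim w s)%N /\ (left_lim w s <= w s)%N.
Proof.
move=> mw u0 us; have s0 : 0 <= s by lra.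
have [d [d0 [_ h2]]] := left_lim_step w s0.
pose v := Num.max u (s - d / 2).
have vs : v < s by rewrite gt_max us/=; lra.
have uv : u <= v by rewrite le_max lexx.
have dv : s - d / 2 <= v by rewrite le_max lexx orbT.
rewrite -(h2 v)//; last by lra.
by split; apply: mw => //; lra.
Qed.

End nat_paths.

(** * Coordinates are Borel on Skorohod space *)
Section coordinates_measurable.
Context {R : realType} {W : puniformType} {A : Type} (pi : W -> A).
Hypothesis ent_pi : entourage [set p : W * W | pi p.1 = pi p.2].

Lemma nbhs_pi z : nbhs z [set y | pi y = pi z].
Proof.
have : nbhs z (xsection [set p : W * W | pi p.1 = pi p.2] z).
  by apply: nbhs_entourage.
by apply: filterS => y; rewrite /xsection/= inE /= => ->.
Qed.

Lemma stepfun_pi (w : cadlag R W) : stepfun (fun t => pi (w t)).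
Proof. by apply: stepfun_cadlag => z; exact: nbhs_pi. Qed.

(** Evaluation at a fixed time is not continuous for the Skorohod topology, but
    being constant on an open interval survives small changes of time. *)
Lemma skorohod_closed_cst (t e : R) (a : A) : 0 <= t ->
  skorohod_open (~` [set w : cadlag R W | forall s : R, t < s -> s < t + e -> pi (w s) = a]).
Proof.
move=> t0 w /= /existsNP[s0 /not_implyP[ts0 /not_implyP[st0 wa]]].
exists (s0 + 1), (Num.min 1 (Num.min (s0 - t) (t + e - s0))),
  [set p : W * W | pi p.1 = pi p.2].
  by split => //; rewrite !lt_min ltr01 !subr_gt0 ts0.
move=> v /= [lam [lamm lamim] h] hv; apply: wa.
have : (lam @` `[0, +oo[%classic) s0 by rewrite lamim /= in_itv /= andbT; lra.
move=> [s]; rewrite /= in_itv /= andbT => s_ge0 lams.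
have sT : s <= s0 + 1.
  rewrite leNgt; apply/negP => lt.
  have [] := h (s0 + 1) _; first by rewrite lexx andbT; lra.
  rewrite lt_min => /andP[]; have : lam (s0 + 1) < lam s.
    by apply: lamm => //; rewrite in_itv /= andbT; lra.
  rewrite lams => lt1 + _; rewrite ltr_norml => /andP[]; lra.
have [] := h s _; first by rewrite s_ge0.
rewrite lams !lt_min => /andP[_ /andP[]] + + /= ->.
rewrite !ltr_norml => /andP[_ h1] /andP[h2 _].
by apply: hv; lra.
Qed.

(** By right continuity the value at [t] is the value on some interval
    following [t], which reduces to countably many closed sets. *)
Lemma measurable_path_at (t : R) (a : A) : 0 <= t ->
  measurable ([set w | pi (w t) = a] : set (borel (cadlag R W))).
Proof.
move=> t0; have -> : ([set w | pi (w t) = a] : set (borel (cadlag R W))) =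
    \bigcup_n [set w | forall s : R, t < s -> s < t + n.+1%:R^-1 -> pi (w s) = a].
  apply/seteqP; split => w /=.
    move=> wa; have [d [b [d0 [h _]]]] := stepfun_pi w t0.
    exists (Num.truncn d^-1) => // s ts st; rewrite h ?(ltW ts)// (lt_trans st)//.
    rewrite ltrD2l invf_plt ?posrE//; exact: truncnS_gt.
  move=> [n _ h]; have [d [b [d0 [hd _]]]] := stepfun_pi w t0.
  have : 0 < n.+1%:R^-1 :> R by rewrite invr_gt0.
  move: n.+1%:R^-1 h => e h e0.
  have [m [m0 md me]] : exists m, [/\ 0 < m, m <= d & m <= e].
    by exists (Num.min d e); rewrite lt_min d0 e0 !ge_min !lexx orbT.
  by rewrite -(hd (t + m / 2)) ?h //; lra.
apply: bigcup_measurable => n _; rewrite -[X in measurable X]setCK.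
by apply: measurableC; apply: sub_sigma_algebra; exact: skorohod_closed_cst.
Qed.

End coordinates_measurable.

(** * The topology of configurations *)
Section config_topology.
Context {S : countType}.

Lemma entourage_coord (x : S) :
  entourage [set p : config S * config S | p.1 x = p.2 x].
Proof.
pose E := [set p : config S * config S | p.1 x = p.2 x].
have entE : @entourage (initial_topology (@proj S (fun=> bool) x)) E.
  exists [set p : bool * bool | p.1 = p.2]; last by move=> [].
  by rewrite uniform_discrete => p [z _ <-].
exists E => //.
have h : `[< @entourage (initial_topology (@proj S (fun=> bool) x)) E >] by apply/asboolP.
exists [fset (exist (fun p : {classic S} * set (config S * config S) =>
  `[< @entourage (initial_topology (@proj S (fun=> bool) p.1)) p.2 >]) (x, E) h)]%fset.
  by move=> ? _; exact: in_setT.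
apply/seteqP; split => [p hp|p Ep i /=]; last by rewrite inE => /eqP ->.
by apply: (hp (exist _ (x, E) h)); rewrite /= inE.
Qed.

Lemma entourage_config (E : set (config S * config S)) : entourage E ->
  exists F : seq S, forall f g : config S, {in F, forall x, f x = g x} -> E (f, g).
Proof.
case=> B [/= L _ <-] sE.
suff [F hF] : exists F : seq S, forall f g : config S, {in F, forall x, f x = g x} ->
    forall i, i \in enum_fset L -> (projT1 i).2 (f, g).
  by exists F => f g fg; apply: sE => i /= iL; exact: hF.
elim: (enum_fset L) => [|[[x V] hV] l [F hF]]; first by exists [::] => f g _ i; rewrite in_nil.
exists ((x : S) :: F) => f g fg i; rewrite inE => /predU1P[->|il]; last first.
  by apply: hF il => y yF; apply: fg; rewrite inE yF orbT.
move: hV => /= /asboolP [V' + sV] /=.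
rewrite uniform_discrete => dV'; apply: sV => /=; apply: dV'.
exists (f x) => //; congr (_, _).
by apply: fg; rewrite inE eqxx.
Qed.

Lemma nbhs_config (f : config S) (U : set (config S)) : nbhs f U ->
  exists F : seq S, forall g : config S, {in F, forall x, f x = g x} -> U g.
Proof.
move=> /nbhsP [E /entourage_config [F hF] EU].
by exists F => g fg; apply: EU; apply/xsectionP; exact: hF.
Qed.

Lemma cvg_config (T : Type) (G : set_system T) (FG : Filter G) (f : T -> config S)
    (g : config S) :
  (forall x, \forall t \near G, g x = f t x) -> f t @[t --> G] --> g.
Proof.
move=> h U /nbhs_config [F hF].
suff GF : G [set t | {in F, forall x, g x = f t x}].
  by apply: (@filterS _ G FG _ (f @^-1` U) _ GF) => t /= /hF.
elim: F {hF} => [|x F ih]; first by apply: filterS filterT => t _ x.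
apply: filterS (filterI (h x) ih) => t [/= gx gF] y.
by rewrite inE => /predU1P[->|/gF].
Qed.

Lemma open_config (U : set (config S)) (G : set (set (config S))) :
  sigma_algebra setT G ->
  (forall x b, G [set z | z x = b]) -> open U -> G U.
Proof.
move=> sG hG oU.
pose cyl (l : seq (S * bool)) := [set z : config S | {in l, forall p, z p.1 = p.2}].
have -> : U = [set z | exists l, cyl l `<=` U /\ cyl l z].
  apply/seteqP; split => z /=; last by move=> [l [lU]]; exact: lU.
  move=> Uz; have /nbhs_config[F hF] : nbhs z U by apply: open_nbhs_nbhs.
  exists [seq (x, z x) | x <- F]; split; last by move=> _ /mapP[x xF ->].
  by move=> y hy; apply: hF => x xF; rewrite (hy (x, z x))//; exact: map_f.
apply: salg_ex => // l; apply: salg_and => // _.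
by apply: salg_all_seq => // -[x b] _; exact: hG.
Qed.

Lemma measurable_config_coord (x : S) (b : bool) :
  measurable ([set z | z x = b] : set (borel (config S))).
Proof.
apply: sub_sigma_algebra; rewrite openE => z /= zx.
have : nbhs z (xsection [set p : config S * config S | p.1 x = p.2 x] z).
  by apply: nbhs_entourage; exact: entourage_coord.
by apply: filterS => y; rewrite /xsection/= inE /= => <-.
Qed.

End config_topology.

(** * Changes of time between step functions *)
Section cells.
Context {R : realType} {A : eqType}.
Implicit Types (f g : R -> A) (u q : R) (a b : A).

(** [f] passes from [a] to [b] on [[u, q]] by at most one jump, which happens
    before [q].  Only rational times are inspected, so that this is a countable
    condition; right continuity recovers the other times.  The strict margin
    before [q] is needed for changes of time that fix [q]. *)
Definition crossing f u q a b : Prop :=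
  [/\ f u = a, f q = b,
      forall r r' : rat, u <= ratr r /\ ratr r <= ratr r' :> R /\ ratr r' <= q ->
        f (ratr r) = a \/ f (ratr r') = b &
      exists k : nat, forall r : rat, q - k.+1%:R^-1 < ratr r /\ u <= ratr r /\ ratr r <= q ->
        f (ratr r) = b].

Lemma right_rat f s q : stepfun f -> 0 <= s -> s < q ->
  exists r : rat, [/\ s < ratr r, ratr r < q & f (ratr r) = f s].
Proof.
move=> sf s0 sq; have [d [a [d0 [h _]]]] := sf _ s0.
have lt : s < Num.min q (s + d) by rewrite lt_min sq ltrDl.
have [r] := rat_in_itvoo lt; rewrite in_itv /= lt_min => /and3P[sr rq rd].
by exists r; split => //; apply: h => //; exact: ltW.
Qed.

Lemma crossing_mono f u q a b : stepfun f -> 0 <= u -> crossing f u q a b ->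
  forall r r', u <= r -> r <= r' -> r' <= q -> f r = a \/ f r' = b.
Proof.
move=> sf u0 [fu fq h _] r r' ur rr' r'q.
have [->|r'Nq] := eqVneq r' q; first by right.
have {}r'q : r' < q by rewrite lt_neqAle r'Nq.
have [p' [rp' p'q <-]] := right_rat sf (le_trans (le_trans u0 ur) rr') r'q.
have rp : r < ratr p' by rewrite (le_lt_trans rr').
have [p [rp1 pp' <-]] := right_rat sf (le_trans u0 ur) rp.
by apply: h; split; [|split]; apply: ltW => //; rewrite (le_lt_trans ur).
Qed.

Lemma crossing_margin f u q a b : stepfun f -> 0 <= u -> crossing f u q a b ->
  exists2 d, 0 < d & forall s, q - d < s -> u <= s -> s <= q -> f s = b.
Proof.
move=> sf u0 [fu fq _ [k h]]; exists k.+1%:R^-1; first by rewrite invr_gt0.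
move=> s ds us sq; have [->//|sNq] := eqVneq s q.
have {}sq : s < q by rewrite lt_neqAle sNq.
have [p [sp pq <-]] := right_rat sf (le_trans u0 us) sq.
apply: h; split; first exact: lt_trans sp.
by split; apply: ltW => //; exact: le_lt_trans sp.
Qed.

Lemma crossing_jump f u q a b : stepfun f -> 0 <= u -> u < q -> a != b ->
  crossing f u q a b -> exists t, [/\ u < t, t < q,
    forall s, u <= s -> s < t -> f s = a & forall s, t <= s -> s <= q -> f s = b].
Proof.
move=> sf u0 uq ab cf; have fm := crossing_mono sf u0 cf.
have [e e0 he] := crossing_margin sf u0 cf.
have [fu fq _ _] := cf.
pose E := [set s | [/\ u <= s, s <= q & f s = a]].
have Eu : E u by split => //; exact: ltW.
have Ee s : E s -> s <= q - e.
  move=> [us sq fs]; rewrite leNgt; apply/negP => lt.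
  by move/eqP: ab; apply; rewrite -fs; exact: he.
have supE : has_sup E by split; [exists u|exists (q - e)].
have us : u <= sup E by exact: sup_upper_bound.
have sq : sup E <= q - e by apply: ge_sup => //; exists u.
have NE s : sup E < s -> s <= q -> f s != a.
  move=> ss s_q; apply/eqP => fs; have : s <= sup E; last by lra.
  by apply: sup_upper_bound => //; split => //; lra.
have fab s : u <= s -> s <= q -> f s = a \/ f s = b by move=> ? ?; exact: fm.
have fs : f (sup E) != a.
  apply/eqP => fsa; have [d [a' [d0 [hd _]]]] := sf _ (le_trans u0 us).
  have m : 0 < Num.min d e by rewrite lt_min d0.
  have m1 : Num.min d e <= d by rewrite ge_min lexx.
  have m2 : Num.min d e <= e by rewrite ge_min lexx orbT.
  have /eqP : f (sup E + Num.min d e / 2) != a by apply: NE; lra.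
  by apply; rewrite hd //; lra.
exists (sup E); split.
- rewrite lt_neqAle us andbT; apply/eqP => us'; move/eqP: fs; apply.
  by rewrite -us'.
- by lra.
- move=> s us' ss; have ss' : 0 < sup E - s by rewrite subr_gt0.
  have [x [ux xq fx] xs] := sup_adherent ss' supE.
  have sx : s <= x by lra.
  have [//|fxb] := fm s x us' sx xq.
  by move: ab; rewrite -fx fxb eqxx.
- move=> s; rewrite le_eqVlt => /predU1P[<- _|ss s_q].
    have sq' : sup E <= q by lra.
    by have [fsa|//] := fab (sup E) us sq'; rewrite fsa eqxx in fs.
  have us' : u <= s by lra.
  have [fsa|//] := fab s us' s_q.
  by have := NE s ss s_q; rewrite fsa eqxx.
Qed.

Lemma piecewise_linear u q t t' : u < t -> t < q -> u < t' -> t' < q ->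
  exists phi : R -> R, [/\ phi u = u /\ phi q = q,
    {homo phi : x y / x < y},
    forall y, exists x, phi x = y &
    forall s, (s < t) = (phi s < t')].
Proof.
move=> ut tq ut' t'q.
pose phi s := if s <= t then t' + (s - t) * ((t' - u) / (t - u))
              else t' + (s - t) * ((q - t') / (q - t)).
have c1 : 0 < (t' - u) / (t - u) by rewrite divr_gt0 ?subr_gt0.
have c2 : 0 < (q - t') / (q - t) by rewrite divr_gt0 ?subr_gt0.
exists phi; split.
- rewrite /phi ltW // leNgt tq /=; split.
    by field; rewrite subr_eq0 gt_eqF.
  by field; rewrite subr_eq0 gt_eqF.
- move: c1 c2; rewrite /phi; move: (_ / _) (_ / _) => k2 k1 k10 k20 x y xy.
  case: (leP x t) => xt; case: (leP y t) => yt.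
  + by rewrite ltrD2l ltr_pM2r//; lra.
  + have h1 : (x - t) * k1 <= 0 by rewrite pmulr_lle0 // subr_le0.
    have h2 : 0 < (y - t) * k2 by rewrite pmulr_lgt0 // subr_gt0.
    by lra.
  + by lra.
  + by rewrite ltrD2l ltr_pM2r//; lra.
- move=> y; have [yt|ty] := leP y t'.
    exists (t + (y - t') / ((t' - u) / (t - u))); rewrite /phi ifT.
      by rewrite addrAC subrr add0r divfK ?gt_eqF// addrCA subrr addr0.
    by rewrite gerDl pmulr_lle0 ?invr_gt0// subr_le0.
  exists (t + (y - t') / ((q - t') / (q - t))); rewrite /phi ifF.
    by rewrite addrAC subrr add0r divfK ?gt_eqF// addrCA subrr addr0.
  by apply/negbTE; rewrite -ltNge ltrDl pmulr_lgt0 ?invr_gt0// subr_gt0.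
- move=> s; rewrite /phi; case: (ltgtP s t) => st.
  + by rewrite gtrDl pmulr_llt0 // subr_lt0 st.
  + apply/esym/negbTE; rewrite -leNgt lerDl; apply: mulr_ge0; last exact: ltW.
    by rewrite subr_ge0 ltW.
  + by rewrite st subrr mul0r addr0 ltxx.
Qed.

(** The jump times of [f] and [g] lie strictly inside the interval, so that a
    piecewise linear map exchanges them and fixes the endpoints. *)
Lemma crossing_time_change f g u q a b : stepfun f -> stepfun g -> 0 <= u -> u < q ->
  crossing f u q a b -> crossing g u q a b ->
  exists phi : R -> R, [/\ phi u = u /\ phi q = q,
    {homo phi : x y / x < y},
    forall y, exists x, phi x = y &
    forall s, u <= s -> s <= q -> f (phi s) = g s].
Proof.
move=> sf sg u0 uq cf cg; have [ab|ab] := eqVneq a b.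
  exists id; split => //; first by move=> y; exists y.
  move=> s us sq; subst b.
  by case: (crossing_mono sf u0 cf us (lexx s) sq) => ->;
     case: (crossing_mono sg u0 cg us (lexx s) sq) => ->.
have [t [ut tq fa fb]] := crossing_jump sf u0 uq ab cf.
have [t' [ut' t'q ga gb]] := crossing_jump sg u0 uq ab cg.
have [phi [[phiu phiq] phim phis phit]] := piecewise_linear ut' t'q ut tq.
exists phi; split => // s us sq.
have us' : u <= phi s by rewrite -phiu (ltW_homo phim).
have sq' : phi s <= q by rewrite -[leRHS]phiq (ltW_homo phim).
have [st|ts] := ltP s t'.
  by rewrite ga // fa // -phit.
by rewrite gb // fb // leNgt -phit -leNgt.
Qed.

(** Consecutive crossings at rational times, starting from the value [a] at [u]:
    a description of [f] by an element of a countable type. *)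
Fixpoint chain f u a (l : seq (rat * A)) : Prop :=
  if l is (q, b) :: l' then
    [/\ u < ratr q, crossing f u (ratr q) a b & chain f (ratr q) b l']
  else f u = a.

Fixpoint narrow (e : R) u (l : seq (rat * A)) : Prop :=
  if l is (q, b) :: l' then ratr q - u < e /\ narrow e (ratr q) l' else True.

Definition chain_end u (l : seq (rat * A)) : R := last u [seq ratr p.1 | p <- l].

Lemma chain_rcons f u a l (q : rat) b : chain f u a l ->
  chain_end u l < ratr q -> crossing f (chain_end u l) (ratr q) (f (chain_end u l)) b ->
  chain f u a (rcons l (q, b)).
Proof.
elim: l u a => [|[p c] l ih] u a /=; rewrite /chain_end /=.
  by move=> <- uq cf; split => //; case: cf.
by move=> [up cf h] lq ce; split => //; exact: ih.
Qed.

Lemma narrow_rcons e u l (q : rat) b : narrow e u l ->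
  ratr q - chain_end u l < e -> narrow e u (rcons l (q, b)).
Proof.
elim: l u => [|[p c] l ih] u /=; rewrite /chain_end //=.
by move=> [up cf] lq; split => //; exact: ih.
Qed.

Lemma chain_time_change f g (e : R) u a l : stepfun f -> stepfun g -> 0 < e -> 0 <= u ->
  chain f u a l -> chain g u a l -> narrow e u l ->
  exists lam : R -> R, [/\ lam u = u, forall x y, u <= x -> x < y -> lam x < lam y,
    forall y, u <= y -> exists2 x, u <= x & lam x = y,
    forall s, u <= s -> `|lam s - s| < e &
    forall s, u <= s -> s <= chain_end u l -> f (lam s) = g s].
Proof.
move=> sf sg e0; elim: l u a => [|[q b] l ih] u a u0 /=.
  move=> fu gu _; exists id; split => //; first by move=> y uy; exists y.
    by move=> s _; rewrite subrr normr0.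
  move=> s us; rewrite /chain_end /= => su; have -> : s = u by lra.
  by rewrite fu gu.
move=> [uq cf chf] [_ cg chg] [qe ne].
have q0 : 0 <= ratr q :> R by exact: le_trans (ltW uq).
have [lam [lamq lamm lams lame lamf]] := ih _ _ q0 chf chg ne.
have [phi [[phiu phiq] phim phis phif]] := crossing_time_change sf sg u0 uq cf cg.

exists (fun s => if s <= ratr q then phi s else lam s); split.
- by rewrite ltW.
- move=> x y ux xy.
  case: (leP x (ratr q)) => xq; case: (leP y (ratr q)) => yq.
  + exact: phim.
  + apply: (@le_lt_trans _ _ (ratr q)); first by rewrite -[leRHS]phiq (ltW_homo phim).
    by rewrite -[ltLHS]lamq; exact: lamm.
  + by move: xy; rewrite ltNge (le_trans yq)// ltW.
  + by apply: lamm => //; exact: ltW.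
- move=> y uy; have [yq|qy] := leP y (ratr q).
    have [x phix] := phis y.
    have ux : u <= x by rewrite leNgt; apply/negP => /phim; rewrite phix phiu ltNge uy.
    exists x => //; rewrite ifT // leNgt; apply/negP => /phim.
    by rewrite phix phiq ltNge yq.
  have [x qx lamx] := lams _ (ltW qy).
  exists x; first exact: le_trans (ltW uq) qx.
  rewrite ifF //; apply/negbTE; rewrite -ltNge lt_neqAle qx andbT.
  by apply/eqP => qx'; move: qy; rewrite -lamx -qx' lamq ltxx.
- move=> s us; case: (leP s (ratr q)) => sq; last by apply: lame; exact: ltW.
  have us' : u <= phi s by rewrite -phiu (ltW_homo phim).
  have sq' : phi s <= ratr q by rewrite -[leRHS]phiq (ltW_homo phim).
  by rewrite ltr_norml; apply/andP; split; lra.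
- move=> s us; rewrite /chain_end /= => sl; case: (leP s (ratr q)) => sq.
    exact: phif.
  by apply: lamf => //; exact: ltW.
Qed.

(** Chains extend to the right of any point: a rational time slightly after it
    is reached by one more crossing, as [f] is constant on either side. *)
Lemma chain_exists f (e T : R) : stepfun f -> 0 < e -> 0 <= T ->
  exists l, [/\ chain f 0 (f 0) l, narrow e 0 l & T <= chain_end 0 l].
Proof.
move=> sf e0 T0; pose Q (t : R) := exists l,
  [/\ chain f 0 (f 0) l, narrow e 0 l & t <= chain_end 0 l].
suff : Q 0 -> Q T by apply; exists [::].
apply: (interval_ind (P := fun x y : R => Q x -> Q y)) => //.
  by move=> a m b _ _ _ h1 h2 /h1 /h2.
move=> s s0; have [d [c [d0 [h1 h2]]]] := sf _ s0.
(* [d] keeps [f] constant on either side of [s]; [e / 2] keeps the new crossing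
   narrow. *)
exists (Num.min d (e / 2)); first by rewrite lt_min d0 divr_gt0.
have m1 : Num.min d (e / 2) <= d by rewrite ge_min lexx.
have m2 : Num.min d (e / 2) <= e / 2 by rewrite ge_min lexx orbT.
move: (Num.min _ _) m1 m2 => m m1 m2 x y a0 sa as_ sb bs [l [chl nl al]].
have [bl|lb] := leP y (chain_end 0 l); first by exists l.
have [q] := rat_in_itvoo bs; rewrite in_itv /= => /andP[bq qs].
pose p := chain_end 0 l.
exists (rcons l (q, f (ratr q))); split.
- apply: chain_rcons => //; rewrite -/p in al lb *; first exact: lt_trans bq.
  split => //.
    move=> r r' [pr [rr' r'q]]; have [sr'|r's] := leP s (ratr r').
      by right; rewrite !h1 //; lra.
    by left; rewrite !h2 //; lra.
  have sq : 0 < ratr q - s by lra.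
  exists (Num.truncn (ratr q - s)^-1) => r [r1 [r2 r3]].
  have : (Num.truncn (ratr q - s)^-1).+1%:R^-1 < ratr q - s.
    by rewrite invf_plt ?posrE//; exact: truncnS_gt.
  move=> lt; have sr : s < ratr r by rewrite (lt_trans _ r1)// ltrBrDr -ltrBrDl.
  by rewrite !h1 //; lra.
- by apply: narrow_rcons => //; rewrite -/p in al lb *; lra.
- by rewrite /chain_end map_rcons last_rcons; exact: ltW.
Qed.

End cells.

(** * Borel sets of Skorohod space and coordinates *)
Section skorohod_borel.
Context {R : realType} {S : countType}.

Definition restr (F : seq S) (z : config S) : seq bool := [seq z x | x <- F].

Lemma entourage_restr (F : seq S) :
  entourage [set p : config S * config S | restr F p.1 = restr F p.2].
Proof.
elim: F => [|x F ih]; first by apply: filterS filterT.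
apply: filterS (filterI (entourage_coord x) ih) => -[z z'] [/= zx zF].
by rewrite zx; congr (_ :: _).
Qed.

Lemma chain_measurable (G : set (set (cadlag R (config S)))) :
  sigma_algebra setT G ->
  (forall t x b, 0 <= t -> G [set w : cadlag R (config S) | w t x = b]) ->
  forall (F : seq S) (l : seq (rat * seq bool)) u a, 0 <= u ->
  G [set w : cadlag R (config S) | chain (fun t => restr F (w t)) u a l].
Proof.
move=> sG hG F.
have hF t a : 0 <= t -> G [set w : cadlag R (config S) | restr F (w t) = a].
  move=> t0.
  apply: (@cmeas_map _ G sG S bool F (fun x (w : cadlag R (config S)) => w t x)).
  by move=> x b; exact: hG.
elim=> [|[q b] l ih] u a u0 /=; first exact: hF.
have -> : [set w : cadlag R (config S) | [/\ u < ratr q,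
  crossing (fun t => restr F (w t)) u (ratr q) a b &
    chain (fun t => restr F (w t)) (ratr q) b l]] =
  [set w : cadlag R (config S) | u < ratr q /\
    ([set w : cadlag R (config S) | crossing (fun t => restr F (w t)) u (ratr q) a b] `&`
    [set w : cadlag R (config S) | chain (fun t => restr F (w t)) (ratr q) b l]) w].
  apply/seteqP; split => w /=; first by move=> [h1 h2 h3]; split; [|split].
  by move=> [h1 [h2 h3]]; split.
apply: salg_and => // uq; have q0 : 0 <= ratr q :> R by rewrite (le_trans u0)// ltW.
apply: salgI => //; last exact: ih.
have -> : [set w : cadlag R (config S) | crossing (fun t => restr F (w t)) u (ratr q) a b] =
  ([set w : cadlag R (config S) | restr F (w u) = a] `&`
   [set w : cadlag R (config S) | restr F (w (ratr q)) = b]) `&`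
  ([set w : cadlag R (config S) | forall r r' : rat,
     (u <= ratr r /\ ratr r <= ratr r' :> R /\ ratr r' <= ratr q :> R) ->
     restr F (w (ratr r)) = a \/ restr F (w (ratr r')) = b] `&`
   [set w : cadlag R (config S) | exists k : nat, forall r : rat,
     (ratr q - k.+1%:R^-1 < ratr r :> R /\ u <= ratr r /\ ratr r <= ratr q :> R) ->
     restr F (w (ratr r)) = b]).
  apply/seteqP; split => w /=.
    by move=> [h1 h2 h3 h4]; split; split => // r r'; exact: h3.
  by move=> [[h1 h2] [h3 h4]]; split.
apply: salgI => //; apply: salgI => //; try exact: hF.
  apply: salg_all => // r; apply: salg_all => // r'; apply: salg_imply => // -[ur [rr' _]].
  by apply: salgU => //; apply: hF; lra.
apply: salg_ex => // k; apply: salg_all => // r; apply: salg_imply => // -[_ [ur _]].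
by apply: hF; lra.
Qed.

(** Every point [w] of [U] lies in some chain set contained in [U]: a chain for
    the restriction of [w] to finitely many sites determines a path up to a
    small change of time.  There are countably many chain sets. *)
Lemma skorohod_open_coord (G : set (set (cadlag R (config S)))) :
  sigma_algebra setT G ->
  (forall t x b, 0 <= t -> G [set w : cadlag R (config S) | w t x = b]) ->
  forall U : set (cadlag R (config S)), skorohod_open U -> G U.
Proof.
move=> sG hG U oU.
pose M (c : seq S * (seq bool * seq (rat * seq bool))) :=
  [set w : cadlag R (config S) | chain (fun t => restr c.1 (w t)) 0 c.2.1 c.2.2].
have -> : U = [set w | exists c, M c `<=` U /\ M c w].
  apply/seteqP; split => w /=; last by move=> [c [cU]]; exact: cU.
  move=> Uw; have [T [e [E [e0 /entourage_config[F hF]] sU]]] := oU w Uw.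
  have sf (v : cadlag R (config S)) : stepfun (fun t => restr F (v t)).
    exact: stepfun_pi (entourage_restr F) v.
  have T0 : 0 <= Num.max 0 T by rewrite le_max lexx.
  have [l [chl nl Tl]] := chain_exists (sf w) e0 T0.
  exists (F, (restr F (w 0), l)); split => // v /= chv.
  have [lam [lam0 lamm lams lame lamf]] :=
    chain_time_change (sf w) (sf v) e0 (lexx 0) chl chv nl.
  apply: sU; exists lam.
    split; first by move=> x y; rewrite !in_itv /= !andbT => x0 y0; exact: lamm.
    apply/seteqP; split => y /=; rewrite !in_itv /= andbT.
      move=> [x + <-]; rewrite in_itv /= !andbT le_eqVlt => /predU1P[<-|x0].
        by rewrite lam0.
      by rewrite -[leLHS]lam0; apply/ltW; exact: lamm.
    by move=> /lams [x x0 <-]; exists x => //; rewrite in_itv /= andbT.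
  move=> s /andP[s0 sT]; split; first exact: lame.
  apply: hF => x xF; have /lamf : 0 <= s by [].
  have sl : s <= chain_end 0 l by rewrite (le_trans _ Tl)// le_max sT orbT.
  move=> /(_ sl) e1; apply/eqP; have /eqP := e1.
  by rewrite /restr => /eqP /eq_in_map; move=> ->.
apply: salg_ex => // c; apply: salg_and => // _.
exact: chain_measurable.
Qed.

End skorohod_borel.

(** * Discretized exclusion dynamics *)
Section discretization.
Context {R : realType} {S : countType}.
Implicit Types (K : driving R S) (z : config S) (C : set S) (p q : opair S).

Definition try_move p z : config S :=
  if z (val p).1 && ~~ z (val p).2 then move_particle z p else z.

Definition sweep (L : seq (opair S)) (b : opair S -> bool) z : config S :=
  foldl (fun z p => if b p then try_move p z else z) z L.

Definition rang K (u v : R) p : bool := (K p u < K p v)%N.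

(** The exclusion dynamics when only the counts at the times of the partition
    [s] are visible: on each interval, a pair moves at most once, when its count
    has increased. *)
Fixpoint discrete_run K L (u : R) (s : seq R) z : config S :=
  if s is v :: s' then discrete_run K L v s' (sweep L (rang K u v) z) else z.

Lemma discrete_run_cat K L u s1 s2 z :
  discrete_run K L u (s1 ++ s2) z = discrete_run K L (last u s1) s2 (discrete_run K L u s1 z).
Proof. by elim: s1 u z => //= v s1 ih u z. Qed.

Definition agree C z z' := forall x, C x -> z x = z' x.

Lemma try_move_agree C p z z' : inside C p -> agree C z z' ->
  agree C (try_move p z) (try_move p z').
Proof.
move=> [C1 C2] zz x Cx; rewrite /try_move !zz //.
by case: ifP => _; rewrite /move_particle zz.
Qed.

Lemma try_move_outside C p z : ~ C (val p).1 -> ~ C (val p).2 ->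
  agree C (try_move p z) z.
Proof.
move=> C1 C2 x Cx; rewrite /try_move; case: ifP => // _; rewrite /move_particle.
by case: eqP => [xE|_]; [rewrite xE in Cx|case: eqP => [xE|//]; rewrite xE in Cx].
Qed.

Lemma sweep_outside C (L : seq (opair S)) (b : opair S -> bool) z :
  (forall p, p \in L -> b p -> ~ C (val p).1 /\ ~ C (val p).2) ->
  agree C (sweep L b z) z.
Proof.
elim: L z => [|p L ih] z h x Cx //=.
rewrite ih //; last by move=> q qL; apply: h; rewrite inE qL orbT.
case: ifP => // bp; have [C1 C2] := h p (mem_head _ _) bp.
exact: (@try_move_outside C).
Qed.

Lemma sweep_cat (L1 L2 : seq (opair S)) (b : opair S -> bool) z : sweep (L1 ++ L2) b z =
  sweep L2 b (sweep L1 b z).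
Proof. by rewrite /sweep foldl_cat. Qed.

Definition simple_jumps K :=
  (forall p q, p != q -> jump_times (K p) `&` jump_times (K q) = set0) /\
  (forall p s, jump_times (K p) s -> rings_at K p s).

(** Jumps are simple, so that [p] is the only pair ringing at time [s] and the
    choice made by [update] is forced. *)
Lemma update_ring K C z s p : simple_jumps K -> inside C p -> rings_at K p s ->
  update K C z s = try_move p z.
Proof.
move=> [dj _] Cp rp.
have uniq_p q : rings_at K q s -> q = p.
  move=> rq; apply: contrapT => /eqP /dj qp.
  have : (jump_times (K q) `&` jump_times (K p)) s by split; exact: rings_jump.
  by rewrite qp.
rewrite /update /try_move; case: pselect => [ex|nex].
  have [_ rq z1 z2] := projT2 (cid ex).
  by rewrite (uniq_p _ rq) in z1 z2 *; rewrite z1 z2.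
case: ifP => // /andP[z1 z2]; exfalso; apply: nex.
by exists p; split.
Qed.

Lemma jump_isolated_seq K (l : seq (opair S)) (s : R) : 0 <= s ->
  exists2 d : R, 0 < d & forall p u, p \in l -> s - d < u -> u < s + d ->
    jump_times (K p) u -> u = s.
Proof.
move=> s0; elim: l => [|p l [d d0 ih]]; first by exists 1.
have [e e0 he] := jump_isolated (K p) s0.
have m1 : Num.min d e <= d by rewrite ge_min lexx.
have m2 : Num.min d e <= e by rewrite ge_min lexx orbT.
exists (Num.min d e) => [|q u]; first by rewrite lt_min d0.
rewrite inE => /predU1P[->|ql] h1 h2; first by apply: he; lra.
by apply: ih => //; lra.
Qed.

Lemma finite_inside C : finite_set C ->
  exists2 l : seq (opair S), uniq l & forall p, p \in l <-> inside C p.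
Proof.
move=> fC; have fCC : finite_set (C `*` C) by exact: finite_setX.
have fP : finite_set [set p : opair S | inside C p].
  have -> : [set p : opair S | inside C p] = val @^-1` (C `*` C).
    by apply/seteqP; split.
  apply: finite_preimage => // p q _ _; exact: val_inj.
exists (fset_set [set p : opair S | inside C p]); first exact: fset_uniq.
move=> p; rewrite in_fset_set // inE; split => //.
Qed.

Definition ring_times K C (s t : R) : set R :=
  [set u | s < u <= t /\ exists2 p, inside C p & rings_at K p u].

Lemma finite_ring_times K C s t : finite_set C -> 0 <= s -> finite_set (ring_times K C s t).
Proof.
move=> /finite_inside[l _ hl] s0.
have [st|ts] := leP s t; last first.
  by apply: (@sub_finite_set _ _ set0) => // u [/andP[su ut]]; lra.
apply: (@sub_finite_set _ _ (\bigcup_(p in [set` l])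
  [set u | s < u <= t /\ jump_times (K p) u])).
  by move=> u [su [p /hl pl rp]]; exists p => //; split => //; exact: rings_jump.
by apply: bigcup_finite => // p _; exact: finite_jumps.
Qed.

Lemma mem_update_times K C s t u : finite_set C -> 0 <= s ->
  (u \in update_times K C s t) = (u \in ring_times K C s t).
Proof. by move=> fC s0; rewrite mem_sort in_fset_set // ; exact: finite_ring_times. Qed.

Lemma update_times_sorted K C s t : sorted <%R (update_times K C s t).
Proof. by rewrite sort_lt_sorted fset_uniq. Qed.

Lemma update_times_cat K C s m t : finite_set C -> 0 <= s -> s <= m -> m <= t ->
  update_times K C s t = update_times K C s m ++ update_times K C m t.
Proof.
move=> fC s0 sm mt; have m0 : 0 <= m by exact: le_trans sm.
apply: lt_sorted_eq; first exact: update_times_sorted.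
  rewrite sorted_pairwise; last exact: lt_trans.
  rewrite pairwise_cat -!sorted_pairwise; try exact: lt_trans.
  rewrite !update_times_sorted !andbT; apply/allrelP => u v.
  rewrite !mem_update_times // => /set_mem[/andP[_ um] _] /set_mem[/andP[mv _] _].
  exact: le_lt_trans mv.
move=> u; rewrite mem_cat !mem_update_times //; apply/idP/orP.
  move=> /set_mem[/andP[su ut] h]; have [um|mu] := leP u m; [left|right];
  by apply/mem_set; split => //; apply/andP; split.
move=> [] /set_mem [/andP[h1 h2] h]; apply/mem_set; split => //; apply/andP; split => //.
- exact: le_trans mt.
- exact: le_lt_trans h1.
Qed.

Lemma update_times_nil K C s t :
  (forall u, ~ ring_times K C s t u) -> update_times K C s t = [::].
Proof.
move=> h; rewrite /update_times.
have -> : [set u | s < u <= t /\ exists2 p, inside C p & rings_at K p u] = set0.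
  by apply/seteqP; split => // u /h.
by rewrite fset_set0.
Qed.

Lemma counterE K p (s : R) : counter K (val p).1 (val p).2 s = K p s.
Proof. by rewrite /counter -surjective_pairing valK. Qed.

Lemma simple_mono K p : simple_jumps K ->
  forall a b : R, 0 <= a -> a <= b -> (K p a <= K p b)%N.
Proof. by move=> [_ h]; apply: jump_mono => s; exact: h. Qed.

Lemma counter_mono K x y : simple_jumps K ->
  forall a b : R, 0 <= a -> a <= b -> (counter K x y a <= counter K x y b)%N.
Proof.
by move=> sK a b a0 ab; rewrite /counter; case: insub => // p; exact: simple_mono.
Qed.

Lemma rang_edge K p (u v m m' : R) : simple_jumps K -> 0 <= u -> u <= m -> m <= m' -> m' <= v ->
  rang K m m' p -> edge K u v (val p).1 (val p).2 && edge K u v (val p).2 (val p).1.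
Proof.
move=> sK u0 um mm mv rp.
suff h : edge K u v (val p).1 (val p).2.
  by rewrite h /=; move: h;
    rewrite /edge /sym_count eq_sym ![(counter _ (val p).2 _ _ + _)%N]addnC.
rewrite /edge (valP p) /= /sym_count !counterE.
have h1 : (counter K (val p).2 (val p).1 u <= counter K (val p).2 (val p).1 v)%N.
  by apply: counter_mono => //; lra.
have h2 : (K p u <= K p m)%N by exact: simple_mono.
have h3 : (K p m' <= K p v)%N by apply: simple_mono => //; lra.
rewrite -addSn; apply: leq_add => //.
exact: leq_trans (leq_ltn_trans h2 rp) h3.
Qed.

Lemma component_closed (e : rel S) x y y' : component e x y -> e y y' -> component e x y'.
Proof.
move=> [s ps ->] ey; exists (rcons s y'); last by rewrite last_rcons.
by rewrite rcons_path ps.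
Qed.

Lemma component_self (e : rel S) x : component e x x.
Proof. by exists [::]. Qed.

Definition stable K C (u v : R) := forall x y, C x -> edge K u v x y -> C y.

(** A pair that rings is an edge, and edges do not leave a stable set: the rest
    of the system cannot interact with [C] during the slot. *)
Lemma rang_stable K C p (u v m m' : R) : simple_jumps K -> stable K C u v ->
  0 <= u -> u <= m -> m <= m' -> m' <= v ->
  rang K m m' p -> inside C p \/ (~ C (val p).1 /\ ~ C (val p).2).
Proof.
move=> sK st u0 um mm mv rp; have /andP[e1 e2] := rang_edge sK u0 um mm mv rp.
have [C1|NC1] := pselect (C (val p).1); first by left; split => //; exact: st e1.
right; split => // C2; apply: NC1; exact: st e2.
Qed.

Lemma rang_jump K p (m m' : R) : simple_jumps K -> 0 <= m -> m <= m' ->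
  (rang K m m' p : Prop) <-> exists s, [/\ m < s, s <= m' & jump_times (K p) s].
Proof.
move=> sK m0 mm; split => [rp|[s [ms sm js]]].
  apply: contrapT => h; move: rp; rewrite /rang (@no_jump_cst _ (K p) m m') ?ltnn//.
  by move=> s ms sm js; apply: h; exists s.
have [h1 _] := mono_left_lim (simple_mono p sK) m0 ms.
have : rings_at K p s by exact: sK.2.
rewrite /rings_at => rs; apply: leq_trans (simple_mono p sK (ltW (le_lt_trans m0 ms)) sm).
by rewrite rs ltnS.
Qed.

Definition sparse K C (m m' : R) := forall s s', ring_times K C m m' s ->
  ring_times K C m m' s' -> s = s'.

(** On an interval containing at most one relevant jump, a sweep performs the
    same move as the exact dynamics: all other pairs of the list either do not
    ring or have both sites outside [C]. *)
Lemma one_cell_agree K C L z z' (u v m m' : R) : simple_jumps K -> finite_set C ->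
  stable K C u v -> 0 <= u -> u <= m -> m <= m' -> m' <= v ->
  sparse K C m m' -> uniq L -> (forall p, inside C p -> p \in L) ->
  agree C z z' ->
  agree C (sweep L (rang K m m') z) (foldl (update K C) z' (update_times K C m m')).
Proof.
move=> sK fC st u0 um mm mv sp uL hL zz.
have m0 : 0 <= m by exact: le_trans um.
have [[s rs]|nr] := pselect (exists s, ring_times K C m m' s); last first.
  rewrite update_times_nil; last by move=> s rs; apply: nr; exists s.
  move=> x Cx; rewrite (@sweep_outside C) //= ?zz // => p _ rp.
  have [Cp|//] := rang_stable sK st u0 um mm mv rp.
  have [/(_ rp)[s [ms sm js]] _] := rang_jump p sK m0 mm.
  exfalso; apply: nr; exists s; split; first by rewrite ms.
  by exists p => //; exact: sK.2.
have -> : update_times K C m m' = [:: s].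
  apply: lt_sorted_eq => //; first exact: update_times_sorted.
  move=> s'; rewrite mem_update_times // !inE; apply/idP/eqP => [/set_mem rs'|->].
    exact: sp.
  by rewrite inE.
have [/andP[ms sm] [p Cp rp]] := rs.
rewrite /= (update_ring _ sK Cp rp).
have pL := hL _ Cp; move: uL hL; case/splitPr: pL => L1 L2.
rewrite cat_uniq /= => /and3P[_ /norP[pL1 _] /andP[pL2 _]] hL.
have outL q : q != p -> rang K m m' q -> ~ C (val q).1 /\ ~ C (val q).2.
  move=> qp rq; have [Cq|//] := rang_stable sK st u0 um mm mv rq.
  have [/(_ rq)[s' [ms' sm' js']] _] := rang_jump q sK m0 mm.
  have s's : s' = s.
    apply: sp => //; split; first by rewrite ms'.
    by exists q => //; exact: sK.2.
  have : (jump_times (K q) `&` jump_times (K p)) s.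
    by split; [rewrite -s's|exact: rings_jump].
  by rewrite (sK.1 _ _ qp).
rewrite sweep_cat /= => x Cx; rewrite /sweep /= -/(sweep L2 _ _) -/(sweep L1 _ _).
rewrite ifT; last by apply/(rang_jump p sK m0 mm); exists s; split => //; exact: rings_jump.
rewrite (@sweep_outside C L2) //; last first.
  by move=> q qL2; apply: outL; apply: contraNneq pL2 => <-.
apply: (try_move_agree Cp _ Cx) => y Cy; rewrite (@sweep_outside C L1) ?zz // => q qL1.
by apply: outL; apply: contraNneq pL1 => <-.
Qed.

Definition mesh (d a b : R) := (a <= b) && (b - a < d).

Lemma path_mesh_le d a s : path (mesh d) a s -> a <= last a s.
Proof.
elim: s a => [|b s ih] a //= /andP[/andP[ab _] /ih]; exact: le_trans.
Qed.

Lemma path_mesh_mem d a s b : path (mesh d) a s -> b \in s -> a <= b <= last a s.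
Proof.
elim: s a => [|c s ih] a //= /andP[/andP[ac _] ps]; rewrite inE => /predU1P[->|bs].
  by rewrite ac (path_mesh_le ps).
by have /andP[cb ->] := ih _ ps bs; rewrite (le_trans ac cb).
Qed.

Lemma path_mesh_sub d d' a s : d <= d' -> path (mesh d) a s -> path (mesh d') a s.
Proof.
move=> dd; apply: sub_path => b c /andP[bc cd]; rewrite /mesh bc /=.
exact: lt_le_trans dd.
Qed.

Lemma slot_agree K C L z z' (u v d m : R) s : simple_jumps K -> finite_set C ->
  stable K C u v -> 0 <= u -> u <= m -> path (mesh d) m s -> last m s <= v ->
  (forall a b : R, 0 <= a -> a <= b -> b <= v -> b - a < d -> sparse K C a b) ->
  uniq L -> (forall p, inside C p -> p \in L) -> agree C z z' ->
  agree C (discrete_run K L m s z) (foldl (update K C) z' (update_times K C m (last m s))).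
Proof.
move=> sK fC st u0 + + + sp uL hL; elim: s m z z' => [|m' s ih] m z z' um /=.
  move=> _ mv zz; rewrite update_times_nil // => a [/andP[]]; lra.
move=> /andP[/andP[mm md] ps] lv zz.
have m0 : 0 <= m by lra.
have ml := path_mesh_le ps.
have mv : m' <= v by lra.
rewrite (@update_times_cat K C m m') // foldl_cat.
apply: ih => //; first by lra.
by apply: (one_cell_agree sK fC st u0) => //; exact: sp.
Qed.

Lemma sparse_mesh K C (v : R) : finite_set C -> exists2 d : R, 0 < d &
  forall a b : R, 0 <= a -> a <= b -> b <= v -> b - a < d -> sparse K C a b.
Proof.
move=> /finite_inside[l _ hl]; apply: lebesgue_gap => s s0.
have [d d0 hd] := jump_isolated_seq K l s0.
exists d => // a b a0 da ab bd u u'.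
have hu x : ring_times K C a b x -> x = s.
  move=> [/andP[ax xb] [p /hl pl rp]]; apply: (hd p) => //; try lra.
  exact: rings_jump.
by move=> /hu -> /hu ->.
Qed.

End discretization.

(** * Paths restarted at a given time *)
Section shift.
Context {R : realType}.

Lemma is_cadlag_comp (h : nat -> nat) (w : cadlag R nat) :
  is_cadlag (fun s : {nonneg R} => h (cadlag_fun w s)).
Proof.
move=> t t0; have [wr wl] := cadlagP w t0.
have hc (n : nat) : h x @[x --> n] --> h n.
  by move=> A; rewrite nbhs_principalE => /principal_filterP An; exact: nbhs_nat.
split; first exact: cvg_comp wr (hc _).
apply/cvg_ex; move/cvg_ex : wl => [l wl]; exists (h l).
exact: cvg_comp wl (hc l).
Qed.

Definition shift_path (t : {nonneg R}) (w : cadlag R nat) : cadlag R nat :=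
  Cadlag (is_cadlag_comp (fun n => (n - w t%:num)%N) (time_shift t w)).

Lemma shift_pathE t w (s : R) : 0 <= s ->
  shift_path t w s = (w (t%:num + s)%R - w t%:num)%N.
Proof. by move=> s0; rewrite {1}/path_at /extend /= max_r. Qed.

Definition shift_driving (S : countType) (t : {nonneg R}) (K : driving R S) : driving R S :=
  fun p => shift_path t (K p).

End shift.

(** * The graphical construction as a limit of discretizations *)
Section approximation.
Context {R : realType} {S : countType} (t0 : R).
Hypothesis t0_gt0 : 0 < t0.
Implicit Types (K : driving R S) (z : config S) (C : set S) (p q : opair S).

Definition regular K :=
  simple_jumps K /\ forall r, finite_components (edge_slot t0 K r).

(** All fine partitions and all large lists of pairs give the exact value, and
    the initial configuration matters only on [F].  This uniformity is what
    allows one partition to serve two constructions at the same time. *)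
Definition approximates K t (f : config S -> config S) x (d : R) (F : seq S) :=
  forall L s z z', uniq L ->
    (forall p, (val p).1 \in F -> (val p).2 \in F -> p \in L) ->
    path (mesh d) 0 s -> last 0 s = t ->
    (forall j : nat, j%:R * t0 <= t -> j%:R * t0 \in 0 :: s) ->
    {in F, forall y, z y = z' y} -> discrete_run K L 0 s z' x = f z x.

Definition approximable K t f := forall x, exists d F, 0 < d /\ approximates K t f x d F.

Lemma approximates_weaken K t f x d d' (F F' : seq S) : d' <= d -> {subset F <= F'} ->
  approximates K t f x d F -> approximates K t f x d' F'.
Proof.
move=> dd FF h L s z z' uL hL ps ls bs zz; apply: h => //.
- by move=> p p1 p2; apply: hL; exact: FF.
- exact: path_mesh_sub ps.
- by move=> y /FF; exact: zz.
Qed.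

Lemma approximable_seq K t f (X : seq S) : approximable K t f ->
  exists d F, 0 < d /\ forall x, x \in X -> approximates K t f x d F.
Proof.
move=> h; elim: X => [|x X [d [F [d0 ih]]]]; first by exists 1, [::].
have [e [G [e0 hG]]] := h x.
exists (Num.min d e), (F ++ G); split; first by rewrite lt_min d0.
move=> y; rewrite inE => /predU1P[->|yX].
  apply: approximates_weaken hG; first by rewrite ge_min lexx orbT.
  by move=> z zG; rewrite mem_cat zG orbT.
apply: approximates_weaken (ih y yX); first by rewrite ge_min lexx.
by move=> z zG; rewrite mem_cat zG.
Qed.

Lemma component_stable K x u v : stable K (component (edge K u v) x) u v.
Proof. by move=> y y'; exact: component_closed. Qed.

(** The state of [x] within a slot depends on the states of the sites of its
    finite component at the start of the slot; a common mesh and a common set of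
    sites exist for all of them. *)
Lemma approximable_evolve K r t g : regular K ->
  approximable K (r%:R * t0) g -> r%:R * t0 <= t -> t <= r.+1%:R * t0 ->
  approximable K t (fun z => evolve t0 K r (g z) t).
Proof.
move=> [sK fK] ag rt tr x.
set C := component (edge_slot t0 K r) x.
have fC : finite_set C by exact: fK.
have /finite_seqP[X CX] := fC.
have [d [F [d0 hF]]] := approximable_seq X ag.
have [e e0 he] := sparse_mesh K (r.+1%:R * t0) fC.
have rt0 : 0 <= r%:R * t0 by rewrite mulr_ge0 // ltW.
have md : Num.min d e <= d by rewrite ge_min lexx.
have me : Num.min d e <= e by rewrite ge_min lexx orbT.
exists (Num.min d e), (X ++ F); split; first by rewrite lt_min d0.
move=> L s z z' uL hL ps ls bs zz.
(* Cut the partition at the start of the slot. *)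
have [s1 [s2 [sE l1]]] : exists s1 s2, s = s1 ++ s2 /\ last 0 s1 = r%:R * t0.
  by case/splitPl: (bs r rt) => s1 s2 l1; exists s1, s2.
move: ps ls bs; rewrite {s}sE.
rewrite cat_path l1 last_cat discrete_run_cat l1 => /andP[ps1 ps2] ls bs.
have stC : stable K C (r%:R * t0) (r.+1%:R * t0) by exact: component_stable.
have hLC p : inside C p -> p \in L.
  by rewrite /inside CX /= => -[p1 p2]; apply: hL; rewrite mem_cat ?p1 ?p2.
rewrite /evolve -/C -ls.
apply: (slot_agree sK fC stC rt0 (lexx _) (path_mesh_sub me ps2) _ he) => //.
- by rewrite ls.
- move=> y; rewrite CX /= => yX; apply: (hF _ yX _ _ _ _ uL _ (path_mesh_sub md ps1) l1).
  + by move=> p p1 p2; apply: hL; rewrite mem_cat ?p1 ?p2 orbT.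
  + move=> j jr; have jt : j%:R * t0 <= t by exact: le_trans rt.
    have := bs j jt; rewrite -cat_cons mem_cat => /orP[//|js2].
    have := path_mesh_mem ps2 js2 => /andP[rj _].
    have -> : j%:R * t0 = r%:R * t0 by apply/le_anti; rewrite jr rj.
    by rewrite -l1 mem_last.
  + by move=> y' yF; apply: zz; rewrite mem_cat yF orbT.
- exact: component_self.
Qed.

Lemma discrete_run_trivial K L d u s z : path (mesh d) u s -> last u s = u ->
  discrete_run K L u s z = z.
Proof.
elim: s u z => //= v s ih u z /andP[/andP[uv _] ps] ls.
have vu : v = u by apply/le_anti; rewrite uv andbT -[leRHS]ls (path_mesh_le ps).
rewrite vu in ps ls *; rewrite ih //.
by rewrite /sweep {ih}; elim: L z => //= p L ihL z; rewrite /rang ltnn ihL.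
Qed.

Lemma approximable_grid K r : regular K ->
  approximable K (r%:R * t0) (fun z => eta_grid t0 K z r).
Proof.
move=> rK; elim: r => [|r ih] /=.
  move=> x; exists 1, [:: x]; split => // L s z z' _ _ ps ls _ zz.
  rewrite mul0r in ls; rewrite (discrete_run_trivial K L _ ps) ?ls // zz //.
  by rewrite inE.
have := approximable_evolve rK ih; apply => //.
by rewrite ler_wpM2r ?ler_nat // ltW.
Qed.

Lemma slot_itv (t : R) : 0 < t ->
  let r := `|Num.ceil (t / t0)|%N.-1 in r%:R * t0 < t /\ t <= r.+1%:R * t0.
Proof.
move=> t_gt0; have y0 : 0 < t / t0 by rewrite divr_gt0.
have c0 : (0 < Num.ceil (t / t0))%R by rewrite -ceil_gt0 in y0 *.
have /andP[h1 h2] := ceil_itv (t / t0).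
case E : (Num.ceil (t / t0)) c0 h1 h2 => [[//|n]|//] _ h1 h2 /=.
rewrite -ltr_pdivlMr // -ler_pdivrMr //; split => //.
apply: le_lt_trans h1; rewrite -natz intrD.
by rewrite /= -addn1 natrD; lra.
Qed.

Lemma slot0 : `|Num.ceil ((0 : R) / t0)|%N.-1 = 0%N.
Proof. by rewrite mul0r ceil0. Qed.

Lemma approximable_eta K t : regular K -> 0 <= t ->
  approximable K t (fun z => eta t0 K z t).
Proof.
move=> rK; rewrite le_eqVlt => /predU1P[<-|t_gt0]; rewrite /eta.
  rewrite slot0; apply: approximable_evolve => //; rewrite ?mul0r //.
    by have := approximable_grid 0 rK; rewrite mul0r.
  by rewrite mul1r ltW.
have [h1 h2] := slot_itv t_gt0.
by apply: approximable_evolve => //; [exact: approximable_grid|exact: ltW].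
Qed.

Lemma isolated_seq (X : seq R) (s : R) : exists2 d : R, 0 < d &
  forall x, x \in X -> s - d < x -> x < s + d -> x = s.
Proof.
elim: X => [|y X [d d0 ih]]; first by exists 1.
have [->|ys] := eqVneq y s.
  by exists d => // x; rewrite inE => /predU1P[->//|]; exact: ih.
have e0 : 0 < `|y - s| by rewrite normr_gt0 subr_eq0.
exists (Num.min d `|y - s|); first by rewrite lt_min d0.
have m1 : Num.min d `|y - s| <= d by rewrite ge_min lexx.
have m2 : Num.min d `|y - s| <= `|y - s| by rewrite ge_min lexx orbT.
move=> x; rewrite inE => /predU1P[->|xX] h1 h2; last by apply: ih => //; lra.
suff : `|y - s| < `|y - s| by rewrite ltxx.
by rewrite {1}ltr_norml; apply/andP; split; lra.
Qed.

Lemma partition_exists (X : seq R) (d a b : R) : 0 < d -> 0 <= a -> a <= b ->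
  exists s, [/\ path (mesh d) a s, last a s = b &
    forall x, x \in X -> a <= x -> x <= b -> x \in a :: s].
Proof.
move=> d0; apply: (interval_ind (P := fun a b : R =>
  exists s, [/\ path (mesh d) a s, last a s = b &
    forall x, x \in X -> a <= x -> x <= b -> x \in a :: s])).
  move=> {}a m {}b _ _ _ [s [ps ls hs]] [s' [ps' ls' hs']]; exists (s ++ s').
  rewrite cat_path last_cat ls ps ps' ls'; split => // x xX ax xb.
  rewrite -cat_cons mem_cat; have [xm|mx] := leP x m; first by rewrite hs.
  have := hs' x xX (ltW mx) xb; rewrite inE => /predU1P[->|->]; last by rewrite orbT.
  by rewrite -{1}ls mem_last.
move=> s s0; have [e e0 he] := isolated_seq X s.
exists (Num.min e (d / 2)); first by rewrite lt_min e0 divr_gt0.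
have m1 : Num.min e (d / 2) <= e by rewrite ge_min lexx.
have m2 : Num.min e (d / 2) <= d / 2 by rewrite ge_min lexx orbT.
move: (Num.min _ _) m1 m2 => m m1 m2 {}a {}b a0 da as_ sb bd.
exists [:: s; b]; rewrite /= /mesh andbT; split => //.
  by apply/andP; split; apply/andP; split; lra.
move=> x xX ax xb; rewrite (he x xX) ?inE ?eqxx ?orbT //; lra.
Qed.

End approximation.

(** * The flow property *)
Section flow.
Context {R : realType} {S : countType} (t0 : R).
Hypothesis t0_gt0 : 0 < t0.
Implicit Types (K : driving R S) (z : config S) (p : opair S).

Lemma discrete_run_shift K L (t : {nonneg R}) u s z : simple_jumps K -> 0 <= u ->
  all (fun v => 0 <= v) s ->
  discrete_run (shift_driving t K) L u s z =
    discrete_run K L (t%:num + u) [seq t%:num + v | v <- s] z.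
Proof.
move=> sK; elim: s u z => //= v s ih u z u0 /andP[v0 s0]; rewrite ih //; congr discrete_run.
rewrite /sweep {ih}; elim: L z => //= p L ihL z; rewrite ihL /rang; congr foldl.
rewrite /shift_driving !shift_pathE //.
have h w : 0 <= w -> (K p t%:num <= K p (t%:num + w)%R)%N.
  by move=> w0; apply: simple_mono => //; rewrite lerDl.
by rewrite ltn_subLR ?h // subnKC // h.
Qed.

Lemma path_mesh_map (d t u : R) s :
  path (mesh d) (t + u) [seq t + v | v <- s] = path (mesh d) u s.
Proof.
rewrite path_map; apply: eq_path => x y /=; rewrite /mesh lerD2l; congr (_ && _).
by rewrite opprD addrACA subrr add0r.
Qed.

Definition pairs (F : seq S) : seq (opair S) :=
  undup (pmap insub [seq (x, y) | x <- F, y <- F]).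

Lemma pairs_uniq F : uniq (pairs F). Proof. exact: undup_uniq. Qed.

Lemma mem_pairs F p : (val p).1 \in F -> (val p).2 \in F -> p \in pairs F.
Proof.
move=> p1 p2; rewrite mem_undup mem_pmap_sub.
by apply/allpairsP; exists (val p); split => //; case: (val p).
Qed.

Definition slot_grid (N : nat) : seq R := [seq j%:R * t0 | j <- iota 0 N].

Lemma mem_slot_grid (T : R) (j : nat) : j%:R * t0 <= T ->
  j%:R * t0 \in slot_grid (Num.truncn (T / t0)).+1.
Proof.
move=> jT; apply/mapP; exists j => //; rewrite mem_iota /= add0n ltnS.
by rewrite -(@natrK R j) le_truncn // ler_pdivlMr.
Qed.

(** The two sides use time slots with different endpoints.  Both agree with the
    discretized evolution along one fine partition that contains the endpoints
    of either kind and the time [t] itself. *)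
Lemma eta_flow K (t : {nonneg R}) (s : R) z :
  regular t0 K -> regular t0 (shift_driving t K) -> 0 <= s ->
  eta t0 K z (t%:num + s) = eta t0 (shift_driving t K) (eta t0 K z t%:num) s.
Proof.
move=> rK rT s0; apply/funext => x.
set K' := shift_driving t K in rT *.
have ts0 : 0 <= t%:num + s by rewrite addr_ge0.
have [d1 [F1 [d10 h1]]] := approximable_eta t0_gt0 rK ts0 x.
have [d2 [F2 [d20 h2]]] := approximable_eta t0_gt0 rT s0 x.
have [d3 [F3 [d30 h3]]] := approximable_seq F2 (approximable_eta t0_gt0 rK (ge0 t)).
pose d := Num.min d1 (Num.min d2 d3).
have d0 : 0 < d by rewrite !lt_min d10 d20.
have dd1 : d <= d1 by rewrite ge_min lexx.
have dd2 : d <= d2 by rewrite !ge_min lexx orbT.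
have dd3 : d <= d3 by rewrite !ge_min lexx !orbT.
pose X := slot_grid (Num.truncn ((t%:num + s) / t0)).+1.
have [s1 [ps1 ls1 hs1]] := partition_exists X d0 (lexx 0) (ge0 t).
have [s2 [ps2 ls2 hs2]] :=
  partition_exists (X ++ [seq v - t%:num | v <- X]) d0 (lexx 0) s0.
pose L := pairs (F1 ++ F2 ++ F3).
have hL (F : seq S) p : {subset F <= F1 ++ F2 ++ F3} ->
    (val p).1 \in F -> (val p).2 \in F -> p \in L.
  by move=> FF p1 p2; apply: mem_pairs; exact: FF.
have sK := rK.1.
(* Both sides are runs along [s1] followed by the translate of [s2]. *)
transitivity (discrete_run K L 0 (s1 ++ [seq t%:num + v | v <- s2]) z x).
  apply/esym/h1 => //; first exact: pairs_uniq.
  - by move=> p; apply: hL => y yF; rewrite mem_cat yF.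
  - apply: path_mesh_sub dd1 _; rewrite cat_path ls1 ps1 /=.
    by have := path_mesh_map d t%:num 0 s2; rewrite addr0 => ->.
  - rewrite last_cat ls1; have := last_map (fun v => t%:num + v) s2 0.
    by rewrite addr0 ls2 => ->.
  - move=> j jts; rewrite -cat_cons mem_cat.
    have jX : j%:R * t0 \in X by exact: mem_slot_grid.
    have j0 : 0 <= j%:R * t0 by rewrite mulr_ge0 // ltW.
    have [jt|tj] := leP (j%:R * t0) t%:num; first by rewrite hs1.
    apply/orP; right; have : j%:R * t0 - t%:num \in 0 :: s2.
      apply: hs2; last by rewrite lerBlDl.
        by rewrite mem_cat; apply/orP; right; exact: (map_f (fun v => v - t%:num)).
      by rewrite subr_ge0 ltW.
    rewrite inE => /predU1P[/eqP|js2]; first by rewrite subr_eq0 gt_eqF.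
    by apply/mapP; exists (j%:R * t0 - t%:num) => //; rewrite addrC subrK.
rewrite discrete_run_cat ls1.
have := discrete_run_shift L t (discrete_run K L 0 s1 z) sK (lexx 0) (s := s2);
  rewrite addr0 => <-; last first.
  by apply/allP => v vs; have /andP[] := path_mesh_mem ps2 vs.
apply: h2 => //; first exact: pairs_uniq.
- by move=> p; apply: hL => y yF; rewrite !mem_cat yF orbT.
- exact: path_mesh_sub dd2 ps2.
- move=> j js; apply: hs2 => //; last by rewrite mulr_ge0 // ltW.
  by rewrite mem_cat mem_slot_grid // (le_trans js) // lerDr.
- move=> y yF2; apply/esym; apply: (h3 y yF2) => //; first exact: pairs_uniq.
  + by move=> p; apply: hL => y' yF; rewrite !mem_cat yF !orbT.
  + exact: path_mesh_sub dd3 ps1.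
  + move=> j jt; apply: hs1 => //; last by rewrite mulr_ge0 // ltW.
    by apply: mem_slot_grid; rewrite (le_trans jt) // lerDl.
Qed.

End flow.

(** * Regularity of the exclusion trajectories *)
Section eta_path.
Context {R : realType} {S : countType} (t0 : R).
Hypothesis t0_gt0 : 0 < t0.
Implicit Types (K : driving R S) (z : config S) (p : opair S).

(** Slots are closed on the left as well: nothing happens at their left end. *)
Lemma eta_in_slot K z r (t : R) : r%:R * t0 <= t -> t <= r.+1%:R * t0 ->
  eta t0 K z t = evolve t0 K r (eta_grid t0 K z r) t.
Proof.
have nil C (u : R) : update_times K C u u = [::].
  by apply: update_times_nil => v [/andP[h1 h2]]; lra.
move=> rt tr; have t_ge0 : 0 <= t by rewrite (le_trans _ rt) // mulr_ge0 // ltW.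
have [t_gt0|t_le0] := ltP 0 t; last first.
  have tE : t = 0 by apply/le_anti; rewrite t_le0.
  have -> : r = 0%N.
    apply/eqP; rewrite -(eqr_nat R) eq_le ler0n andbT.
    by have := rt; rewrite tE -(mul0r t0) ler_pM2r.
  by rewrite /eta tE slot0.
have [] := slot_itv t0_gt0 t_gt0; rewrite /eta.
set r' := `|Num.ceil (t / t0)|%N.-1 => h1 h2.
have rr' : (r' <= r)%N.
  by rewrite -ltnS -(ltr_nat R) -(ltr_pM2r t0_gt0) (lt_le_trans h1).
have r'r : (r <= r'.+1)%N by rewrite -(ler_nat R) -(ler_pM2r t0_gt0) (le_trans rt).
move: rr'; rewrite leq_eqVlt => /predU1P[-> //|rr'].
have {rr' r'r}rE : r = r'.+1 by apply/eqP; rewrite eqn_leq r'r.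
have tE : t = r'.+1%:R * t0 by apply/le_anti; rewrite h2 -rE rt.
by apply/funext => x; rewrite rE [in RHS]/evolve tE nil.
Qed.

Lemma evolve_cst K r z x (u v : R) :
  finite_set (component (edge_slot t0 K r) x) -> r%:R * t0 <= u -> u <= v ->
  (forall w, ~ ring_times K (component (edge_slot t0 K r) x) u v w) ->
  evolve t0 K r z u x = evolve t0 K r z v x.
Proof.
move=> fC ru uv nr; have r0 : 0 <= r%:R * t0 by rewrite mulr_ge0 // ltW.
by rewrite /evolve (update_times_cat K fC r0 ru uv) (update_times_nil nr) cats0.
Qed.

Lemma eta_step K z x (s : R) : regular t0 K -> 0 <= s ->
  exists (d : R) b, [/\ 0 < d,
    forall u, s <= u -> u < s + d -> eta t0 K z u x = eta t0 K z s x &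
    forall u, 0 <= u -> s - d < u -> u < s -> eta t0 K z u x = b].
Proof.
move=> [sK fK] s0.
have isol r : exists2 d : R, 0 < d & forall u v w, s - d < u -> v < s + d ->
    ring_times K (component (edge_slot t0 K r) x) u v w -> w = s.
  have [l _ hl] := finite_inside (fK r x).
  have [d d0 hd] := jump_isolated_seq K l s0.
  exists d => // u v w du vd [/andP[uw wv] [p /hl pl rp]].
  by apply: (hd p) => //; [lra|lra|exact: rings_jump].
have [d [d0 hd]] : exists d : R, 0 < d /\
    forall u, s <= u -> u < s + d -> eta t0 K z u x = eta t0 K z s x.
  pose r := Num.truncn (s / t0).
  have rs : r%:R * t0 <= s by rewrite -ler_pdivlMr // truncn_le // divr_ge0 // ltW.
  have sr : s < r.+1%:R * t0 by rewrite -ltr_pdivrMr //; exact: truncnS_gt.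
  have [d d0 hd] := isol r.
  exists (Num.min d (r.+1%:R * t0 - s)).
  rewrite lt_min d0 subr_gt0; split => // u su.
  rewrite -ltrBlDl lt_min !ltrBlDl => /andP[ud]; rewrite addrC subrK => ur.
  rewrite (@eta_in_slot K z r u) ?(@eta_in_slot K z r s) //; try lra.
  apply/esym; apply: evolve_cst => //; first exact: fK.
  move=> w rw; have ws := hd s u w _ ud rw.
  by case: rw => /andP[]; rewrite ws ?ltxx // ltrBlDr ltrDl.
move: s0; rewrite le_eqVlt => /predU1P[s0|s_gt0].
  by exists d, true; split => // u; rewrite s0; lra.
have [h1 h2] := slot_itv t0_gt0 s_gt0.
move: h1 h2; set r := (_.-1)%N => h1 h2.
have [e e0 he] := isol r.
have [m [m0 md me mr]] : exists m, [/\ 0 < m, m <= d, m <= e & m <= s - r%:R * t0].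
  exists (Num.min d (Num.min e (s - r%:R * t0))).
  by rewrite !lt_min d0 e0 subr_gt0 h1 !ge_min !lexx !orbT.
exists m, (eta t0 K z (s - m / 2) x); split => //.
  by move=> u su um; apply: hd => //; lra.
move=> u u0 su us.
have hh a b : a <= b -> s - m < a -> b < s -> eta t0 K z a x = eta t0 K z b x.
  move=> ab ma bs; rewrite (@eta_in_slot K z r a) ?(@eta_in_slot K z r b) //; try lra.
  apply: evolve_cst => //; [exact: fK|lra|].
  move=> w rw; have ws : w = s by apply: (he a b) => //; lra.
  by case: rw => /andP[_]; rewrite ws; lra.
have [um|mu] := leP u (s - m / 2); first by apply: hh => //; lra.
by apply/esym; apply: hh => //; lra.
Qed.

Definition eta_fun K z : {nonneg R} -> config S := fun t => eta t0 K z t%:num.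

Lemma is_cadlag_eta K z : regular t0 K -> is_cadlag (eta_fun K z).
Proof.
move=> rK s s0.
have extE u : 0 <= u -> extend (eta_fun K z) u = eta t0 K z u.
  by move=> u0; rewrite /extend /eta_fun /= max_r.
have ext0 u : u <= 0 -> extend (eta_fun K z) u = eta t0 K z 0.
  by move=> u0; rewrite /extend /eta_fun /= max_l.
split.
  apply: cvg_config => x; have [d [b [d0 h _]]] := eta_step z x rK s0.
  near=> u; have su : s < u by near: u; exact: nbhs_right_gt.
  rewrite !extE ?h //; try lra.
  by near: u; apply: nbhs_right_lt; rewrite ltrDl.
have [s_gt0|s_le0] := ltP 0 s; last first.
  apply/cvg_ex; exists (eta t0 K z 0); apply: cvg_config => x.
  near=> u; rewrite ext0 //; apply: (le_trans _ s_le0); apply: ltW.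
  by near: u; exact: nbhs_left_lt.
have /choice[l hl] : forall x, exists b, exists2 d : R, 0 < d &
    forall u, 0 <= u -> s - d < u -> u < s -> eta t0 K z u x = b.
  by move=> x; have [d [b [d0 _ h]]] := eta_step z x rK s0; exists b, d.
apply/cvg_ex; exists (l : config S); apply: cvg_config => x.
have [d d0 h] := hl x.
near=> u; have u0 : 0 < u by near: u; exact: nbhs_left_gt.
rewrite extE ?ltW // h //; first exact: ltW.
  by near: u; apply: nbhs_left_gt; rewrite ltrBlDr ltrDl.
Unshelve. all: by end_near. Qed.

End eta_path.

(** * Events up to a given time *)
Section past.
Context {R : realType} {S : countType}.
Implicit Types (K : driving R S) (p q : opair S).

Definition past (t : R) : set (set (driving R S)) :=
  <<s [set A | exists (p : opair S) (s : R) (k : nat), 0 <= s <= t /\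
         A = [set K : driving R S | K p s = k]] >>.

Lemma past_salg t : sigma_algebra setT (past t).
Proof. exact: smallest_sigma_algebra. Qed.

Lemma past_coord t p (s : R) : 0 <= s -> s <= t ->
  cmeas (past t) (fun K : driving R S => K p s).
Proof.
move=> s0 st k; apply: sub_sigma_algebra; exists p, s, k; split => //.
by rewrite s0.
Qed.

Lemma measurable_proj p (B : set (borel (cadlag R nat))) : measurable B ->
  measurable ([set K | B (K p)] : set (borel (driving R S))).
Proof.
move=> mB; suff : <<s @open (cadlag R nat) >> `<=`
    [set A | measurable ([set K | A (K p)] : set (borel (driving R S)))] by apply.
apply: smallest_sub.
  exact: (preimage_salg (fun K : driving R S => K p) (borel_salg _)).
move=> U oU /=; apply: sub_sigma_algebra.
have : continuous ((fun K => K p) : driving R S -> cadlag R nat).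
  exact: (@proj_continuous (opair S) (fun _ => cadlag R nat) p).
by move=> /continuousP /(_ U oU).
Qed.

Lemma entourage_nat : entourage [set p : nat * nat | id p.1 = id p.2].
Proof. by rewrite uniform_discrete => p [z _ <-]. Qed.

Lemma measurable_nat_coord (s : R) (k : nat) : 0 <= s ->
  measurable ([set w | w s = k] : set (borel (cadlag R nat))).
Proof. exact: (measurable_path_at entourage_nat). Qed.

Lemma measurable_coord p (s : R) (k : nat) : 0 <= s ->
  measurable ([set K | K p s = k] : set (borel (driving R S))).
Proof. by move=> s0; exact: (measurable_proj p (measurable_nat_coord k s0)). Qed.

Lemma past_measurable t (A : set (borel (driving R S))) : past t A -> measurable A.
Proof.
move: A; apply: smallest_sub; first exact: borel_salg.
by move=> _ [p [s [k [/andP[s0 _] ->]]]]; exact: measurable_coord.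
Qed.

Lemma past_le (s t : R) : s <= t -> past s `<=` past t.
Proof.
move=> st; apply: smallest_sub; first exact: past_salg.
move=> _ [p [u [k [/andP[u0 us] ->]]]]; apply: past_coord => //.
exact: le_trans st.
Qed.

Section coordinates.
Variables (G : set (set (driving R S))) (t : R).
Hypothesis sG : sigma_algebra setT G.
Hypothesis hG : forall p s, 0 <= s -> s <= t -> cmeas G (fun K => K p s).

Lemma cmeas_counter x y (s : R) : 0 <= s -> s <= t -> cmeas G (fun K => counter K x y s).
Proof.
move=> s0 st; rewrite /counter; case: insub => [p|]; first exact: hG.
exact: cmeas_cst.
Qed.

Lemma cmeas_edge x y (u v : R) : 0 <= u -> u <= t -> 0 <= v -> v <= t ->
  cmeas G (fun K => edge K u v x y).
Proof.
move=> u0 ut v0 vt; rewrite /edge; apply: (cmeas2 sG (fun a b => a && b)).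
  exact: cmeas_cst.
apply: (cmeas2 sG (fun a b => (a < b)%N)); rewrite /sym_count;
  by apply: (cmeas2 sG addn); exact: cmeas_counter.
Qed.

(** Finiteness expressed through countable quantifiers only. *)
Lemma finite_componentsE (e : rel S) :
  finite_components e <-> forall x, exists F : seq S, forall s, path e x s -> last x s \in F.
Proof.
split=> h x; last first.
  have [F hF] := h x; apply: (@sub_finite_set _ _ [set` F]) => //.
  by move=> y [s ps ->]; exact: hF.
have /finite_seqP[F FE] := h x; exists F => s ps.
have : component e x (last x s) by exists s.
by rewrite FE.
Qed.

Lemma finite_components_meas (u v : R) : 0 <= u -> u <= t -> 0 <= v -> v <= t ->
  G [set K | finite_components (edge K u v)].
Proof.
move=> u0 ut v0 vt.
have -> : [set K | finite_components (edge K u v)] = [set K | forall x, exists F : seq S,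
    forall s, path (edge K u v) x s -> last x s \in F].
  by apply/seteqP; split => K /finite_componentsE.
apply: salg_all => // x; apply: salg_ex => // F; apply: salg_all => // s.
apply: (cmeas_pred sG (f := fun K => path (edge K u v) x s) (fun b => b -> last x s \in F)).
elim: s x => [|y s ih] x /=; first exact: cmeas_cst.
by apply: (cmeas2 sG (fun a b => a && b)); [exact: cmeas_edge|exact: ih].
Qed.

End coordinates.

End past.

(** * Unit jumps and disjoint jumps read on dyadic grids *)
Section unit_steps.
Context {R : realType}.
Implicit Types (w : cadlag R nat) (h : R).

Definition unit_incr h N w := forall i, (i < N)%N ->
  w (i.+1%:R * h) = w (i%:R * h) \/ w (i.+1%:R * h) = (w (i%:R * h)).+1.

Definition no_common_incr h N w w' := forall i, (i < N)%N ->
  w (i%:R * h) = w (i.+1%:R * h) \/ w' (i%:R * h) = w' (i.+1%:R * h).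

Lemma dyadic_small (T d : R) : 0 < d -> exists n0, forall n, (n0 <= n)%N ->
  T / (2 ^ n)%:R < d.
Proof.
move=> d0; exists (Num.truncn (T / d)).+1 => n nn.
rewrite ltr_pdivrMr ?ltr0n ?expn_gt0 // mulrC -ltr_pdivrMr //.
apply: lt_le_trans (truncnS_gt _) _; rewrite ler_nat.
by apply: leq_trans nn _; apply: ltnW; exact: ltn_expl.
Qed.

(** Asking for arbitrarily fine grids, and not just for one, makes the path
    monotone as well. *)
Definition often_unit w := forall T n0 : nat, exists n, (n0 <= n)%N /\
  unit_incr (T%:R / (2 ^ n)%:R) (2 ^ n) w.

Lemma unit_incr_mono h N w : unit_incr h N w ->
  forall i j, (i <= j)%N -> (j <= N)%N -> (w (i%:R * h)%R <= w (j%:R * h)%R)%N.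
Proof.
move=> hw i j; elim: j => [|j ih]; first by rewrite leqn0 => /eqP ->.
rewrite leq_eqVlt => /predU1P[-> //|ij] jN.
apply: leq_trans (ih ij (ltnW jN)) _.
by have [->|->] := hw j jN.
Qed.

(** On a fine grid where all increments are 0 or 1, compare the grid points
    just after the two times; right continuity makes the values agree. *)
Lemma often_unit_mono w : often_unit w ->
  forall a b : R, 0 <= a -> a <= b -> (w a <= w b)%N.
Proof.
move=> hw a b a0 ab; have b0 := le_trans a0 ab.
have [d [_ [d0 [ha _]]]] := stepfun_nat w a0.
have [e [_ [e0 [hb _]]]] := stepfun_nat w b0.
pose T := (Num.truncn b).+1.
have m0 : 0 < Num.min d e by rewrite lt_min d0.
have [n0 hn0] := dyadic_small T%:R m0.
have [n [nn0 hn]] := hw T n0.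
have := hn0 n nn0; move: hn; set h := _ / _ => hn; rewrite lt_min => /andP[hd he].
have N0 : (0 : R) < (2 ^ n)%:R by rewrite ltr0n expn_gt0.
have h0 : 0 < h by rewrite divr_gt0 // ltr0n.
have up (x : R) : 0 <= x -> x < (Num.truncn (x / h)).+1%:R * h /\
    (Num.truncn (x / h)).+1%:R * h <= x + h.
  move=> x0; have /truncn_itv/andP[h1 h2] : 0 <= x / h by rewrite divr_ge0 // ltW.
  rewrite -ltr_pdivrMr //; split => //.
  by rewrite -addn1 natrD mulrDl mul1r lerD2r -ler_pdivlMr.
have [a1 a2] := up a a0; have [b1 b2] := up b b0.
rewrite -(ha ((Num.truncn (a / h)).+1%:R * h)); [|lra|lra].
rewrite -(hb ((Num.truncn (b / h)).+1%:R * h)); [|lra|lra].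
apply: (unit_incr_mono hn); first by rewrite ltnS le_truncn // ler_pM2r ?invr_gt0.
have bh : 0 <= b / h by rewrite divr_ge0 // ltW.
by rewrite truncn_lt_nat // ltr_pdivrMr // /h mulrC divfK ?gt_eqF // truncnS_gt.
Qed.

Lemma grid_cell (T : R) (n : nat) (s : R) : 0 < s -> s <= T ->
  exists2 i, (i < 2 ^ n)%N & i%:R * (T / (2 ^ n)%:R) < s /\ s <= i.+1%:R * (T / (2 ^ n)%:R).
Proof.
move=> s0 sT; have N0 : (0 : R) < (2 ^ n)%:R by rewrite ltr0n expn_gt0.
have h0 : 0 < T / (2 ^ n)%:R by rewrite divr_gt0 // (lt_le_trans s0).
have [h1 h2] := slot_itv h0 s0.
move: h1 h2; set r := (_.-1)%N => h1 h2; exists r => //.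
rewrite -(ltr_nat R) -(ltr_pM2r h0) (lt_le_trans h1) // (le_trans sT) //.
by rewrite mulrC divfK // gt_eqF.
Qed.

(** A jump lies in a grid interval whose total increment is at most 1. *)
Lemma often_unit_jump w : often_unit w -> forall s, jump_times w s -> w s = (left_lim w s).+1.
Proof.
move=> hw s js; have s0 := jump_gt0 js.
pose T := (Num.truncn s).+1.
have [n [_ hn]] := hw T 0%N.
have [i iN [si is_]] := grid_cell n s0 (ltW (truncnS_gt s)).
have mw := often_unit_mono hw.
have i0 : 0 <= i%:R * (T%:R / (2 ^ n)%:R) :> R by rewrite mulr_ge0 // divr_ge0.
have [l1 l2] := mono_left_lim mw i0 si.
have l3 := mw _ _ (ltW s0) is_.
have : left_lim w s <> w s by move=> e; apply: js.
have := hn i iN; move: l1 l2 l3; rewrite -/T.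
move: (w _) (w s) (left_lim w s) (w _) => a b c d; lia.
Qed.

(** Jumps are isolated, so that a fine grid separates them. *)
Lemma jump_often_unit w : (forall s, jump_times w s -> w s = (left_lim w s).+1) -> often_unit w.
Proof.
move=> hw T n0.
have [|d d0 hd] := @lebesgue_gap R (fun u v => w v = w u \/ w v = (w u).+1) _ T%:R.
  move=> s s0; have [d [d0 [h1 h2]]] := left_lim_step w s0.
  exists d => // u v u0 du uv vd.
  have hs : w s = left_lim w s \/ w s = (left_lim w s).+1.
    by have [/hw|/contrapT] := pselect (jump_times w s); [right|left].
  have [vs|sv] := ltP v s; first by rewrite !h2 //; [left|lra|lra].
  rewrite (h1 v) //; have [us|su] := ltP u s; first by rewrite (h2 u).
  by rewrite (h1 u) //; [left|lra].
have [n1 hn1] := dyadic_small T%:R d0.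
exists (maxn n0 n1); split; first exact: leq_maxl.
move=> i iN; have N0 : (0 : R) < (2 ^ maxn n0 n1)%:R by rewrite ltr0n expn_gt0.
have hh := hn1 _ (leq_maxr n0 n1).
have h0 : 0 <= T%:R / (2 ^ maxn n0 n1)%:R :> R by rewrite divr_ge0 // ltW.
move: hh h0 iN; set h := _ / _ => hh h0 iN.
have iS : i.+1%:R * h = i%:R * h + h by rewrite -addn1 natrD mulrDl mul1r.
have ST : i.+1%:R * h <= T%:R.
  have -> : T%:R = (2 ^ maxn n0 n1)%:R * h by rewrite /h mulrC divfK // gt_eqF.
  by rewrite ler_wpM2r // ler_nat.
apply: hd => //; rewrite ?iS ?lerDl //; first by rewrite mulr_ge0.
by rewrite addrAC subrr add0r.
Qed.

End unit_steps.

Section no_common.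
Context {R : realType}.
Implicit Types (w : cadlag R nat).

Definition sometimes_apart w w' := forall T : nat, exists n,
  no_common_incr (T%:R / (2 ^ n)%:R) (2 ^ n) w w'.

Lemma sometimes_apart_jumps w w' : often_unit w -> often_unit w' ->
  sometimes_apart w w' -> jump_times w `&` jump_times w' = set0.
Proof.
move=> uw uw' hw; apply/seteqP; split => // s [js js'].
have s0 := jump_gt0 js; pose T := (Num.truncn s).+1.
have [n hn] := hw T.
have [i iN [si is_]] := grid_cell n s0 (ltW (truncnS_gt s)).
have i0 : 0 <= i%:R * (T%:R / (2 ^ n)%:R) :> R by rewrite mulr_ge0 // divr_ge0.
have incr v : often_unit v -> jump_times v s ->
    (v (i%:R * (T%:R / (2 ^ n)%:R))%R < v (i.+1%:R * (T%:R / (2 ^ n)%:R))%R)%N.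
  move=> uv jv; have mv := often_unit_mono uv.
  have [l1 _] := mono_left_lim mv i0 si.
  apply: leq_trans (mv _ _ (ltW s0) is_).
  by rewrite (often_unit_jump uv jv).
have := incr _ uw js; have := incr _ uw' js'.
by have [->|->] := hn i iN; rewrite ltnn.
Qed.

Lemma jumps_sometimes_apart w w' :
  jump_times w `&` jump_times w' = set0 -> sometimes_apart w w'.
Proof.
move=> hw T.
have [|d d0 hd] := @lebesgue_gap R (fun u v => w u = w v \/ w' u = w' v) _ T%:R.
  move=> s s0.
  suff [v [hv [d [d0 [h1 h2]]]]] : exists v : cadlag R nat, (v = w \/ v = w') /\
      exists d : R, 0 < d /\ step_at v s d (v s).
    exists d => // a b a0 da ab bd.
    have e : v a = v b.
      have [bs|sb] := ltP b s; first by rewrite !h2 //; lra.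
      rewrite (h1 b) //; have [as_|sa] := ltP a s; first by rewrite h2.
      by rewrite h1 //; lra.
    by case: hv e => -> e; [left|right].
  have [d [d0 hd]] := left_lim_step w s0; have [d' [d'0 hd']] := left_lim_step w' s0.
  have [jw|/contrapT e] := pselect (jump_times w s); last first.
    by exists w; split; [left|exists d; rewrite e].
  have [jw'|/contrapT e] := pselect (jump_times w' s); last first.
    by exists w'; split; [right|exists d'; rewrite e].
  have : (jump_times w `&` jump_times w') s by split.
  by rewrite hw.
have [n1 hn1] := dyadic_small T%:R d0.
exists n1 => i iN; have N0 : (0 : R) < (2 ^ n1)%:R by rewrite ltr0n expn_gt0.
have hh := hn1 _ (leqnn n1).
have h0 : 0 <= T%:R / (2 ^ n1)%:R :> R by rewrite divr_ge0 // ltW.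
move: hh h0 iN; set h := _ / _ => hh h0 iN.
have iS : i.+1%:R * h = i%:R * h + h by rewrite -addn1 natrD mulrDl mul1r.
have ST : i.+1%:R * h <= T%:R.
  have -> : T%:R = (2 ^ n1)%:R * h by rewrite /h mulrC divfK // gt_eqF.
  by rewrite ler_wpM2r // ler_nat.
apply: hd => //; rewrite ?iS ?lerDl //; first by rewrite mulr_ge0.
by rewrite addrAC subrr add0r.
Qed.

End no_common.

(** * Good driving paths *)
Section gamma_star.
Context {R : realType} {S : countType} (t0 : R).
Hypothesis t0_gt0 : 0 < t0.
Implicit Types (K : driving R S) (p q : opair S).

Lemma Gamma_regular K : Gamma_star t0 K -> regular t0 K.
Proof. by move=> [fK _ sK _]; split. Qed.

Lemma sym_count_slot K x y (N : nat) : (forall p, K p 0 = 0%N) ->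
  (0 < sym_count K x y (N%:R * t0))%N -> x != y ->
  exists2 r, (r < N)%N & edge_slot t0 K r x y.
Proof.
move=> K0 + xy; elim: N => [|N ih].
  rewrite mul0r /sym_count /counter.
  by case: insub => [p|]; case: insub => [q|]; rewrite ?K0.
move=> hN; have [h|] := posnP (sym_count K x y (N%:R * t0)); last first.
  by move=> /ih[r rN er]; exists r => //; exact: ltnW.
by exists N => //; rewrite /edge_slot /edge xy h.
Qed.

(** The number of jumps at [x] is finite because a counter that increased did so
    during one of finitely many slots, and the neighbours of [x] in a slot belong
    to its finite component. *)
Lemma regular_Gamma K : regular t0 K -> (forall p, K p 0 = 0%N) -> Gamma_star t0 K.
Proof.
move=> [sK fK] K0; split => // x t t_ge0.
pose N := (Num.truncn (t / t0)).+1.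
have tN : t <= N%:R * t0 by rewrite -ler_pdivrMr // ltW // truncnS_gt.
pose B := [set y | y != x /\ (0 < sym_count K x y t)%N].
have fB : finite_set B.
  apply: (@sub_finite_set _ _ (\bigcup_(r in [set` iota 0 N]) component (edge_slot t0 K r) x)).
    move=> y [yx hy]; have [||r rN er] := @sym_count_slot K x y N K0.
    - apply: leq_trans hy _; rewrite /sym_count.
      by apply: leq_add; exact: counter_mono.
    - by rewrite eq_sym.
    have rI : r \in iota 0 N by rewrite mem_iota.
    exists r => //.
    by exists [:: y] => //=; rewrite er.
  by apply: bigcup_finite => // r _; exact: fK.
rewrite (esumID B); last by move=> y _; rewrite lee_fin.
rewrite [X in (_ + X)%E]esum1; last first.
  move=> y [yx nB]; have /eqP -> : sym_count K x y t == 0%N; last by [].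
  by rewrite -leqn0 leqNgt; apply/negP => h; apply: nB.
rewrite adde0 esum_fset; first last.
- by move=> y _; rewrite lee_fin.
- by apply: sub_finite_set fB => y [].
rewrite fsbig_finite /=; last by apply: sub_finite_set fB => y [].
by rewrite sumEFin ltry.
Qed.

(** The conditions on jumps, which quantify over all times, are equivalent to
    conditions on counts along dyadic grids. *)
Lemma Gamma_starE K : Gamma_star t0 K <->
  [/\ forall r, finite_components (edge_slot t0 K r), forall p, K p 0 = 0%N,
      forall p, often_unit (K p) &
      forall p q, p != q -> sometimes_apart (K p) (K q)].
Proof.
split.
  move=> [fK _ [dK jK] K0]; split => //.
  - by move=> p; apply: jump_often_unit => s; exact: jK.
  - by move=> p q pq; apply: jumps_sometimes_apart; exact: dK.
move=> [fK K0 uK aK]; apply: regular_Gamma => //; split => //; split.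
  by move=> p q pq; apply: sometimes_apart_jumps => //; exact: aK.
by move=> p s js; exact: often_unit_jump.
Qed.

Lemma measurable_pair (Rl : nat -> nat -> Prop) p q (s t : R) : 0 <= s -> 0 <= t ->
  measurable ([set K | Rl (K p s) (K q t)] : set (borel (driving R S))).
Proof.
move=> s0 t1; have sG := borel_salg (driving R S).
have mc r (u : R) : 0 <= u -> cmeas (measurable : set (set (borel (driving R S))))
    (fun K : driving R S => K r u).
  by move=> u0 k; exact: measurable_coord.
exact: (cmeas_pred sG (fun ab => Rl ab.1 ab.2) (cmeas_pair sG (mc p s s0) (mc q t t1))).
Qed.

Lemma measurable_unit_incr (h : R) N p : 0 <= h ->
  measurable ([set K | unit_incr h N (K p)] : set (borel (driving R S))).
Proof.
move=> h0; have sG := borel_salg (driving R S).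
apply: (salg_all sG) => i; apply: (salg_imply sG) => _.
by apply: (measurable_pair (fun a b => a = b \/ a = b.+1)); rewrite mulr_ge0.
Qed.

Lemma measurable_no_common (h : R) N p q : 0 <= h ->
  measurable ([set K | no_common_incr h N (K p) (K q)] : set (borel (driving R S))).
Proof.
move=> h0; have sG := borel_salg (driving R S).
apply: (salg_all sG) => i; apply: (salg_imply sG) => _.
by apply: (salgU sG); apply: (measurable_pair (fun a b => a = b)); rewrite mulr_ge0.
Qed.

Lemma measurable_often_unit p :
  measurable ([set K | often_unit (K p)] : set (borel (driving R S))).
Proof.
have sG := borel_salg (driving R S).
apply: (salg_all sG) => T; apply: (salg_all sG) => n0; apply: (salg_ex sG) => n.
by apply: (salg_and sG) => _; apply: measurable_unit_incr; rewrite divr_ge0.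
Qed.

Lemma measurable_sometimes_apart p q :
  measurable ([set K | sometimes_apart (K p) (K q)] : set (borel (driving R S))).
Proof.
have sG := borel_salg (driving R S).
apply: (salg_all sG) => T; apply: (salg_ex sG) => n.
by apply: measurable_no_common; rewrite divr_ge0.
Qed.

Lemma measurable_slot r : measurable
  ([set K | finite_components (edge_slot t0 K r)] : set (borel (driving R S))).
Proof.
have r0 : 0 <= r%:R * t0 by rewrite mulr_ge0 // ltW.
have rr : r%:R * t0 <= r.+1%:R * t0 by rewrite ler_wpM2r ?ler_nat // ltW.
apply: (finite_components_meas (borel_salg _) (t := r.+1%:R * t0)) => //.
  by move=> p s s0 _ k; exact: measurable_coord.
exact: le_trans rr.
Qed.

Lemma measurable_Gamma :
  measurable (Gamma_star t0 : set (borel (driving R S))).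
Proof.
have sG := borel_salg (driving R S).
have -> : (Gamma_star t0 : set (borel (driving R S))) =
   ([set K | forall r, finite_components (edge_slot t0 K r)] `&`
    [set K | forall p, K p 0 = 0%N]) `&`
   ([set K | forall p, often_unit (K p)] `&`
    [set K | forall p q, p != q -> sometimes_apart (K p) (K q)]).
  by apply/seteqP; split => K /=;
    [move=> /Gamma_starE[]|move=> [[? ?] [? ?]]; exact/Gamma_starE].
apply: (salgI sG); apply: (salgI sG); apply: (salg_all sG).
- exact: measurable_slot.
- by move=> p; exact: measurable_coord.
- exact: measurable_often_unit.
- move=> p; apply: (salg_all sG) => q; apply: (salg_imply sG) => _.
  exact: measurable_sometimes_apart.
Qed.

Definition sites (m : nat) : seq S := pmap choice.unpickle (iota 0 m).

Lemma mem_sites x m : (choice.pickle x < m)%N -> x \in sites m.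
Proof.
move=> xm; rewrite mem_pmap; apply/mapP; exists (choice.pickle x).
  by rewrite mem_iota.
by rewrite choice.pickleK.
Qed.

Lemma sub_sites (F : seq S) : exists n, forall m, (n <= m)%N -> {subset F <= sites m}.
Proof.
elim: F => [|x F [n hn]]; first by exists 0%N.
exists (maxn n (choice.pickle x).+1) => m; rewrite geq_max => /andP[nm xm] y.
by rewrite inE => /predU1P[->|/(hn m nm)//]; exact: mem_sites.
Qed.

(** One sequence of discretizations, with mesh tending to 0, works for every
    driving path and every initial configuration. *)
Lemma eta_approx (t : R) (x : S) : 0 <= t ->
  exists xi : nat -> driving R S -> config S -> bool,
    (forall m z, cmeas (past t) (fun K => xi m K z)) /\
    forall K, regular t0 K -> exists n, forall m, (n <= m)%N -> forall z z',
      {in sites m, forall y, z y = z' y} -> xi m K z' = eta t0 K z t x.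
Proof.
move=> t_ge0; pose X := slot_grid t0 (Num.truncn (t / t0)).+1.
have /choice[s hs] : forall m : nat, exists s, [/\ path (mesh m.+1%:R^-1) 0 s, last 0 s = t &
    forall x, x \in X -> 0 <= x -> x <= t -> x \in 0 :: s].
  by move=> m; apply: partition_exists.
exists (fun m K z => discrete_run K (pairs (sites m)) 0 (s m) z x); split.
  move=> m z; have [ps ls _] := hs m.
  have sle v : v \in 0 :: s m -> 0 <= v /\ v <= t.
    rewrite inE => /predU1P[->//|vs].
    by have := path_mesh_mem ps vs; rewrite ls => /andP[].
  apply: (cmeas_factor (past_salg t)
    (V := fun K : driving R S =>
      [seq [seq K p (if (0 <= v) && (v <= t) then v else 0) | v <- 0 :: s m] | p <- pairs
        (sites m)])).
    apply: (cmeas_map (past_salg t)) => p; apply: (cmeas_map (past_salg t)) => v.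
    by case: ifP => [/andP[v0 vt]|_]; apply: past_coord.
  move=> K K' /eq_in_map hV.
  have {}hV p v : p \in pairs (sites m) -> v \in 0 :: s m -> K p v = K' p v.
    move=> pL vs; have /eq_in_map /(_ v vs) := hV p pL.
    by have [-> ->] := sle v vs.
  congr (_ x); move: hV {ps ls sle}; elim: (s m) 0 z => //= v s' ih u z hV.
  rewrite ih; last by move=> p a pL as_; apply: hV; rewrite ?inE // orbC -in_cons as_.
  congr discrete_run; rewrite /sweep.
  have : {subset pairs (sites m) <= pairs (sites m)} by [].
  elim: {1 3 4}(pairs (sites m)) z => //= p L ihL z pL.
  rewrite ihL; last by move=> q qL; apply: pL; rewrite inE qL orbT.
  congr foldl; rewrite /rang !hV ?inE ?eqxx ?orbT //; apply: pL; rewrite inE eqxx //.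
move=> K rK; have [d [F [d0 hF]]] := approximable_eta t0_gt0 rK t_ge0 x.
have [n hn] := sub_sites F.
exists (maxn n (Num.truncn d^-1)) => m; rewrite geq_max => /andP[nm dm] z z' zz.
have [ps ls bs] := hs m.
apply: hF => //.
- exact: pairs_uniq.
- by move=> p p1 p2; apply: mem_pairs; exact: hn.
- apply: path_mesh_sub ps; apply/ltW; rewrite invf_plt ?posrE //.
  by apply: lt_le_trans (truncnS_gt _) _; rewrite ler_nat ltnS.
- by move=> j jt; apply: bs => //; [exact: mem_slot_grid|rewrite mulr_ge0 // ltW].
- by move=> y /(hn m nm); exact: zz.
Qed.

Lemma eta_continuous K z (t : R) x : regular t0 K -> 0 <= t ->
  exists n, forall m, (n <= m)%N -> forall z',
    {in sites m, forall y, z y = z' y} -> eta t0 K z' t x = eta t0 K z t x.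
Proof.
move=> rK t_ge0; have [xi [_ h]] := eta_approx x t_ge0.
have [n hn] := h K rK; exists n => m nm z' zz.
by rewrite -(hn m nm z' z') // (hn m nm z z').
Qed.

Lemma eta_past z (t : R) x b : 0 <= t -> exists2 B, past t B &
  forall K, regular t0 K -> B K <-> eta t0 K z t x = b.
Proof.
move=> t_ge0; have [xi [mxi h]] := eta_approx x t_ge0.
exists [set K | exists n, forall m, (n <= m)%N -> xi m K z = b].
  apply: (salg_ex (past_salg t)) => n; apply: (salg_all (past_salg t)) => m.
  by apply: (salg_imply (past_salg t)) => _; exact: mxi.
move=> K rK; have [n hn] := h K rK; split => [[n' hn']|eb].
  by rewrite -(hn (maxn n n') _ z z) ?leq_maxl // hn' // leq_maxr.
by exists n => m nm; rewrite (hn m nm z z).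
Qed.

End gamma_star.

(** * Almost sure events and independence *)
Section full_events.
Context {d : measure_display} {T : measurableType d} {R : realType}.
Variable P : probability T R.
Implicit Types (E : set T).

Definition full (A : set T) := measurable A /\ P (~` A) = 0%E.

Lemma full_all (I : countType) (F : I -> T -> Prop) :
  (forall i, full [set x | F i x]) -> full [set x | forall i, F i x].
Proof.
move=> fF; have sG : sigma_algebra setT (@measurable _ T) by exact: sigma_algebra_measurable.
have mA : measurable [set x | forall i, F i x].
  by apply: (salg_all sG) => i; exact: (fF i).1.
split => //; apply: measure_negligible; first exact: measurableC.
pose F' n : set T := if @choice.unpickle I n is Some i then ~` [set x | F i x] else set0.
have -> : ~` [set x | forall i, F i x] = \bigcup_n F' n.
  apply/seteqP; split => x /=.
    move=> /existsNP[i nF]; exists (choice.pickle i) => //.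
    by rewrite /F' choice.pickleK.
  move=> [n _]; rewrite /F'; case: choice.unpickle => // i nF h; exact: nF.
apply: negligible_bigcup => n; rewrite /F'; case: choice.unpickle => [i|].
  by have [mi Pi] := fF i; apply/negligibleP => //; exact: measurableC.
exact: negligible_set0.
Qed.

Lemma full1 (A : set T) : measurable A -> P A = 1%E -> full A.
Proof. by move=> mA PA; split => //; rewrite probability_setC // PA subee. Qed.

Lemma full_P1 (A : set T) : full A -> P A = 1%E.
Proof.
move=> [mA PA]; rewrite -(setCK A) probability_setC ?PA ?sube0 //.
exact: measurableC.
Qed.

Lemma fullI (A B : set T) : full A -> full B -> full (A `&` B).
Proof.
move=> fA fB; have -> : A `&` B = [set x | forall b : bool, (if b then A else B) x].
  by apply/seteqP; split => x /= => [[Ax Bx] []|h] //; split;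
    [exact: (h true)|exact: (h false)].
by apply: full_all => -[].
Qed.

Lemma full_imply (p : Prop) (A : set T) : (p -> full A) -> full [set x | p -> A x].
Proof.
move=> h; have [hp|np] := pselect p.
  have -> : [set x | p -> A x] = A by apply/seteqP; split => x /=; [exact|].
  exact: h.
have -> : [set x | p -> A x] = setT by apply/seteqP; split => // x _ /np.
by split => //; rewrite setCT measure0.
Qed.

Lemma full_sub (A B : set T) : measurable B -> full A -> A `<=` B -> full B.
Proof.
move=> mB [mA PA] AB; split => //; apply/eqP; rewrite -measure_le0 -PA.
by apply: le_measure; rewrite ?inE; [exact: measurableC|exact: measurableC|exact: subsetC].
Qed.

Lemma full_eq (F A B : set T) : full F -> measurable A -> measurable B ->
  (forall x, F x -> A x <-> B x) -> P A = P B.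
Proof.
move=> [mF PF] mA mB AB.
have h C : measurable C -> P C = P (C `&` F).
  move=> mC; rewrite (measureDI P mC mF).
  rewrite [X in (X + _)%E](_ : _ = 0%E) ?add0e //.
  apply/eqP; rewrite -measure_le0 -PF.
  by apply: le_measure; rewrite ?inE; [exact: measurableD|exact: measurableC|move=> x []].
rewrite h // (h B) //; congr (P _).
by apply/seteqP; split => x [Cx Fx]; split => //; apply/(AB x Fx).
Qed.

Lemma full_ae (A : set T) (Q : T -> Prop) : {ae P, forall x, Q x} -> A = [set x | Q x] ->
  measurable A -> full A.
Proof.
move=> h AQ mA; split => //; apply: measure_negligible; first exact: measurableC.
by rewrite AQ.
Qed.

Lemma measure_bigcupT (F : (set T)^nat) : trivIset setT F ->
  (forall n, measurable (F n)) -> P (\bigcup_n F n) = (\sum_(0 <= n <oo) P (F n))%E.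
Proof.
move=> tF mF; have := @measure_bigcup _ _ _ P setT F (fun n _ => mF n) tF.
by move=> ->; apply: eq_eseriesl => n; rewrite in_setT.
Qed.

(** Two maps are allowed because the shifted paths [f] have the law of the paths
    [g]: one extension then yields independence and stationarity together. *)
Lemma independence_extend (T1 : Type) (f g : T -> T1) (G : set (set T1)) E :
  measurable E -> setI_closed G ->
  (forall A, <<s G >> A -> measurable (f @^-1` A)) ->
  (forall A, <<s G >> A -> measurable (g @^-1` A)) ->
  (forall A, G A -> P (f @^-1` A `&` E) = (P (g @^-1` A) * P E)%E) ->
  forall A, <<s G >> A -> P (f @^-1` A `&` E) = (P (g @^-1` A) * P E)%E.
Proof.
move=> mE IG mf mg GE.
pose H := [set A | <<s G >> A /\ P (f @^-1` A `&` E) = (P (g @^-1` A) * P E)%E].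
suff : <<s G >> `<=` H by move=> h A /h[].
have sG : sigma_algebra setT <<s G >> by exact: smallest_sigma_algebra.
apply: lambda_system_subset => //; last first.
  by move=> A GA; split; [exact: sub_sigma_algebra|exact: GE].
apply/dynkin_lambda_system; split.
- split; first exact: (salgT sG).
  by rewrite !preimage_setT setTI probability_setT mul1e.
- move=> A [GA HA]; split; first exact: (salgC sG GA).
  have mfA := mf _ GA; have mgA := mg _ GA.
  have -> : f @^-1` (~` A) `&` E = E `\` f @^-1` A by rewrite setDE setIC.
  have -> : g @^-1` (~` A) = ~` (g @^-1` A) by [].
  have -> : P (E `\` f @^-1` A) = (P E - P (E `&` f @^-1` A))%E.
    apply: measureD => //.
    by rewrite (le_lt_trans (probability_le1 P mE)) // ltry.
  rewrite probability_setC // setIC HA.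
  have [x ->] : exists x : R, P E = x%:E by exists (fine (P E)); rewrite fineK //
    fin_num_measure.
  have [y ->] : exists y : R, P (g @^-1` A) = y%:E.
    by exists (fine (P (g @^-1` A))); rewrite fineK // fin_num_measure.
  by rewrite -EFinM -!EFinB -EFinM mulrBl mul1r.
- move=> F tF HF; split.
    by case: sG => _ _ + ; apply => n; have [] := HF n.
  have -> : P (f @^-1` (\bigcup_k F k) `&` E) = (\sum_(0 <= k <oo) P (f @^-1` F k `&` E))%E.
    rewrite preimage_bigcup setI_bigcupl; apply: measure_bigcupT.
      apply/trivIsetP => i j _ _ ij; rewrite setIACA -preimage_setI.
      by move/trivIsetP : tF => /(_ i j I I ij) ->; rewrite preimage_set0 set0I.
    by move=> n; apply: measurableI => //; apply: mf; have [] := HF n.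
  have -> : P (g @^-1` (\bigcup_k F k)) = (\sum_(0 <= k <oo) P (g @^-1` F k))%E.
    rewrite preimage_bigcup; apply: measure_bigcupT.
      apply/trivIsetP => i j _ _ ij; rewrite -preimage_setI.
      by move/trivIsetP : tF => /(_ i j I I ij) ->; rewrite preimage_set0.
    by move=> n; apply: mg; have [] := HF n.
  have -> : P E = (fine (P E))%:E by rewrite fineK // fin_num_measure.
  rewrite muleC -nneseriesZl //; apply: eq_eseriesr => n _.
  have [_ ->] := HF n; rewrite muleC fineK // fin_num_measure //.
Qed.

End full_events.

(** * Almost sure regularity of Poisson paths *)
Section poisson_paths.
Context {R : realType} {S : countType}.
Variables (P : probability (borel (driving R S)) R) (c : opair S -> R).
Hypotheses (c_ge0 : forall p, 0 <= c p) (P_law : poisson_law P c).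
Implicit Types (K : driving R S) (p q : opair S).

Let mdriv := borel_salg (driving R S).

Lemma measurable_incr p (s t : R) k : 0 <= s -> 0 <= t ->
  measurable (increment_event p s t k).
Proof.
by move=> s0 t0; apply: (measurable_pair (fun a b => b = (a + k)%N) p p s0 t0).
Qed.

Lemma incr_prob p (s t : R) k : 0 <= s -> s <= t ->
  P (increment_event p s t k) = (poisson_weight (c p * (t - s)) k)%:E.
Proof. by move=> s0 st; have [[_ h _] _] := (P_law.1 p, tt); apply: h; rewrite s0. Qed.

Lemma incrs_prob p (u : nat -> R) N (d : nat -> nat) : 0 <= u 0%N ->
  {homo u : i j / (i <= j)%N >-> i <= j} ->
  P [set K | forall i, (i < N)%N -> K p (u i.+1) = (K p (u i) + d i)%N] =
  (\prod_(i < N) poisson_weight (c p * (u i.+1 - u i)) (d i))%:E.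
Proof.
move=> u0 hu; have [[_ _ h] _] := (P_law.1 p, tt).
rewrite -prodEFin; transitivity (P (\bigcap_(i < N) increment_event p (u i) (u i.+1) (d i))).
  by congr (P _); apply/seteqP; split => K /= hK i; exact: hK.
rewrite h //; apply: eq_bigr => i _; apply: incr_prob; last exact: hu.
by rewrite (le_trans u0) // hu.
Qed.

Lemma weight0 (m : R) : 1 - poisson_weight m 0 <= m.
Proof.
rewrite /poisson_weight expr0 mulr1 fact0 divr1.
by have := expR_ge1Dx (- m); lra.
Qed.

Lemma weight01 (m : R) : 0 <= m -> 1 - (poisson_weight m 0 + poisson_weight m 1) <= m ^+ 2.
Proof.
move=> m0; rewrite /poisson_weight expr0 expr1 mulr1 fact0 !divr1.
have := expR_ge1Dx (- m); nra.
Qed.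

(** A union bound over [2 ^ n] grid intervals of quadratically small
    probabilities gives such an estimate. *)
Lemma null_dyadic (C : R) (A : set (borel (driving R S))) : measurable A ->
  (exists n0, forall n, (n0 <= n)%N -> (P A <= (C / (2 ^ n)%:R)%:E)%E) -> P A = 0%E.
Proof.
move=> mA [n0 h]; have PA : P A = (fine (P A))%:E by rewrite fineK // fin_num_measure.
apply/eqP; rewrite -measure_le0 leNgt; apply/negP => PA0.
have x0 : 0 < fine (P A) by rewrite -lte_fin -PA.
have [n1 h1] := dyadic_small C x0.
have := h (maxn n0 n1) (leq_maxl _ _); rewrite PA lee_fin leNgt.
by rewrite h1 // leq_maxr.
Qed.

Lemma union_bound (A : nat -> set (borel (driving R S))) (N : nat) (e : R) :
  (forall i, measurable (A i)) -> (forall i, (P (A i) <= e%:E)%E) ->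
  (P (~` [set K | forall i, (i < N)%N -> ~ A i K]) <= (N%:R * e)%:E)%E.
Proof.
move=> mA PA.
have mN M : measurable (~` [set K | forall i, (i < M)%N -> ~ A i K]).
  apply: measurableC; apply: (salg_all mdriv) => i; apply: (salg_imply mdriv) => _.
  exact: measurableC.
elim: N => [|N ih].
  have -> : ~` [set K | forall i, (i < 0)%N -> ~ A i K] = set0.
    by apply/seteqP; split => // K /=; apply; case.
  by rewrite measure0 mul0r.
have sub : ~` [set K | forall i, (i < N.+1)%N -> ~ A i K] `<=`
    ~` [set K | forall i, (i < N)%N -> ~ A i K] `|` A N.
  move=> K /= /existsNP[i /not_implyP[iN /contrapT AK]].
  move: iN; rewrite ltnS leq_eqVlt => /predU1P[iN|iN]; [right|left].
    by rewrite -iN.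
  by move=> h; apply: h iN _.
apply: (@le_trans _ _ (P (~` [set K | forall i, (i < N)%N -> ~ A i K] `|` A N))).
  by apply: le_measure; rewrite ?inE //; exact: measurableU.
apply: (@le_trans _ _ (P (~` [set K | forall i, (i < N)%N -> ~ A i K]) + P (A N))%E).
  exact: measureU2.
by rewrite -addn1 natrD mulrDl mul1r EFinD; exact: leeD.
Qed.

Lemma grid_pos (h : R) i : 0 <= h -> 0 <= i%:R * h /\ i%:R * h <= i.+1%:R * h.
Proof. by move=> h0; rewrite mulr_ge0 // ler_wpM2r // ler_nat. Qed.

Lemma incr_grid p (h : R) i k : 0 <= h ->
  P (increment_event p (i%:R * h) (i.+1%:R * h) k) = (poisson_weight (c p * h) k)%:E.
Proof.
move=> h0; have [g0 g1] := grid_pos i h0; rewrite incr_prob //.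
by rewrite -addn1 natrD mulrDl mul1r addrAC subrr add0r.
Qed.

Lemma full_often_unit p : full P [set K | often_unit (K p)].
Proof.
apply: full_all => T; apply: full_all => n0.
pose E n := [set K : driving R S | (n0 <= n)%N /\ unit_incr (T%:R / (2 ^ n)%:R) (2 ^ n) (K p)].
have h0 n : 0 <= T%:R / (2 ^ n)%:R :> R by rewrite divr_ge0.
have mE n : measurable (E n : set (borel (driving R S))).
  by apply: (salg_and mdriv) => _; exact: measurable_unit_incr.
have mA : measurable ([set K | exists n, E n K] : set (borel (driving R S))).
  exact: (salg_ex mdriv).
split => //; apply: (@null_dyadic ((c p * T%:R) ^+ 2)); first exact: measurableC.
exists n0 => n nn0; set h : R := T%:R / (2 ^ n)%:R.
(* A Poisson variable of mean [m] exceeds 1 with probability at most [m ^+ 2]. *)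
pose A i : set (borel (driving R S)) := ~` (increment_event p (i%:R * h) (i.+1%:R * h) 0 `|`
  increment_event p (i%:R * h) (i.+1%:R * h) 1).
have mI i k : measurable (increment_event p (i%:R * h) (i.+1%:R * h) k).
  have [g0 g1] := grid_pos i (h0 n : 0 <= h).
  by apply: measurable_incr => //; exact: le_trans g1.
have mAi i : measurable (A i) by apply: measurableC; exact: measurableU.
have PA i : (P (A i) <= ((c p * h) ^+ 2)%:E)%E.
  have -> : P (A i) = (1 - (P (increment_event p (i%:R * h) (i.+1%:R * h) 0) +
      P (increment_event p (i%:R * h) (i.+1%:R * h) 1)))%E.
    rewrite probability_setC; last exact: measurableU.
    congr (_ - _)%E; apply: measureU => //.
    apply/seteqP; split => // K []; rewrite /increment_event /= => ->.
    rewrite addn0 addn1 => /eqP.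
    by rewrite eqn_leq [X in _ && X]ltnn andbF.
  rewrite !incr_grid //; try exact: h0.
  have : ((1 - (poisson_weight (c p * h) 0 + poisson_weight (c p * h) 1))%:E <=
      ((c p * h) ^+ 2)%:E)%E.
    by rewrite lee_fin weight01 // mulr_ge0 // h0.
  by [].
have := union_bound (2 ^ n) mAi PA.
have -> : (2 ^ n)%:R * (c p * h) ^+ 2 = (c p * T%:R) ^+ 2 / (2 ^ n)%:R.
  rewrite /h; have : (2 ^ n)%:R != 0 :> R by rewrite pnatr_eq0 -lt0n expn_gt0.
  by move: (2 ^ n)%:R => x x0; field.
apply: le_trans; apply: le_measure; rewrite ?inE.
- exact: measurableC.
- apply: measurableC; apply: (salg_all mdriv) => i; apply: (salg_imply mdriv) => _.
  exact: measurableC.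
- apply: subsetC => K /= hK; exists n; split => // i iN.
  have /contrapT := hK i iN; rewrite /increment_event /= addn0 addn1.
  by rewrite /h => -[|] ->; [left|right].
Qed.

Lemma full_apart p q : p != q -> full P [set K | sometimes_apart (K p) (K q)].
Proof.
move=> pq; apply: full_all => T.
have h0 n : 0 <= T%:R / (2 ^ n)%:R :> R by rewrite divr_ge0.
have mE n : measurable ([set K | no_common_incr (T%:R / (2 ^ n)%:R) (2 ^ n) (K p) (K q)]
    : set (borel (driving R S))) by exact: measurable_no_common.
have mA : measurable ([set K | exists n, no_common_incr (T%:R / (2 ^ n)%:R) (2 ^ n) (K p) (K q)]
    : set (borel (driving R S))) by exact: (salg_ex mdriv).
split => //; apply: (@null_dyadic (c p * c q * T%:R ^+ 2)); first exact: measurableC.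
exists 0%N => n _; set h : R := T%:R / (2 ^ n)%:R.
have hh0 : 0 <= h by exact: h0.
pose B i := [set w : borel (cadlag R nat) | w (i%:R * h) <> w (i.+1%:R * h)].
have mB i : measurable (B i).
  have [g0 g1] := grid_pos i hh0; have g2 := le_trans g0 g1.
  have sG := borel_salg (cadlag R nat).
  have mc (u : R) : 0 <= u -> cmeas (measurable : set (set (borel (cadlag R nat))))
      (fun w : cadlag R nat => w u).
    by move=> u0 k; exact: measurable_nat_coord.
  exact: (cmeas_pred sG (fun ab => ab.1 <> ab.2) (cmeas_pair sG (mc _ g0) (mc _ g2))).
pose A i : set (borel (driving R S)) := [set K | forall r, r \in [:: p; q] -> B i (K r)].
have mAi i : measurable (A i).
  by apply: (salg_all_seq mdriv) => r _; exact: (measurable_proj r (mB i)).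
have PB i r : (P [set K | B i (K r)] <= (c r * h)%:E)%E.
  have -> : [set K | B i (K r)] = ~` increment_event r (i%:R * h) (i.+1%:R * h) 0.
    by apply/seteqP; split => K; rewrite /B /increment_event /= addn0 => e /esym.
  have [g0 g1] := grid_pos i hh0.
  rewrite probability_setC; last by apply: measurable_incr => //; exact: le_trans g1.
  rewrite incr_grid //.
  have : ((1 - poisson_weight (c r * h) 0)%:E <= (c r * h)%:E)%E.
    by rewrite lee_fin weight0.
  by [].
have PA i : (P (A i) <= (c p * h * (c q * h))%:E)%E.
  rewrite (P_law.2 [:: p; q] (fun _ => B i)) ?big_cons ?big_nil ?mule1 /=.
  - by rewrite EFinM; apply: lee_pmul.
  - by rewrite inE pq.
  - by move=> r; exact: mB.
have := union_bound (2 ^ n) mAi PA.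
have -> : (2 ^ n)%:R * (c p * h * (c q * h)) = c p * c q * T%:R ^+ 2 / (2 ^ n)%:R.
  rewrite /h; have : (2 ^ n)%:R != 0 :> R by rewrite pnatr_eq0 -lt0n expn_gt0.
  by move: (2 ^ n)%:R => x x0; field.
apply: le_trans; apply: le_measure; rewrite ?inE.
- exact: measurableC.
- apply: measurableC; apply: (salg_all mdriv) => i; apply: (salg_imply mdriv) => _.
  exact: measurableC.
- apply: subsetC => K /= hK; exists n => i iN; apply: contrapT => nh.
  apply: (hK i iN) => r; rewrite !inE => /orP[] /eqP -> e; apply: nh; [left|right];
  exact: e.
Qed.

Definition tame K := forall p, K p 0 = 0%N /\ often_unit (K p).

Lemma full_tame : full P tame.
Proof.
apply: full_all => p; apply: fullI; last exact: full_often_unit.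
apply: full1; first exact: measurable_coord.
by have [] := P_law.1 p.
Qed.

End poisson_paths.

(** * Values along dyadic grids *)
Section path_values.
Context {R : realType}.
Implicit Types (w : cadlag R nat) (u v : nat -> R) (a b : nat -> nat).

Definition values u N a : set (cadlag R nat) :=
  [set w | forall i, (i <= N)%N -> w (u i) = a i].

Definition admissible N a := a 0%N = 0%N /\ forall i, (i < N)%N -> (a i <= a i.+1)%N.

Definition mono_path w := forall s t : R, 0 <= s -> s <= t -> (w s <= w t)%N.

Lemma values_incr w u N a : w 0 = 0%N -> u 0%N = 0 -> admissible N a ->
  values u N a w <-> forall i, (i < N)%N -> w (u i.+1) = (w (u i) + (a i.+1 - a i))%N.
Proof.
move=> w0 u0 [a0 am]; split => [h i iN|h i].
  by rewrite !h ?(ltnW iN) // subnKC // am.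
elim: i => [|i ih] iN; first by rewrite u0 w0 a0.
by rewrite h // ih ?(ltnW iN) // subnKC // am.
Qed.

Lemma values_admissible w u N a : w 0 = 0%N -> mono_path w -> u 0%N = 0 ->
  {homo u : i j / (i <= j)%N >-> i <= j} -> values u N a w -> admissible N a.
Proof.
move=> w0 mw u0 hu h; split => [|i iN]; first by rewrite -h // u0.
by rewrite -!h ?(ltnW iN) //; apply: mw; rewrite ?hu // -u0 hu.
Qed.

Lemma shift_zero (t : {nonneg R}) w : shift_path t w 0 = 0%N.
Proof. by rewrite shift_pathE // addr0 subnn. Qed.

Lemma shift_mono (t : {nonneg R}) w : mono_path w -> mono_path (shift_path t w).
Proof.
move=> mw s s' s0 ss; rewrite !shift_pathE ?(le_trans s0) //.
by apply: leq_sub2r; apply: mw; rewrite ?lerD2l // addr_ge0.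
Qed.

Lemma shift_incr (t : {nonneg R}) w (x y : R) k : mono_path w -> 0 <= x -> 0 <= y ->
  shift_path t w y = (shift_path t w x + k)%N <->
  w (t%:num + y) = (w (t%:num + x)%R + k)%N.
Proof.
move=> mw x0 y0; rewrite !shift_pathE //.
have h z : 0 <= z -> (w t%:num <= w (t%:num + z)%R)%N by move=> z0; apply: mw; rewrite ?lerDl.
have hx := h x x0; have hy := h y y0.
split => [e|->]; last by rewrite addnBAC.
by rewrite -(subnKC hy) e addnA subnKC.
Qed.

Definition dyadic (T : R) (n i : nat) : R := i%:R * (T / (2 ^ n)%:R).

Lemma dyadic0 T n : dyadic T n 0 = 0. Proof. by rewrite /dyadic mul0r. Qed.

Lemma dyadic_homo T n : 0 <= T -> {homo dyadic T n : i j / (i <= j)%N >-> i <= j}.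
Proof. by move=> T0 i j ij; rewrite /dyadic ler_wpM2r ?divr_ge0 // ler_nat. Qed.

Lemma dyadic_ge0 T n i : 0 <= T -> 0 <= dyadic T n i.
Proof. by move=> T0; rewrite mulr_ge0 // divr_ge0. Qed.

Lemma dyadic_last T n : dyadic T n (2 ^ n) = T.
Proof. by rewrite /dyadic mulrC divfK // pnatr_eq0 -lt0n expn_gt0. Qed.

Lemma dyadic_refine T n m i : (n <= m)%N -> dyadic T n i = dyadic T m (i * 2 ^ (m - n)).
Proof.
move=> nm; rewrite /dyadic natrM -{2}(subnK nm) expnD natrM.
have h k : (2 ^ k)%:R != 0 :> R by rewrite pnatr_eq0 -lt0n expn_gt0.
by move: (h n) (h (m - n)%N); move: (2 ^ n)%:R (2 ^ (m - n))%:R => x y x0 y0; field; apply/andP.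
Qed.

(** Prescribing all the values along a dyadic grid makes this class stable under
    intersection: a finer prescription is compatible with a coarser one or
    contradicts it. *)
Definition atoms (T : R) : set (set (cadlag R nat)) :=
  [set A | A = set0 \/ exists n (a : seq nat), A = values (dyadic T n) (2 ^ n) (nth 0%N a)].

Lemma atoms_setI T : setI_closed (atoms T).
Proof.
have h n m (a b : seq nat) : (n <= m)%N ->
    atoms T (values (dyadic T n) (2 ^ n) (nth 0%N a) `&`
      values (dyadic T m) (2 ^ m) (nth 0%N b)).
  move=> nm; have [[w [wa wb]]|ne] := pselect (exists w,
    (values (dyadic T n) (2 ^ n) (nth 0%N a) `&` values (dyadic T m) (2 ^ m) (nth 0%N b)) w).
    right; exists m, b; apply/seteqP; split => [w' []//|w' wb']; split => // i iN.
    have jM : (i * 2 ^ (m - n) <= 2 ^ m)%N by rewrite -(subnKC nm) expnD addKn leq_mul2r iN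
      orbT.
    by rewrite -wa // (dyadic_refine T i nm) wb // wb'.
  by left; apply/seteqP; split => // w hw; apply: ne; exists w.
move=> A B [->|[n [a ->]]] [->|[m [b ->]]]; try by left; rewrite ?set0I ?setI0.
have [nm|/ltnW mn] := leqP n m; first exact: h.
by rewrite setIC; exact: h.
Qed.

Definition path_past (T : R) : set (set (cadlag R nat)) :=
  <<s [set A | exists (s : R) (k : nat), 0 <= s <= T /\ A =
    [set w : cadlag R nat | w s = k]] >>.

Lemma path_past_salg T : sigma_algebra setT (path_past T).
Proof. exact: smallest_sigma_algebra. Qed.

Lemma path_past_measurable T (A : set (borel (cadlag R nat))) : path_past T A -> measurable A.
Proof.
move: A; apply: smallest_sub; first exact: borel_salg.
by move=> _ [s [k [/andP[s0 _] ->]]]; exact: measurable_nat_coord.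
Qed.

(** The value at time [s] is the limit of the values at grid points decreasing
    to [s], and [T] itself is a grid point. *)
Lemma path_past_atoms T : 0 <= T -> path_past T `<=` <<s atoms T >>.
Proof.
move=> T0; have sG : sigma_algebra setT <<s atoms T >> by exact: smallest_sigma_algebra.
apply: smallest_sub => //.
move=> _ [s [k [/andP[s0 sT] ->]]].
have /choice[j hj] : forall n, exists i, (i <= 2 ^ n)%N /\
    s <= dyadic T n i /\ dyadic T n i <= s + T / (2 ^ n)%:R.
  move=> n; move: s0; rewrite le_eqVlt => /predU1P[<-|s_gt0].
    by exists 0%N; rewrite dyadic0 add0r divr_ge0.
  have [i iN [h1 h2]] := grid_cell n s_gt0 sT; exists i.+1; split => //.
  by split => //; rewrite /dyadic -addn1 natrD mulrDl mul1r lerD2r ltW.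
have -> : [set w : cadlag R nat | w s = k] = [set w : cadlag R nat |
    exists n0, forall n, (n0 <= n)%N -> w (dyadic T n (j n)) = k].
  apply/seteqP; split => w /=; have [d [a [d0 [h _]]]] := stepfun_nat w s0;
  have [n1 hn1] := dyadic_small T d0.
    move=> wk; exists n1 => n nn; have [_ [j1 j2]] := hj n.
    by rewrite h // (le_lt_trans j2) // ltrD2l hn1.
  move=> [n0 hn0]; have [_ [j1 j2]] := hj (maxn n0 n1).
  rewrite -(h (dyadic T (maxn n0 n1) (j (maxn n0 n1)))) ?hn0 ?leq_maxl //.
  by rewrite (le_lt_trans j2) // ltrD2l hn1 // leq_maxr.
suff at_grid n i : (i <= 2 ^ n)%N ->
  <<s atoms T >> [set w : cadlag R nat | w (dyadic T n i) = k].
  apply: (salg_ex sG) => n0; apply: (salg_all sG) => n; apply: (salg_imply sG) => _.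
  by apply: at_grid; have [] := hj n.
move=> iN; have -> : [set w : cadlag R nat | w (dyadic T n i) = k] = [set w : cadlag R nat |
    exists a : seq nat, nth 0%N a i = k /\ values (dyadic T n) (2 ^ n) (nth 0%N a) w].
  apply/seteqP; split => w /=; last by move=> [a [<- ->]].
  move=> wk; exists (mkseq (fun i => w (dyadic T n i)) (2 ^ n).+1).
  split; first by rewrite nth_mkseq.
  by move=> l lN; rewrite nth_mkseq.
apply: (salg_ex sG) => a; apply: (salg_and sG) => _; apply: sub_sigma_algebra.
by right; exists n, a.
Qed.

Lemma atoms_past T : 0 <= T -> <<s atoms T >> `<=` path_past T.
Proof.
move=> T0; have sG := path_past_salg T; apply: smallest_sub => //.
move=> _ [->|[n [a ->]]]; first exact: salg0.
apply: (salg_all sG) => i; apply: (salg_imply sG) => iN.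
apply: sub_sigma_algebra; exists (dyadic T n i), (nth 0%N a i); split => //.
by rewrite dyadic_ge0 //= -[leRHS](dyadic_last T n) dyadic_homo.
Qed.

Lemma measurable_shift_path (t : {nonneg R}) T (A : set (borel (cadlag R nat))) :
  path_past T A ->
  measurable ([set w | A (shift_path t w)] : set (borel (cadlag R nat))).
Proof.
suff : path_past T `<=` [set A | measurable ([set w | A (shift_path t w)] :
  set (borel (cadlag R nat)))].
  by apply.
have sG := borel_salg (cadlag R nat).
apply: smallest_sub; first exact: (preimage_salg (shift_path t) sG).
move=> _ [s [k [/andP[s0 _] ->]]].
have mc (x : R) : 0 <= x -> cmeas (measurable : set (set (borel (cadlag R nat))))
    (fun w : cadlag R nat => w x).
  by move=> x0 m; exact: measurable_nat_coord.
have ts : 0 <= t%:num + s by rewrite addr_ge0.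
suff : measurable [set w : borel (cadlag R nat) | shift_path t w s = k] by [].
have -> : [set w : borel (cadlag R nat) | shift_path t w s = k] =
    [set w : borel (cadlag R nat) | (w (t%:num + s)%R - w t%:num)%N = k].
  by apply/funext => w; rewrite /mkset shift_pathE.
exact: (cmeas_pred sG (fun ab => (ab.1 - ab.2)%N = k)
  (cmeas_pair sG (mc _ ts) (mc _ (ge0 t)))).
Qed.

End path_values.

(** * Independence and stationarity of increments *)
Section independent_increments.
Context {R : realType} {S : countType}.
Variables (P : probability (borel (driving R S)) R) (c : opair S -> R).
Hypotheses (c_ge0 : forall p, 0 <= c p) (P_law : poisson_law P c).
Implicit Types (K : driving R S) (p q : opair S) (u v : nat -> R) (a b : nat -> nat).

Let mdriv := borel_salg (driving R S).

Lemma tame_mono K p : tame K -> mono_path (K p).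
Proof. by move=> tK s t; apply: often_unit_mono; have [] := tK p. Qed.

Lemma measurable_values u N a : (forall i, 0 <= u i) ->
  measurable (values u N a : set (borel (cadlag R nat))).
Proof.
move=> u0; have sG := borel_salg (cadlag R nat).
apply: (salg_all sG) => i; apply: (salg_imply sG) => _.
exact: measurable_nat_coord.
Qed.

Definition increments p u N (d : nat -> nat) : set (borel (driving R S)) :=
  [set K | forall i, (i < N)%N -> K p (u i.+1) = (K p (u i) + d i)%N].

Lemma measurable_incrs p u N d : (forall i, 0 <= u i) -> measurable (increments p u N d).
Proof.
move=> u0; apply: (salg_all mdriv) => i; apply: (salg_imply mdriv) => _.
exact: (measurable_pair (fun x y => x = (y + d i)%N)).
Qed.

Lemma homo_ge0 u i : u 0%N = 0 -> {homo u : i j / (i <= j)%N >-> i <= j} -> 0 <= u i.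
Proof. by move=> u0 hu; rewrite -u0 hu. Qed.

Section one_coordinate.
Variables (p : opair S) (t : {nonneg R}).

Let past_event u N a : set (borel (driving R S)) := [set K | values u N a (K p)].
Let future_event v M b : set (borel (driving R S)) :=
  [set K | values v M b (shift_path t (K p))].

(** The subdivision [u] of [[0, t]] followed by [t + v]. *)
Definition join_times u N v (i : nat) : R := if (i < N)%N then u i else t%:num + v (i - N)%N.

(** For a path that is nondecreasing and starts at 0, prescribing values is the
    same as prescribing increments, and the product formula for the joined
    subdivision factors at time [t].  Inadmissible values have probability 0. *)
Lemma joint_values_prob u N a v M b :
  u 0%N = 0 -> {homo u : i j / (i <= j)%N >-> i <= j} -> u N = t%:num ->
  v 0%N = 0 -> {homo v : i j / (i <= j)%N >-> i <= j} ->
  P (past_event u N a `&` future_event v M b) =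
  (P (past_event u N a) * P [set K | values v M b (K p)])%E /\
  P (future_event v M b) = P [set K | values v M b (K p)].
Proof.
move=> u0 hu uN v0 hv.
have up i : 0 <= u i := homo_ge0 i u0 hu.
have vp i : 0 <= v i := homo_ge0 i v0 hv.
have fT := full_tame c_ge0 P_law.
have mP : measurable (past_event u N a).
  by apply: (measurable_proj p (B := values u N a)); exact: measurable_values.
have mF : measurable (future_event v M b).
  apply: (measurable_proj p (B := [set w | values v M b (shift_path t w)])).
  apply: (measurable_shift_path t (T := v M)).
  apply: (salg_all (path_past_salg _)) => i; apply: (salg_imply (path_past_salg _)) => iM.
  apply: sub_sigma_algebra; exists (v i), (b i); split => //.
  by rewrite vp hv.
have mF0 : measurable ([set K | values v M b (K p)] : set (borel (driving R S))).
  by apply: (measurable_proj p (B := values v M b)); exact: measurable_values.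
pose da i := (a i.+1 - a i)%N; pose db i := (b i.+1 - b i)%N.
pose w' i := join_times u N v i.
have w'L i : (i <= N)%N -> w' i = u i.
  rewrite /w' /join_times leq_eqVlt => /predU1P[->|->//].
  by rewrite ltnn subnn v0 addr0.
have w'R j : w' (N + j)%N = t%:num + v j.
  by rewrite /w' /join_times ltnNge leq_addr /= addKn.
have hw' : {homo w' : i j / (i <= j)%N >-> i <= j}.
  move=> i j ij; have [jN|Nj] := leqP j N.
    by rewrite !w'L // ?hu // (leq_trans ij).
  rewrite -(subnKC (ltnW Nj)) w'R; have [iN|Ni] := leqP i N.
    by rewrite w'L // -uN ler_wpDr // hu.
  by rewrite -(subnKC (ltnW Ni)) w'R lerD2l hv // leq_sub2r.
pose d i := if (i < N)%N then da i else db (i - N)%N.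
have pU : admissible N a -> P (past_event u N a) =
    (\prod_(i < N) poisson_weight (c p * (u i.+1 - u i)) (da i))%:E.
  move=> ga; rewrite -(incrs_prob P_law) ?u0 //.
  apply: (full_eq fT) => //; first exact: measurable_incrs.
  by move=> K tK; apply: values_incr => //; have [] := tK p.
have pV : admissible M b -> P [set K | values v M b (K p)] =
    (\prod_(i < M) poisson_weight (c p * (v i.+1 - v i)) (db i))%:E.
  move=> gb; rewrite -(incrs_prob P_law) ?v0 //.
  apply: (full_eq fT) => //; first exact: measurable_incrs.
  by move=> K tK; apply: values_incr => //; have [] := tK p.
have futE K : tame K -> admissible M b -> future_event v M b K <->
    forall i, (i < M)%N -> K p (t%:num + v i.+1) = (K p (t%:num + v i)%R + db i)%N.
  move=> tK gb; rewrite /future_event /= (values_incr (shift_zero t (K p)) v0 gb).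
  by split => h i iM; apply/(shift_incr t _ (tame_mono p tK) (vp i) (vp i.+1)); exact: h.
have pF : admissible M b -> P (future_event v M b) =
    (\prod_(i < M) poisson_weight (c p * (v i.+1 - v i)) (db i))%:E.
  move=> gb; have tv0 : 0 <= t%:num + v 0%N by rewrite v0 addr0.
  have htv : {homo (fun i => t%:num + v i) : i j / (i <= j)%N >-> i <= j}.
    by move=> i j ij; rewrite lerD2l hv.
  have := incrs_prob P_law p M db tv0 htv.
  rewrite (eq_bigr (fun i : 'I_M => poisson_weight (c p * (v i.+1 - v i)) (db i))); last first.
    by move=> i _; rewrite opprD addrACA subrr add0r.
  move=> <-; apply: (full_eq fT) => //; last by move=> K tK; exact: futE.
  by apply: (measurable_incrs p (u := fun i => t%:num + v i)) => i; rewrite addr_ge0.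
have nullP : ~ admissible N a -> P (past_event u N a) = 0%E.
  move=> na; rewrite -(measure0 P); apply: (full_eq fT) => // K tK; split => // h.
  by apply: na; apply: values_admissible h => //; [have [] := tK p|exact: tame_mono].
have nullV : ~ admissible M b -> P [set K | values v M b (K p)] = 0%E.
  move=> nb; rewrite -(measure0 P); apply: (full_eq fT) => // K tK; split => // h.
  by apply: nb; apply: values_admissible h => //; [have [] := tK p|exact: tame_mono].
have nullF : ~ admissible M b -> P (future_event v M b) = 0%E.
  move=> nb; rewrite -(measure0 P); apply: (full_eq fT) => // K tK; split => // h.
  apply: nb; apply: values_admissible h => //; first exact: shift_zero.
  exact/shift_mono/tame_mono.
split; last first.
  have [gb|nb] := pselect (admissible M b); first by rewrite pF // pV.
  by rewrite nullF // nullV.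
have [gb|nb] := pselect (admissible M b); last first.
  rewrite nullV // mule0; apply/eqP; rewrite -measure_le0 -(nullF nb).
  by apply: le_measure; rewrite ?inE //; exact: measurableI.
have [ga|na] := pselect (admissible N a); last first.
  rewrite nullP // mul0e; apply/eqP; rewrite -measure_le0 -(nullP na).
  by apply: le_measure; rewrite ?inE //; exact: measurableI.
rewrite pU // pV // -EFinM.
have w'0 : 0 <= w' 0%N by rewrite w'L // u0.
have wp i : 0 <= w' i by rewrite (le_trans w'0) // hw'.
have := incrs_prob P_law p (N + M) d w'0 hw'.
have -> : \prod_(i < N + M) poisson_weight (c p * (w' i.+1 - w' i)) (d i) =
    (\prod_(i < N) poisson_weight (c p * (u i.+1 - u i)) (da i)) *
    (\prod_(i < M) poisson_weight (c p * (v i.+1 - v i)) (db i)).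
  rewrite big_split_ord /=; congr (_ * _); apply: eq_bigr => i _.
    by rewrite !w'L ?(ltnW (ltn_ord i)) // /d ltn_ord.
  rewrite -addnS !w'R opprD addrACA subrr add0r /d ltnNge leq_addr /=.
  by rewrite addKn.
move=> <-; apply: (full_eq fT).
- exact: measurableI.
- exact: (measurable_incrs p (u := w')).
move=> K tK; have K0 : K p 0 = 0%N by have [] := tK p.
split=> [[/(values_incr K0 u0 ga) hP /(futE K tK gb) hF] i iNM|h].
  have [iN|Ni] := ltnP i N; first by rewrite !w'L ?(ltnW iN) // /d iN hP.
  rewrite -(subnKC Ni) -addnS !w'R hF ?ltn_subLR // /d ltnNge leq_addr /=.
  by rewrite addKn.
split.
  apply/(values_incr K0 u0 ga) => i iN.
  have := h i (ltn_addr _ iN); by rewrite !w'L ?(ltnW iN) // /d iN.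
apply/(futE K tK gb) => i iM; have := h (N + i)%N; rewrite ltn_add2l => /(_ iM).
by rewrite -addnS !w'R /d ltnNge leq_addr /= addKn.
Qed.

(** Extend from atoms first in the past event, then in the future one. *)
Lemma path_independence T A E : path_past t%:num A -> 0 <= T -> path_past T E ->
  P [set K | A (K p) /\ E (shift_path t (K p))] =
  (P [set K | A (K p)] * P [set K | E (K p)])%E /\
  P [set K | E (shift_path t (K p))] = P [set K | E (K p)].
Proof.
move=> hA T0 hE.
have mpast A' : path_past t%:num A' ->
  measurable ([set K | A' (K p)] : set (borel (driving R S))).
  by move=> h; apply: (measurable_proj p); exact: path_past_measurable h.
have mfut E' : path_past T E' -> measurable ([set K | E' (K p)] : set (borel (driving R S))).
  by move=> h; apply: (measurable_proj p); exact: path_past_measurable h.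
have mshift E' : path_past T E' ->
    measurable ([set K | E' (shift_path t (K p))] : set (borel (driving R S))).
  move=> h; apply: (measurable_proj p (B := [set w | E' (shift_path t w)])).
  exact: measurable_shift_path h.
have tp : 0 <= t%:num by [].
have atomF E' : atoms T E' -> path_past T E'.
  by move=> h; apply: (atoms_past T0); exact: sub_sigma_algebra.
have step1 A' E' : path_past t%:num A' -> atoms T E' ->
    P [set K | A' (K p) /\ E' (shift_path t (K p))] =
    (P [set K | A' (K p)] * P [set K | E' (shift_path t (K p))])%E.
  move=> hA' aE; have mE := mshift _ (atomF _ aE).
  apply: (@independence_extend _ (borel (driving R S)) R P (cadlag R nat) (fun K =>
    K p) (fun K => K p)
    (atoms t%:num) [set K | E' (shift_path t (K p))] mE).
  - exact: atoms_setI.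
  - by move=> B hB; apply: mpast; exact: atoms_past.
  - by move=> B hB; apply: mpast; exact: atoms_past.
  - move=> B [->|[n [a ->]]].
      have -> : (fun K : borel (driving R S) => K p) @^-1` set0 = set0 by apply/seteqP; split.
      by rewrite set0I measure0 mul0e.
    case: aE => [->|[m [b ->]]].
      have -> : [set K : borel (driving R S) | (set0 :
        set (cadlag R nat)) (shift_path t (K p))] = set0
        by apply/seteqP; split.
      by rewrite setI0 measure0 mule0.
    have [h1 h2] := @joint_values_prob _ (2 ^ n) (nth 0%N a) _ (2 ^ m) (nth 0%N b)
      (dyadic0 t%:num n) (dyadic_homo n tp) (dyadic_last t%:num n) (dyadic0 T m)
        (dyadic_homo m T0).
    by move: h1; rewrite -h2.
  - exact: path_past_atoms.
have stat E' : atoms T E' -> P [set K | E' (shift_path t (K p))] = P [set K | E' (K p)].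
  move=> [->|[m [b ->]]] //.
  by have [] := @joint_values_prob _ (2 ^ 0) (nth 0%N [::]) _ (2 ^ m) (nth 0%N b)
      (dyadic0 t%:num 0) (dyadic_homo 0 tp) (dyadic_last t%:num 0) (dyadic0 T m)
        (dyadic_homo m T0).
have step2 A' E' : path_past t%:num A' -> path_past T E' ->
    P ([set K | E' (shift_path t (K p))] `&` [set K | A' (K p)]) =
    (P [set K | E' (K p)] * P [set K | A' (K p)])%E.
  move=> hA' hE'; have mA := mpast _ hA'.
  apply: (@independence_extend _ (borel (driving R S)) R P (cadlag R nat)
    (fun K => shift_path t (K p)) (fun K => K p) (atoms T) [set K | A' (K p)] mA).
  - exact: atoms_setI.
  - by move=> B hB; apply: mshift; exact: atoms_past.
  - by move=> B hB; apply: mfut; exact: atoms_past.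
  - by move=> B aB; rewrite setIC; have := step1 A' B hA' aB; rewrite stat // muleC.
  - exact: path_past_atoms.
split; first by rewrite muleC -step2 // setIC.
have := step2 setT E (salgT (path_past_salg _)) hE.
have -> : [set K : borel (driving R S) | (setT : set (cadlag R nat)) (K p)] = setT
  by apply/seteqP; split.
by rewrite setIT probability_setT mule1.
Qed.

End one_coordinate.

Definition rect (t : R) : set (set (driving R S)) :=
  [set X | exists (B : opair S -> set (cadlag R nat)) (s : seq (opair S)),
     [/\ uniq s, forall p, path_past t (B p) & X = [set K | forall p, p \in s -> B p (K p)]]].

(** Used to describe two rectangles by one list of coordinates. *)
Definition widen (s : seq (opair S)) (B : opair S -> set (cadlag R nat)) p :=
  if p \in s then B p else setT.

Lemma widen_past t s B : (forall p, path_past t (B p)) -> forall p, path_past t (widen s B p).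
Proof. by move=> hB p; rewrite /widen; case: ifP => // _;
  exact: (salgT (path_past_salg t)). Qed.

Lemma widenE (s s' : seq (opair S)) B : {subset s <= s'} ->
  [set K : driving R S | forall p, p \in s -> B p (K p)] =
  [set K : driving R S | forall p, p \in s' -> widen s B p (K p)].
Proof.
move=> ss; apply/seteqP; split => K /= h p ps; rewrite ?/widen; last first.
  by have := h p (ss p ps); rewrite /widen ps.
by case: ifP => // /h.
Qed.

Lemma rect_setI t : setI_closed (rect t).
Proof.
move=> _ _ [B [s [us hB ->]]] [B' [s' [us' hB' ->]]].
exists (fun p => widen s B p `&` widen s' B' p), (undup (s ++ s')); split.
- exact: undup_uniq.
- by move=> p; apply: (salgI (path_past_salg t)); exact: widen_past.
rewrite (@widenE s (undup (s ++ s'))); last by move=> p ps; rewrite mem_undup mem_cat ps.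
rewrite (@widenE s' (undup (s ++ s'))); last by move=> p ps; rewrite mem_undup mem_cat ps orbT.
apply/seteqP; split => K /=; first by move=> [h1 h2] p ps; split; [exact: h1|exact: h2].
by move=> h; split => p /h[].
Qed.

Lemma past_rect t : past t `<=` <<s rect t >>.
Proof.
apply: smallest_sub; first exact: smallest_sigma_algebra.
move=> _ [p [s [k [/andP[s0 st] ->]]]]; apply: sub_sigma_algebra.
exists (fun _ => [set w | w s = k]), [:: p]; split => //.
  by move=> _; apply: sub_sigma_algebra; exists s, k; rewrite s0.
apply/seteqP; split => K /=; first by move=> e q; rewrite inE => /eqP ->.
by apply; rewrite inE.
Qed.

Lemma rect_past t : <<s rect t >> `<=` past t.
Proof.
apply: smallest_sub; first exact: past_salg.
move=> _ [B [s [us hB ->]]]; apply: (salg_all_seq (past_salg t)) => p _.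
suff : path_past t `<=` [set A | past t [set K | A (K p)]] by apply.
apply: smallest_sub.
  exact: (preimage_salg (fun K : driving R S => K p) (past_salg t)).
move=> _ [u [k [/andP[u0 ut] ->]]]; exact: past_coord.
Qed.

Lemma measurable_shift (t : {nonneg R}) T (E : set (driving R S)) : past T E ->
  measurable ([set K | E (shift_driving t K)] : set (borel (driving R S))).
Proof.
suff : past T `<=` [set A : set (driving R S) |
  measurable ([set K | A (shift_driving t K)] : set (borel (driving R S)))] by apply.
apply: smallest_sub.
  exact: (preimage_salg (@shift_driving R S t) mdriv).
move=> _ [p [s [k [s0T ->]]]].
apply: (measurable_proj p (B := [set w | [set w' : cadlag R nat | w' s = k] (shift_path t w)])).
by apply: (measurable_shift_path t (T := T)); apply: sub_sigma_algebra; exists s, k.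
Qed.

Lemma prob_rect (B : opair S -> set (borel (cadlag R nat))) (s : seq (opair S)) :
  uniq s -> (forall p, measurable (B p)) ->
  P [set K | forall p, p \in s -> B p (K p)] = (\prod_(p <- s) P [set K | B p (K p)])%E.
Proof. exact: P_law.2. Qed.

Lemma rect_independence (t : {nonneg R}) T X Y : 0 <= T -> rect t%:num X -> rect T Y ->
  P (X `&` [set K | Y (shift_driving t K)]) = (P X * P Y)%E /\
  P [set K | Y (shift_driving t K)] = P Y.
Proof.
move=> T0 [B [s [us hB ->]]] [B' [s' [us' hB' ->]]].
pose r := undup (s ++ s').
have ur : uniq r by exact: undup_uniq.
have sr : {subset s <= r} by move=> p ps; rewrite mem_undup mem_cat ps.
have s'r : {subset s' <= r} by move=> p ps; rewrite mem_undup mem_cat ps orbT.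
pose C := widen s B; pose C' := widen s' B'.
have hC p : path_past t%:num (C p) by exact: widen_past.
have hC' p : path_past T (C' p) by exact: widen_past.
have mC p : measurable (C p : set (borel (cadlag R nat))) := path_past_measurable (hC p).
have mC' p : measurable (C' p : set (borel (cadlag R nat))) := path_past_measurable (hC' p).
have mS p : measurable ([set w | C' p (shift_path t w)] : set (borel (cadlag R nat))).
  exact: measurable_shift_path (hC' p).
rewrite (@widenE s r B sr) (@widenE s' r B' s'r) -/C -/C'.
split; last first.
  rewrite (prob_rect (B := fun p => [set w | C' p (shift_path t w)])) // prob_rect //.
  by apply: eq_bigr => p _; have [] := path_independence p (hC p) T0 (hC' p).
have -> : [set K : driving R S | forall p, p \in r -> C p (K p)] `&`
    [set K | [set K' : driving R S | forall p, p \in r -> C' p (K' p)] (shift_driving t K)] =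
    [set K : driving R S | forall p, p \in r ->
      (C p `&` [set w | C' p (shift_path t w)]) (K p)].
  apply/seteqP; split => K /=; first by move=> [h1 h2] p pr; split; [exact: h1|exact: h2].
  by move=> h; split => p /h[].
rewrite (prob_rect (B := fun p => C p `&` [set w | C' p (shift_path t w)])) //; last first.
  by move=> p; exact: measurableI.
rewrite !prob_rect // -big_split /=; apply: eq_bigr => p _.
by have [] := path_independence p (hC p) T0 (hC' p).
Qed.

(** Coordinates are independent, so that the one-dimensional statement passes to
    rectangles; these generate the past. *)
Lemma increments_independent (t : {nonneg R}) T A E : 0 <= T -> past t%:num A -> past T E ->
  P (A `&` [set K | E (shift_driving t K)]) = (P A * P E)%E /\
  P [set K | E (shift_driving t K)] = P E.
Proof.
move=> T0 hA hE.
have step1 A' E' : past t%:num A' -> rect T E' ->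
    P (A' `&` [set K | E' (shift_driving t K)]) =
    (P A' * P [set K | E' (shift_driving t K)])%E.
  move=> hA' rE; have mE := measurable_shift t (rect_past (sub_sigma_algebra rE)).
  apply: (@independence_extend _ (borel (driving R S)) R P (driving R S) id id
    (rect t%:num) [set K | E' (shift_driving t K)] mE).
  - exact: rect_setI.
  - by move=> B hB; apply: past_measurable; exact: rect_past hB.
  - by move=> B hB; apply: past_measurable; exact: rect_past hB.
  - by move=> B rB; have [h1 h2] := rect_independence T0 rB rE; rewrite h2.
  - exact: past_rect.
have step2 A' E' : past t%:num A' -> past T E' ->
    P ([set K | E' (shift_driving t K)] `&` A') = (P E' * P A')%E.
  move=> hA' hE'; have mA := past_measurable hA'.
  apply: (@independence_extend _ (borel (driving R S)) R P (driving R S) (shift_driving t) id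
    (rect T) A' mA).
  - exact: rect_setI.
  - by move=> B hB; apply: (measurable_shift t (T := T)); exact: rect_past hB.
  - by move=> B hB; apply: past_measurable; exact: rect_past hB.
  - move=> B rB; have rT : rect t%:num setT.
      exists (fun _ => setT), [::]; split => //.
        by move=> p; exact: (salgT (path_past_salg _)).
      by apply/seteqP; split.
    rewrite setIC; have := step1 A' B hA' rB.
    by have [_ ->] := rect_independence T0 rT rB; rewrite muleC.
  - exact: past_rect.
split; first by rewrite setIC step2 // muleC.
have := step2 setT E (salgT (past_salg _)) hE.
by rewrite setIT probability_setT mule1.
Qed.

End independent_increments.

(** * Limits of probabilities *)
Section limits_of_events.
Context {d : measure_display} {T : measurableType d} {R : realType}.
Variable P : probability T R.

Lemma integrable_one (D : set T) : measurable D -> P.-integrable D (cst 1%E).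
Proof. by move=> mD; exact: (@finite_measure_integrable_cst _ _ _ P D 1). Qed.

Lemma prob_cvg (F : set T) (X_ : nat -> set T) (X : set T) : full P F ->
  (forall m, measurable (X_ m)) -> measurable X ->
  (forall x, F x -> exists n, forall m, (n <= m)%N -> X_ m x <-> X x) ->
  P (X_ m) @[m --> \oo] --> P X.
Proof.
move=> fF mX_ mX h; have mF := fF.1.
have PF Y : measurable Y -> P Y = (\int[P]_(x in F) (\1_Y x)%:E)%E.
  move=> mY; rewrite integral_indic //.
  by apply: (full_eq fF) => //; [exact: measurableI|move=> x Fx; split => [|[]]].
rewrite PF //; under eq_cvg do rewrite PF //.
apply: (@dominated_cvg _ _ _ P F mF (fun m x => (\1_(X_ m) x)%:E) (fun x =>
  (\1_X x)%:E) (cst 1%E)).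
- move=> m; apply/measurable_EFinP; exact: measurable_indic.
- move=> x Fx; apply: cvg_near_cst; have [n hn] := h x Fx.
  exists n => // m /= nm; rewrite !indicE.
  by have -> : (x \in X_ m) = (x \in X) by apply/idP/idP => /set_mem /(hn m nm) /mem_set.
- by [].
- exact: integrable_one.
- move=> m x _; rewrite /= lee_fin indicE.
  by case: (x \in X_ m); rewrite ?normr1 ?normr0.
Qed.

(** Conditioning on a variable with countably many values: [f] will be constant
    on each piece. *)
Lemma prob_integral_partition (A : countType) (kappa : T -> A) (X Y : set T) (f : T -> \bar R) :
  measurable X -> measurable Y -> (forall a, measurable [set x | kappa x = a]) ->
  measurable_fun setT f -> (forall x, (0 <= f x)%E) ->
  (forall a, P (X `&` [set x | kappa x = a] `&` Y) =
     (\int[P]_(x in X `&` [set x | kappa x = a]) f x)%E) ->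
  P (X `&` Y) = (\int[P]_(x in X) f x)%E.
Proof.
move=> mX mY mk mf f0 h.
pose F n : set T := if @choice.unpickle A n is Some a then
  (if choice.pickle a == n then X `&` [set x | kappa x = a] else set0) else set0.
have mF n : measurable (F n).
  by rewrite /F; case: choice.unpickle => // a; case: ifP => // _; exact: measurableI.
have FP n x : F n x -> choice.pickle (kappa x) = n.
  by rewrite /F; case: choice.unpickle => // a; case: ifP => // /eqP <- [_ /= ->].
have XE : X = \bigcup_n F n.
  apply/seteqP; split => x.
    by move=> Xx; exists (choice.pickle (kappa x)) => //; rewrite /F choice.pickleK eqxx.
  by move=> [n _]; rewrite /F; case: choice.unpickle => // a; case: ifP => // _ [].
have tF : trivIset setT F.
  by apply/trivIsetP => i j _ _ ij; apply/seteqP; split => // x [/FP e1 /FP e2]; move: ij;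
    rewrite -e1 -e2 eqxx.
rewrite {1}XE setI_bigcupl measure_bigcupT; first last.
- by move=> n; exact: measurableI.
- apply/trivIsetP => i j _ _ ij; rewrite setIACA.
  by move/trivIsetP : tF => /(_ i j I I ij) ->; rewrite set0I.
rewrite [in RHS]XE ge0_integral_bigcup //; last exact: measurable_funTS.
apply: eq_eseriesr => n _; rewrite /F; case: choice.unpickle => [a|].
  by case: ifP => _; [exact: h|rewrite set0I measure0 integral_set0].
by rewrite set0I measure0 integral_set0.
Qed.

End limits_of_events.

(** * Restarted driving paths are almost surely good *)
Section shifted_driving.
Context {R : realType} {S : countType} (t0 : R).
Hypothesis t0_gt0 : 0 < t0.
Variables (P : probability (borel (driving R S)) R) (c : opair S -> R).
Hypotheses (c_ge0 : forall p, 0 <= c p) (P_law : poisson_law P c).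
Hypothesis SEP : sep_assumption P t0.
Implicit Types (K : driving R S) (p q : opair S).

Lemma counter_shift K (t : {nonneg R}) x y (s : R) : 0 <= s ->
  counter (shift_driving t K) x y s = (counter K x y (t%:num + s)%R - counter K x y t%:num)%N.
Proof.
move=> s0; rewrite /counter; case: insub => [p|]; last by rewrite subnn.
by rewrite /shift_driving shift_pathE.
Qed.

Lemma edge_shift K (t : {nonneg R}) (a b : R) : (forall p, mono_path (K p)) -> 0 <= a ->
  0 <= b ->
  edge (shift_driving t K) a b =2 edge K (t%:num + a) (t%:num + b).
Proof.
move=> mK a0 b0 x y; rewrite /edge /sym_count !counter_shift //; congr (_ && _).
have h u v (s : R) : 0 <= s -> (counter K u v t%:num <= counter K u v (t%:num + s)%R)%N.
  by move=> s0; rewrite /counter; case: insub => // p; apply: mK; rewrite ?lerDl.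
have := h x y a a0; have := h y x a a0; have := h x y b b0; have := h y x b b0.
move: (counter K x y t%:num) (counter K y x t%:num) => c1 c2.
move: (counter K x y (t%:num + a)) (counter K y x (t%:num + a)) => d1 d2.
move: (counter K x y (t%:num + b)) (counter K y x (t%:num + b)) => e1 e2.
move=> h1 h2 h3 h4; apply/idP/idP; lia.
Qed.

Lemma finite_components_ext (e e' : rel S) : e =2 e' -> finite_components e ->
  finite_components e'.
Proof.
move=> ee h x; apply: (sub_finite_set _ (h x)) => y [s ps ->]; exists s => //.
by rewrite (eq_path ee).
Qed.

Lemma full_tame_law : full P (@tame R S). Proof. exact: (full_tame c_ge0 P_law). Qed.

(** The hypothesis on the first slot, transported by stationarity. *)
Lemma full_slot (t : {nonneg R}) :
  full P [set K | finite_components (edge (shift_driving t K) 0 t0)].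
Proof.
have pE : past t0 [set K : driving R S | finite_components (edge K 0 t0)].
  apply: (finite_components_meas (past_salg t0) (t := t0)) => //; try exact: ltW.
  by move=> p s s0 st; exact: (past_coord p s0 st).
have fE := full_ae SEP erefl (past_measurable pE).
have [_ h] := increments_independent c_ge0 P_law (ltW t0_gt0) (salgT (past_salg t%:num)) pE.
apply: full1; first exact: (measurable_shift t pE).
by move: h => /= ->; exact: full_P1.
Qed.

Lemma edge_slot_shift K (t : {nonneg R}) r : (forall p, mono_path (K p)) ->
  edge_slot t0 (shift_driving t K) r =2
  edge (shift_driving (NngNum (addr_ge0 (ge0 t) (mulr_ge0 (ler0n R r) (ltW t0_gt0)))) K) 0 t0.
Proof.
move=> mK x y; rewrite /edge_slot !edge_shift //=; try by rewrite ?mulr_ge0 // ltW.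
by rewrite addr0 -addrA -[r.+1]addn1 natrD mulrDl mul1r.
Qed.

Lemma simple_shift K (t : {nonneg R}) : simple_jumps K -> simple_jumps (shift_driving t K).
Proof.
move=> sK; have mK p : mono_path (K p) := simple_mono p sK.
have ll p (s : R) : 0 < s ->
    left_lim (shift_driving t K p) s = (left_lim (K p) (t%:num + s)%R - K p t%:num)%N /\
    (K p t%:num <= left_lim (K p) (t%:num + s)%R)%N.
  move=> s0; have ts : 0 <= t%:num + s by rewrite addr_ge0 // ltW.
  split; last by have [] := @mono_left_lim _ (K p) t%:num (t%:num + s) (mK p) (ge0 t) _;
    rewrite ?ltrDl.
  have [d [d0 [_ h]]] := left_lim_step (K p) ts.
  apply: (@left_limE _ _ _ (Num.min d s)); first by rewrite lt_min d0.
  have m1 : Num.min d s <= d by rewrite ge_min lexx.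
  have m2 : Num.min d s <= s by rewrite ge_min lexx orbT.
  move=> u u1 u2; rewrite shift_pathE; last by lra.
  by rewrite h //; lra.
have jump p s : jump_times (shift_driving t K p) s -> jump_times (K p) (t%:num + s).
  move=> js; have s0 := jump_gt0 js; have [e _] := ll p s s0.
  by move=> eK; apply: js; rewrite e -eK shift_pathE // ltW.
split.
  move=> p q pq; apply/seteqP; split => // s [/jump jp /jump jq].
  have : (jump_times (K p) `&` jump_times (K q)) (t%:num + s) by split.
  by rewrite sK.1.
move=> p s js; have s0 := jump_gt0 js; have [e le] := ll p s s0.
have := sK.2 _ _ (jump _ _ js); rewrite /rings_at e => eK.
by rewrite shift_pathE ?(ltW s0) // eK subSn.
Qed.

Lemma full_Gamma : full P (Gamma_star t0).
Proof.
have fA : full P [set K | forall p q, p != q -> sometimes_apart (K p) (K q)].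
  apply: full_all => p; apply: full_all => q; apply: full_imply => pq.
  exact: (full_apart P_law pq).
have fS : full P [set K | forall r, finite_components
    (edge (shift_driving (NngNum (addr_ge0 (lexx 0) (mulr_ge0 (ler0n R r) (ltW t0_gt0)))) K) 0
      t0)].
  by apply: full_all => r; exact: full_slot.
apply: (full_sub _ (fullI full_tame_law (fullI fA fS))); first exact: measurable_Gamma.
move=> K [tK [aK fK]]; apply/Gamma_starE => //; split.
- move=> r; apply: finite_components_ext (fK r) => x y.
  rewrite edge_shift //=; last 2 first.
  + by move=> p; exact: tame_mono.
  + exact: ltW.
  by rewrite /edge_slot add0r addr0 -[r.+1]addn1 natrD mulrDl mul1r.
- by move=> p; have [] := tK p.
- by move=> p; have [] := tK p.
- exact: aK.
Qed.

Lemma full_regular_shift (t : {nonneg R}) :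
  exists F, full P F /\ forall K, F K -> Gamma_star t0 K /\ regular t0 (shift_driving t K).
Proof.
exists (Gamma_star t0 `&` [set K | forall r, finite_components
    (edge (shift_driving (NngNum (addr_ge0 (ge0 t) (mulr_ge0 (ler0n R r) (ltW t0_gt0)))) K) 0
      t0)]).
split; first by apply: fullI; [exact: full_Gamma|apply: full_all => r; exact: full_slot].
move=> K [gK fK]; split => //; have [sK _] := Gamma_regular gK.
split; first exact: simple_shift.
move=> r; apply: finite_components_ext (fK r) => x y.
by rewrite edge_slot_shift // => p; exact: simple_mono.
Qed.

End shifted_driving.

(** * Events on trajectory space *)
Section config_paths.
Context {R : realType} {S : countType}.
Implicit Types (w : cadlag R (config S)) (z : config S) (x : S) (b : bool).

Lemma cadlag_ext w w' : (forall t : R, 0 <= t -> w t = w' t) -> w = w'.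
Proof.
case: w w' => f hf [g hg] fg.
have e : f = g.
  apply/funext => t; have t_ge0 : 0 <= t%:num by [].
  have := fg t%:num t_ge0; rewrite /path_at /extend /=.
  have -> : NngNum (maxr0_ge0 t%:num) = t by apply/val_inj; rewrite /= max_r.
  by [].
move: hf {fg}; rewrite e => hf; congr Cadlag; exact: Prop_irrelevance.
Qed.

Lemma measurable_site (t : R) x b : 0 <= t ->
  measurable ([set w | w t x = b] : set (borel (cadlag R (config S)))).
Proof.
exact: (@measurable_path_at R (config S) bool (fun z => z x) (entourage_coord x) t b).
Qed.

Lemma measurable_paths (G : set (set (cadlag R (config S)))) : sigma_algebra setT G ->
  (forall t x b, 0 <= t -> G [set w : cadlag R (config S) | w t x = b]) ->
  forall A : set (borel (cadlag R (config S))), measurable A -> G A.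
Proof.
by move=> sG hG; apply: smallest_sub => // U oU; exact: skorohod_open_coord.
Qed.

Lemma measurable_configs (G : set (set (config S))) : sigma_algebra setT G ->
  (forall x b, G [set z | z x = b]) ->
  forall A : set (borel (config S)), measurable A -> G A.
Proof. by move=> sG hG; apply: smallest_sub => // U oU; exact: open_config. Qed.

Lemma measurable_eval (t : R) (B : set (borel (config S))) : 0 <= t -> measurable B ->
  measurable ([set w | B (w t)] : set (borel (cadlag R (config S)))).
Proof.
move=> t_ge0 mB; apply: (@measurable_configs [set B | measurable
  ([set w | B (w t)] : set (borel (cadlag R (config S))))]) => //.
  exact: (preimage_salg (fun w : cadlag R (config S) => w t) (borel_salg _)).
by move=> x b; exact: measurable_site.
Qed.

Lemma measurable_fun_eval (t : R) : 0 <= t ->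
  measurable_fun [set: borel (cadlag R (config S))]
    (fun w : borel (cadlag R (config S)) => (w : cadlag R (config S)) t : borel (config S)).
Proof. by move=> t_ge0 _ B mB; rewrite setTI; exact: measurable_eval. Qed.

Lemma measurable_time_shift (t : {nonneg R}) (A : set (borel (cadlag R (config S)))) :
  measurable A -> measurable (time_shift t @^-1` A : set (borel (cadlag R (config S)))).
Proof.
move=> mA; apply: (@measurable_paths [set B | measurable
  (time_shift t @^-1` B : set (borel (cadlag R (config S))))]) => //.
  exact: (preimage_salg (time_shift t) (borel_salg _)).
move=> s x b s0 /=.
have -> : time_shift t @^-1` [set w : cadlag R (config S) | w s x = b] =
    [set w : cadlag R (config S) | w (t%:num + s) x = b].
  by apply/funext => w; rewrite /preimage /mkset {1}/path_at /extend /= max_r.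
by apply: measurable_site; rewrite addr_ge0.
Qed.

Lemma natural_filtration_measurable (t : R) (B : set (borel (cadlag R (config S)))) :
  natural_filtration t B -> measurable B.
Proof.
move: B; apply: smallest_sub; first exact: borel_salg.
by move=> _ [s /andP[s0 _] [B mB ->]]; exact: measurable_eval.
Qed.

Definition cylinder (l : seq ({nonneg R} * S * bool)) : set (cadlag R (config S)) :=
  [set w | forall q, q \in l -> w q.1.1%:num q.1.2 = q.2].

Definition cylinders : set (set (cadlag R (config S))) := [set A | exists l, A = cylinder l].

Lemma cylinders_setI_closed : setI_closed cylinders.
Proof.
move=> _ _ [l ->] [l' ->]; exists (l ++ l'); apply/seteqP; split => w /=.
  by move=> [h h'] q; rewrite mem_cat => /orP[/h|/h'].
by move=> h; split => q ql; apply: h; rewrite mem_cat ql ?orbT.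
Qed.

Lemma measurable_cylinders (A : set (borel (cadlag R (config S)))) :
  measurable A -> <<s cylinders >> A.
Proof.
apply: (@measurable_paths <<s cylinders >>); first exact: smallest_sigma_algebra.
move=> t x b t_ge0; apply: sub_sigma_algebra; exists [:: (NngNum t_ge0, x, b)].
apply/seteqP; split => w /=; first by move=> e q; rewrite inE => /eqP ->.
by move=> h; exact: (h (NngNum t_ge0, x, b) (mem_head _ _)).
Qed.

Lemma cylinder_measurable l : measurable (cylinder l : set (borel (cadlag R (config S)))).
Proof. by apply: (salg_all_seq (borel_salg _)) => q _; exact: measurable_site. Qed.

Definition code (m : nat) (z : config S) : seq bool := restr (sites m) z.

Definition decode (m : nat) (s : seq bool) : config S :=
  fun x => nth false s (index x (@sites S m)).

Lemma codeK m z : {in sites m, forall x, z x = decode m (code m z) x}.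
Proof.
by move=> x xs; rewrite /decode /code /restr (nth_map x) ?index_mem // nth_index.
Qed.

Lemma cmeas_code m : cmeas (measurable : set (set (borel (config S)))) (code m).
Proof.
apply: (@cmeas_map _ _ (borel_salg (config S)) S bool (sites m) (fun x z => z x)).
by move=> x b; exact: measurable_config_coord.
Qed.

End config_paths.

(** * The law of the exclusion process *)
Section exclusion.
Context {R : realType} {S : countType} (t0 : R).
Hypothesis t0_gt0 : 0 < t0.
Variables (P : probability (borel (driving R S)) R) (c : opair S -> R).
Hypotheses (c_ge0 : forall p, 0 <= c p) (P_law : poisson_law P c).
Hypothesis SEP : sep_assumption P t0.
Implicit Types (K : driving R S) (z : config S) (x : S) (b : bool).

Lemma eta_at0 K z : eta t0 K z 0 = z.
Proof.
have -> : eta t0 K z 0 = evolve t0 K 0 z 0.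
  by apply: (eta_in_slot t0_gt0); rewrite ?mul0r // mul1r ltW.
apply/funext => x; rewrite /evolve update_times_nil // => v [/andP[]].
by rewrite mul0r; lra.
Qed.

(** The value off the good driving paths is arbitrary: it has probability 0. *)
Definition sep_path z K : cadlag R (config S) :=
  if pselect (Gamma_star t0 K) is left g
  then Cadlag (is_cadlag_eta t0_gt0 z (Gamma_regular g)) else point.

Lemma sep_pathE z K (t : R) : Gamma_star t0 K -> 0 <= t -> sep_path z K t = eta t0 K z t.
Proof.
move=> gK t_ge0; rewrite /sep_path; case: pselect => // g.
by rewrite /path_at /extend /= /eta_fun /= max_r.
Qed.

Lemma measurable_sep_path z (A : set (borel (cadlag R (config S)))) : measurable A ->
  measurable (sep_path z @^-1` A : set (borel (driving R S))).
Proof.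
move=> mA; apply: (@measurable_paths R S [set B | measurable
  (sep_path z @^-1` B : set (borel (driving R S)))]) => //.
  exact: (preimage_salg (sep_path z) (borel_salg _)).
move=> t x b t_ge0 /=; have sG := borel_salg (driving R S).
have mG := @measurable_Gamma R S t0 t0_gt0.
have [B /past_measurable mB hB] := eta_past t0_gt0 z x b t_ge0.
have -> : sep_path z @^-1` [set w | w t x = b] =
    (Gamma_star t0 `&` B) `|`
      (~` Gamma_star t0 `&` [set _ | (point : cadlag R (config S)) t x = b]).
  apply/seteqP; split => K /=.
    have [gK|nK] := pselect (Gamma_star t0 K).
      by rewrite sep_pathE // => e; left; split => //; apply/(hB K (Gamma_regular gK)).
    by rewrite {1}/sep_path; case: pselect => // _ e; right.
  case=> -[gK].
    by move=> BK; rewrite sep_pathE //; apply/(hB K (Gamma_regular gK)).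
  by rewrite {1}/sep_path; case: pselect.
apply: (salgU sG); apply: (salgI sG) => //; first exact: (salgC sG mG).
exact: (salg_cst sG).
Qed.

Lemma measurable_fun_sep_path z :
  measurable_fun [set: borel (driving R S)]
    (sep_path z : borel (driving R S) -> borel (cadlag R (config S))).
Proof. by move=> _ A mA; rewrite setTI; exact: measurable_sep_path. Qed.

Definition sep_mfun z : {mfun borel (driving R S) >-> borel (cadlag R (config S))} :=
  MeasurableFun.pack_ (isMeasurableFun.phant_Build (measurable_fun_sep_path z)).

Definition sep_law z : probability (borel (cadlag R (config S))) R :=
  distribution P (sep_mfun z).

Lemma sep_lawE z (A : set (borel (cadlag R (config S)))) : sep_law z A = P (sep_path z @^-1` A).
Proof. by []. Qed.

Let fG : full P (Gamma_star t0) := full_Gamma t0_gt0 c_ge0 P_law SEP.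

Lemma sep_law_graphical z (A : set (borel (cadlag R (config S)))) : measurable A ->
  sep_law z A = graphical_law P t0 z A.
Proof.
move=> mA; rewrite sep_lawE /graphical_law.
have -> : [set K | Gamma_star t0 K /\
     exists2 w : cadlag R (config S), A w & forall t, 0 <= t -> w t = eta t0 K z t] =
   Gamma_star t0 `&` sep_path z @^-1` A.
  apply/seteqP; split => K /= [gK].
    move=> [w Aw hw]; split => //; have -> // : sep_path z K = w.
    by apply: cadlag_ext => t t_ge0; rewrite sep_pathE // hw.
  move=> AK; split => //; exists (sep_path z K) => // t t_ge0; exact: sep_pathE.
have mS := measurable_sep_path z mA.
apply: (full_eq fG) => //; first by apply: measurableI => //; exact: fG.1.
by move=> K gK; split => [|[]].
Qed.

Lemma sep_law_start z : sep_law z [set w | w 0 = z] = 1%E.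
Proof.
have mE : measurable ([set w | w 0 = z] : set (borel (cadlag R (config S)))).
  have -> : ([set w | w 0 = z] : set (borel (cadlag R (config S)))) =
      [set w : cadlag R (config S) | forall x, w 0 x = z x].
    by apply/seteqP; split => w /=; [move=> ->|move=> h; exact/funext].
  by apply: (salg_all (borel_salg _)) => x; exact: measurable_site.
rewrite sep_lawE; apply: full_P1; apply: (full_sub _ fG).
  exact: measurable_sep_path.
by move=> K gK /=; rewrite sep_pathE // eta_at0.
Qed.

Lemma cylinder_continuous (l : seq ({nonneg R} * S * bool)) K z : regular t0 K -> exists n,
  forall m, (n <= m)%N -> forall z',
  {in sites m, forall y, z y = z' y} ->
  (forall q : {nonneg R} * S * bool, q \in l -> eta t0 K z' q.1.1%:num q.1.2 = q.2) <->
  (forall q : {nonneg R} * S * bool, q \in l -> eta t0 K z q.1.1%:num q.1.2 = q.2).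
Proof.
move=> rK; suff [n hn] : exists n, forall m, (n <= m)%N -> forall z',
    {in sites m, forall y, z y = z' y} ->
    forall q : {nonneg R} * S * bool, q \in l -> eta t0 K z' q.1.1%:num q.1.2 =
      eta t0 K z q.1.1%:num q.1.2.
  exists n => m nm z' zz; split => h q ql.
    by rewrite -(hn m nm z' zz q ql) h.
  by rewrite (hn m nm z' zz q ql) h.
elim: l => [|q l [n hn]]; first by exists 0%N.
have q0 : 0 <= q.1.1%:num by [].
have [n' hn'] := eta_continuous t0_gt0 z q.1.2 rK q0.
exists (maxn n n') => m; rewrite geq_max => /andP[nm nm'] z' zz q'.
rewrite inE => /predU1P[->|q'l]; first exact: (hn' m nm' z' zz).
exact: (hn m nm z' zz).
Qed.

Lemma sep_path_cylinder (l : seq ({nonneg R} * S * bool)) K z : Gamma_star t0 K ->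
  (sep_path z @^-1` cylinder l) K <->
  forall q : {nonneg R} * S * bool, q \in l -> eta t0 K z q.1.1%:num q.1.2 = q.2.
Proof. by move=> gK; split => h q ql; have := h q ql; rewrite sep_pathE. Qed.

(** For each good driving path, the trajectories started from the two
    configurations agree on the cylinder for large [m]. *)
Lemma cylinder_law_cvg l z :
  sep_law (decode m (code m z)) (cylinder l) @[m --> \oo] --> sep_law z (cylinder l).
Proof.
apply: (prob_cvg fG).
- by move=> m; apply: measurable_sep_path; exact: cylinder_measurable.
- by apply: measurable_sep_path; exact: cylinder_measurable.
- move=> K gK; have [n hn] := cylinder_continuous l z (Gamma_regular gK).
  exists n => m nm; have h := hn m nm _ (@codeK S m z).
  by split => /(sep_path_cylinder l _ gK)/h ?; apply/(sep_path_cylinder l _ gK).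
Qed.

Lemma measurable_code_fun m (g : seq bool -> \bar R) :
  measurable_fun [set: borel (config S)] (fun z : borel (config S) => g (code m z)).
Proof.
move=> _ Y mY; rewrite setTI.
exact: (cmeas_pred (borel_salg (config S)) (fun s => Y (g s)) (cmeas_code m)).
Qed.

Lemma cylinder_law_measurable l :
  measurable_fun [set: borel (config S)] (fun z : borel (config S) => sep_law z (cylinder l)).
Proof.
apply: (@emeasurable_fun_cvg _ _ _ _ (fun m (z : borel (config S)) =>
  sep_law (decode m (code m z)) (cylinder l))).
  by move=> m; exact: (measurable_code_fun m (fun s => sep_law (decode m s) (cylinder l))).
by move=> z _; exact: cylinder_law_cvg.
Qed.

End exclusion.

(** * The Markov property *)
Section markov.
Context {R : realType} {S : countType} (t0 : R).
Hypothesis t0_gt0 : 0 < t0.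
Variables (P : probability (borel (driving R S)) R) (c : opair S -> R).
Hypotheses (c_ge0 : forall p, 0 <= c p) (P_law : poisson_law P c).
Hypothesis SEP : sep_assumption P t0.
Implicit Types (K : driving R S) (z : config S) (l : seq ({nonneg R} * S * bool)).

Local Notation trajectory := (sep_path t0_gt0).
Local Notation law := (sep_law t0_gt0 P).

Let fG : full P (Gamma_star t0) := full_Gamma t0_gt0 c_ge0 P_law SEP.

Lemma sep_path_past z (t : R) (B : set (cadlag R (config S))) : natural_filtration t B ->
  exists2 B', past t B' & forall K, Gamma_star t0 K -> B (trajectory z K) <-> B' K.
Proof.
have sT := trace_salg (Gamma_star t0) (trajectory z) (past_salg (S := S) t).
move: B; apply: smallest_sub => // _ [s /andP[s0 st] [B mB ->]].
have sT' := trace_salg (Gamma_star t0) (fun K => trajectory z K s) (past_salg (S := S) t).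
apply: (measurable_configs sT' _ mB) => x b.
have [B' pB hB] := eta_past t0_gt0 z x b s0.
exists B'; first exact: past_le pB.
by move=> K gK /=; rewrite sep_pathE //; apply: iff_sym; exact: hB (Gamma_regular gK).
Qed.

Lemma cylinder_past l : exists2 T : R, 0 <= T & forall z, exists2 E, past T E &
  forall K, regular t0 K -> E K <->
    forall q : {nonneg R} * S * bool, q \in l -> eta t0 K z q.1.1%:num q.1.2 = q.2.
Proof.
have [T T0 hT] : exists2 T : R, 0 <= T & forall q, q \in l -> q.1.1%:num <= T.
  elim: l => [|q l [T T0 hT]]; first by exists 0.
  exists (Num.max T q.1.1%:num); first by rewrite le_max T0.
  move=> q'; rewrite inE => /predU1P[->|/hT h]; first by rewrite le_max lexx orbT.
  by rewrite le_max h.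
exists T => // z.
have /choice[E hE] : forall q : {nonneg R} * S * bool, exists E, past q.1.1%:num E /\
    forall K, regular t0 K -> E K <-> eta t0 K z q.1.1%:num q.1.2 = q.2.
  move=> q; have q0 : 0 <= q.1.1%:num by [].
  by have [E pE h] := eta_past t0_gt0 z q.1.2 q.2 q0; exists E.
exists [set K | forall q, q \in l -> E q K].
  apply: (salg_all_seq (past_salg T)) => q ql.
  by have [pE _] := hE q; exact: past_le (hT q ql) _ pE.
move=> K rK; split => h q ql; have [_ hq] := hE q; apply/(hq K rK); exact: h.
Qed.

(** The flow property, for the trajectory seen from time [t]. *)
Lemma sep_path_shift z K (t : {nonneg R}) l : Gamma_star t0 K ->
  regular t0 (shift_driving t K) ->
  cylinder l (time_shift t (trajectory z K)) <->
  forall q : {nonneg R} * S * bool, q \in l ->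
    eta t0 (shift_driving t K) (trajectory z K t%:num) q.1.1%:num q.1.2 = q.2.
Proof.
move=> gK rT; have t_ge0 : 0 <= t%:num by [].
have e (s : {nonneg R}) : time_shift t (trajectory z K) s%:num =
    eta t0 (shift_driving t K) (trajectory z K t%:num) s%:num.
  have s0 : 0 <= s%:num by [].
  rewrite sep_pathE // -eta_flow //; last exact: Gamma_regular gK.
  by rewrite {1}/path_at /extend /= max_r // sep_pathE // addr_ge0.
by split => h q ql; have := h q ql; rewrite e.
Qed.

Lemma measurable_fun_at z (t : R) : 0 <= t ->
  measurable_fun [set: borel (driving R S)] (fun K => trajectory z K t : borel (config S)).
Proof.
move=> t_ge0 _ B mB; rewrite setTI.
exact: (measurable_sep_path t0_gt0 z (measurable_eval t_ge0 mB)).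
Qed.

Lemma law_ge0 z A : (0 <= law z A)%E. Proof. exact: measure_ge0. Qed.

Lemma law_le1 z (A : set (borel (cadlag R (config S)))) : measurable A -> (law z A <= 1)%E.
Proof. exact: probability_le1. Qed.

(** The first [m] sites of the configuration at time [t] take countably many
    values.  On each of them, the past event and the future event are independent,
    and the latter has the probability given by the law started from that value. *)
Lemma markov_truncated x (t : {nonneg R}) (B : set (cadlag R (config S))) l m :
  natural_filtration t%:num B ->
  exists Y : set (borel (driving R S)), [/\ measurable Y,
    forall K, regular t0 (shift_driving t K) -> Y K <->
      (forall q : {nonneg R} * S * bool, q \in l ->
        eta t0 (shift_driving t K) (decode m (code m (trajectory x K t%:num))) q.1.1%:num
          q.1.2 = q.2) &
    P (trajectory x @^-1` B `&` Y) =
    (\int[P]_(K in trajectory x @^-1` B) law (decode m (code m (trajectory x K t%:num)))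
      (cylinder l))%E].
Proof.
move=> nB; have t_ge0 : 0 <= t%:num by [].
have sG := borel_salg (driving R S).
have [T T0 /(_ (decode m _)) hT] := cylinder_past l.
have /choice[E hE] : forall s : seq bool, exists E, past T E /\ forall K, regular t0 K ->
  E K <->
    forall q : {nonneg R} * S * bool, q \in l -> eta t0 K (decode m s) q.1.1%:num q.1.2 = q.2.
  by move=> s; have [E pE h] := hT s; exists E.
pose kappa K := code m (trajectory x K t%:num).
have mX : measurable (trajectory x @^-1` B : set (borel (driving R S))).
  by apply: measurable_sep_path; exact: natural_filtration_measurable nB.
have mk s : measurable ([set K | kappa K = s] : set (borel (driving R S))).
  have := @measurable_fun_at x _ t_ge0 measurableT [set z | code m z = s] (cmeas_code m s).
  by rewrite setTI.
have mS s : measurable ([set K | E s (shift_driving t K)] : set (borel (driving R S))).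
  by have [pE _] := hE s; exact: (measurable_shift t pE).
pose Y : set (borel (driving R S)) :=
  [set K | exists s, kappa K = s /\ E s (shift_driving t K)].
have mY : measurable Y by apply: (salg_ex sG) => s; exact: (salgI sG (mk s) (mS s)).
exists Y; split => //.
  move=> K rK; split => [[s [<- EK]]|h]; first by have [_ hK] := hE (kappa K); apply/(hK _ rK).
  by exists (kappa K); split => //; have [_ hK] := hE (kappa K); apply/(hK _ rK).
apply: (@prob_integral_partition _ (borel (driving R S)) R P (seq bool) kappa
  (trajectory x @^-1` B) Y (fun K => law (decode m (kappa K)) (cylinder l))) => //.
- apply: (measurableT_comp (measurable_code_fun m (fun s => law (decode m s) (cylinder l)))).
  exact: measurable_fun_at.
- move=> a; have [pE hEa] := hE a.
  have mXa : measurable (trajectory x @^-1` B `&` [set K | kappa K = a] :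
    set (borel (driving R S))).
    exact: measurableI.
  have [D pD hD] : exists2 D, past t%:num D & forall K, Gamma_star t0 K ->
      (trajectory x @^-1` B `&` [set K | kappa K = a]) K <-> D K.
    have nA : natural_filtration t%:num [set w : cadlag R (config S) | code m (w t%:num) = a].
      apply: sub_sigma_algebra; exists t%:num; first by rewrite t_ge0 lexx.
      by exists [set z | code m z = a] => //; exact: cmeas_code.
    have [D1 p1 h1] := sep_path_past x nB; have [D2 p2 h2] := sep_path_past x nA.
    exists (D1 `&` D2); first exact: (salgI (past_salg _)).
    move=> K gK; split => -[k1 k2]; split;
      [exact/(h1 K gK)|exact/(h2 K gK)|exact/(h1 K gK)|exact/(h2 K gK)].
  have mD := past_measurable pD.
  have -> : trajectory x @^-1` B `&` [set K | kappa K = a] `&` Y =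
      trajectory x @^-1` B `&` [set K | kappa K = a] `&` [set K | E a (shift_driving t K)].
    apply/seteqP; split => K [[XK ka] YK]; split => //.
      by case: YK => s [ks EK]; rewrite /= -ka ks.
    by exists a.
  transitivity (P (D `&` [set K | E a (shift_driving t K)])).
    apply: (full_eq fG) => //; [exact: measurableI|exact: measurableI|].
    by move=> K gK; split => -[k1 k2]; split => //; apply/(hD K gK).
  have [-> _] := increments_independent c_ge0 P_law T0 pD pE.
  have -> : (\int[P]_(K in trajectory x @^-1` B `&` [set K | kappa K = a])
      law (decode m (code m (trajectory x K t%:num))) (cylinder l))%E =
      (\int[P]_(K in trajectory x @^-1` B `&`
        [set K | kappa K = a]) cst (law (decode m a) (cylinder l)) K)%E.
    by apply: eq_integral => K /set_mem[_ /= ka]; rewrite -/(kappa K) ka.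
  rewrite integral_cst // muleC; congr (_ * _)%E.
    rewrite sep_lawE; apply: (full_eq fG) => //.
    + exact: past_measurable pE.
    + by apply: measurable_sep_path; exact: cylinder_measurable.
    + move=> K gK; split => [/(hEa K (Gamma_regular gK))|] h.
        exact/(sep_path_cylinder _ _ _ gK).
      by apply/(hEa K (Gamma_regular gK)); exact/(sep_path_cylinder t0_gt0 _ _ gK).
  apply: (full_eq fG) => // K gK; exact: iff_sym (hD K gK).
Qed.

(** Both sides are limits of their truncated versions, by continuity in the
    initial configuration. *)
Lemma markov_cylinder x (t : {nonneg R}) (B : set (cadlag R (config S))) l :
  natural_filtration t%:num B ->
  (\int[law x]_(w in B) law (w t%:num) (cylinder l))%E =
    law x (B `&` time_shift t @^-1` cylinder l).
Proof.
move=> nB; have t_ge0 : 0 <= t%:num by [].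
have mB := natural_filtration_measurable nB.
have mC := cylinder_measurable l.
have mX : measurable (trajectory x @^-1` B :
  set (borel (driving R S))) by exact: measurable_sep_path.
have mfl := cylinder_law_measurable t0_gt0 c_ge0 P_law SEP l.
have mat := measurable_fun_at x t_ge0.
transitivity (\int[P]_(K in trajectory x @^-1` B) law (trajectory x K t%:num) (cylinder l))%E.
  rewrite /sep_law /distribution ge0_integral_pushforward //.
  by apply: measurable_funTS; exact: (measurableT_comp mfl (measurable_fun_eval t_ge0)).
have /choice[Y hY] := fun m => markov_truncated x l m nB.
have [F [fF hF]] := full_regular_shift t0_gt0 c_ge0 P_law SEP t.
have lim1 : P (trajectory x @^-1` B `&` Y m) @[m --> \oo] -->
    P (trajectory x @^-1` B `&` trajectory x @^-1` (time_shift t @^-1` cylinder l)).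
  apply: (prob_cvg fF).
  - by move=> m; apply: measurableI => //; have [] := hY m.
  - by apply: measurableI => //; apply: measurable_sep_path; exact: measurable_time_shift.
  - move=> K /hF [gK rT].
    have [n hn] := cylinder_continuous t0_gt0 l (trajectory x K t%:num) rT.
    exists n => m nm; have h := hn m nm _ (@codeK S m (trajectory x K t%:num)).
    have [_ /(_ K rT) hYK _] := hY m.
    by split => -[XK YK]; split => //;
      [apply/(sep_path_shift x l gK rT)/h/hYK|apply/hYK/h/(sep_path_shift x l gK rT)].
have lim2 : P (trajectory x @^-1` B `&` Y m) @[m --> \oo] -->
    (\int[P]_(K in trajectory x @^-1` B) law (trajectory x K t%:num) (cylinder l))%E.
  have -> : (fun m => P (trajectory x @^-1` B `&` Y m)) = (fun m =>
     \int[P]_(K in trajectory x @^-1` B) law (decode m (code m (trajectory x K t%:num)))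
       (cylinder l))%E.
    by apply/funext => m; have [] := hY m.
  apply: (@dominated_cvg _ _ _ P _ mX
    (fun m K => law (decode m (code m (trajectory x K t%:num))) (cylinder l))
    (fun K => law (trajectory x K t%:num) (cylinder l)) (cst 1%E)).
  - move=> m; apply: measurable_funTS.
    exact: (measurableT_comp (measurable_code_fun m (fun s => law (decode m s) (cylinder l)))
      mat).
  - by move=> K _; exact: cylinder_law_cvg.
  - by [].
  - exact: integrable_one.
  - by move=> m K _; rewrite gee0_abs ?law_ge0 // law_le1.
exact: cvg_unique lim2 lim1.
Qed.

Lemma sep_law_markov (A : set (borel (cadlag R (config S)))) : measurable A ->
  measurable_fun [set: borel (config S)] (fun z : borel (config S) => law z A) /\
  forall x (t : {nonneg R}) (B : set (cadlag R (config S))), natural_filtration t%:num B ->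
  (\int[law x]_(w in B) law (w t%:num) A)%E = law x (B `&` time_shift t @^-1` A).
Proof.
pose H := [set A : set (borel (cadlag R (config S))) | [/\ measurable A,
  measurable_fun [set: borel (config S)] (fun z : borel (config S) => law z A) &
  forall x (t : {nonneg R}) (B : set (cadlag R (config S))), natural_filtration t%:num B ->
  (\int[law x]_(w in B) law (w t%:num) A)%E = law x (B `&` time_shift t @^-1` A)]].
suff sub : <<s cylinders >> `<=` H by move=> /measurable_cylinders/sub[].
have mev (g : borel (config S) -> \bar R) (t : {nonneg R}) (B :
  set (borel (cadlag R (config S)))) :
    measurable_fun [set: borel (config S)] g -> measurable_fun B
      (fun w : borel (cadlag R (config S)) => g ((w : cadlag R (config S)) t%:num)).
  move=> mg; have t_ge0 : 0 <= t%:num by [].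
  by apply: measurable_funTS; exact: (measurableT_comp mg (measurable_fun_eval t_ge0)).
apply: lambda_system_subset => //; first exact: cylinders_setI_closed; last first.
  move=> _ [l ->]; split; first exact: cylinder_measurable.
    exact: (cylinder_law_measurable t0_gt0 c_ge0 P_law SEP).
  by move=> x t B nB; exact: markov_cylinder.
apply/dynkin_lambda_system; split.
- split => //.
    rewrite (_ : (fun z => _) = cst 1%E); first exact: measurable_cst.
    by apply/funext => z; rewrite /= probability_setT.
  move=> x t B nB; have mB := natural_filtration_measurable nB.
  rewrite preimage_setT setIT -[RHS]mul1e -(integral_cst (law x) mB).
  by apply: eq_integral => w _; rewrite probability_setT.
- move=> C [mC mfC hC].
  have lC z : law z (~` C) = (1 - law z C)%E by exact: probability_setC.
  have mfC' : measurable_fun [set: borel (config S)] (fun z : borel (config S) => law z (~` C)).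
    rewrite (_ : (fun z => _) = (fun z => 1 - law z C)%E); last exact/funext.
    by apply: emeasurable_funB => //; exact: measurable_cst.
  split => //; first exact: measurableC.
  move=> x t B nB; have mB := natural_filtration_measurable nB.
  have mS := measurable_time_shift t mC.
  have e1 : (\int[law x]_(w in B) law (w t%:num) C +
      \int[law x]_(w in B) law (w t%:num) (~` C))%E = law x B.
    rewrite -ge0_integralD //; [|exact: (mev _ t B mfC)|exact: (mev _ t B mfC')].
    rewrite -[RHS]mul1e -(integral_cst (law x) mB); apply: eq_integral => w _.
    by rewrite lC addeC subeK // fin_num_measure.
  (* The identity for the complement follows by subtracting a finite quantity. *)
  have e2 : (law x (B `&` time_shift t @^-1` C) + law x (B `&` time_shift t @^-1` (~` C)))%E =
    law x B.
    rewrite (measureDI (law x) mB mS) addeC; congr (_ + _)%E.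
  have fin : law x (B `&` time_shift t @^-1` C) \is a fin_num.
    by apply: fin_num_measure; exact: measurableI.
  rewrite -[LHS](addeK _ fin) -[RHS](addeK _ fin).
  by rewrite [X in (X - _)%E]addeC [X in _ = (X - _)%E]addeC e2 -(hC x t B nB) e1.
- move=> F tF HF.
  have mF n : measurable (F n : set (borel (cadlag R (config S)))) by have [] := HF n.
  have lF z : law z (\bigcup_n F n) = (\sum_(0 <= n <oo) law z (F n))%E.
    exact: (measure_bigcupT (law z)).
  have mfF : measurable_fun [set: borel (config S)] (fun z : borel (config S) =>
    law z (\bigcup_n F n)).
    rewrite (_ : (fun z => _) = (fun z => \sum_(n <oo | n \in [set: nat]) law z (F n))%E);
      last first.
      by apply/funext => z; rewrite lF; apply: eq_eseriesl => n; rewrite in_setT.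
    apply: ge0_emeasurable_sum => //.
    by move=> n _; have [] := HF n.
  split => //; first exact: bigcupT_measurable.
  move=> x t B nB; have mB := natural_filtration_measurable nB.
  rewrite preimage_bigcup setI_bigcupr (measure_bigcupT (law x)); first last.
  + by move=> n; apply: measurableI => //; exact: measurable_time_shift.
  + apply/trivIsetP => i j _ _ ij; apply/seteqP; split => // w [[_ Fi] [_ Fj]].
    have : (F i `&` F j) (time_shift t w) by split.
    by move/trivIsetP : tF => /(_ i j I I ij) ->.
  transitivity (\int[law x]_(w in B) (\sum_(0 <= n <oo) law (w t%:num) (F n)))%E.
    by apply: eq_integral => w _; rewrite lF.
  rewrite integral_nneseries //; first last.
    by move=> n; have [_ mf _] := HF n; exact: (mev _ t B mf).
  by apply: eq_eseriesr => n _; have [_ _ ->] := HF n.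
Qed.

Lemma sep_law_markov_process : markov_process law.
Proof.
split.
- by move=> x; exact: (sep_law_start t0_gt0 c_ge0 P_law SEP).
- by move=> A mA; have [] := sep_law_markov mA.
move=> x t A mA; have [mfA hA] := sep_law_markov mA.
have t_ge0 : 0 <= t%:num by [].
exists (fun w => law (w t%:num) A); last exact: aeW.
split => //.
- move=> Y mY; apply: sub_sigma_algebra; exists t%:num; first by rewrite t_ge0 lexx.
  exists [set z | Y (law z A)] => //.
  by have := mfA measurableT Y mY; rewrite setTI.
- apply: (@le_integrable _ _ _ (law x) setT _ _ (cst 1%E)) => //.
  + exact: (measurableT_comp mfA (measurable_fun_eval t_ge0)).
  + by move=> w _; rewrite gee0_abs ?law_ge0 //= normr1 law_le1.
  + exact: integrable_one.
- by move=> B nB; exact: hA.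
Qed.

End markov.

Theorem proposition5p8 (R : realType) (S : countType)
    (S_infinite : infinite_set [set: S])
    (c : opair S -> R) (c_ge0 : forall p, 0 <= c p)
    (P : probability (borel (driving R S)) R) (P_law : poisson_law P c)
    (t0 : R) (t0_gt0 : 0 < t0) (SEP : sep_assumption P t0) :
  exists2 Q : config S -> probability (borel (cadlag R (config S))) R,
    (forall (sigma : config S) (A : set (borel (cadlag R (config S)))),
       measurable A -> Q sigma A = graphical_law P t0 sigma A) &
    markov_process Q.
Proof.
exists (sep_law t0_gt0 P).
  by move=> sigma A; exact: (sep_law_graphical t0_gt0 c_ge0 P_law SEP).
exact: (sep_law_markov_process t0_gt0 c_ge0 P_law SEP).
Qed.
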